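(* Let $\beta=\{\beta_k\}_{k\ge0}$ be non-negative reals with $\beta_0=\beta_1=0<\beta_2$, let $\beta(x)=\sum_{k\ge2}\beta_kx^k$, assume $\beta'(1)<\infty$, let $g=\inf\{x\in[0,1):\beta'(x)+\log(1-x)<0\}$, and assume $\beta'(x)+\log(1-x)>0$ for all $x\in(0,g)$. For each $N$ let $\Lambda$ be a Poisson($\beta$) random hypergraph on $V=\{1,\dots,N\}$, and fix a vertex $v_0$. Let $T^N$ be the number of vertices in the domain of $v_0$, $Z^N$ the number of hyperedges identifiable from $v_0$, $\bar T^N=N^{-1}T^N$, $\bar Z^N=N^{-1}Z^N$. Let $\{\xi_n\}_{n\ge0}$ be a random walk on $\mathbb Z$ with $\xi_0=1$ and i.i.d. increments distributed as $-1+\mathrm{Poisson}(2\beta_2)$, and $M=\inf\{n\ge0:\xi_n=0\}\in\mathbb N\cup\{\infty\}$. Set $\bar T=g\,\mathbf 1_{\{M=\infty\}}$ and $\bar Z=[\beta(g)-(1-g)\log(1-g)]\mathbf 1_{\{M=\infty\}}$. Then, as $N\to\infty$, $(T^N,Z^N)\to(M,M)$ in distribution (with $M$ taking values in the one-point compactification $\mathbb N\cup\{\infty\}$) and $(\bar T^N,\bar Z^N)\to(\bar T,\bar Z)$ in distribution.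
   Context: A hypergraph on $V$ is a map $\Lambda:2^V\to\{0,1,2,\dots\}$ ($\Lambda(A)$ = number of hyperedges equal to $A$). A Poisson($\beta$) random hypergraph on $V=\{1,\dots,N\}$: the $\Lambda(A)$, $A\subset V$, are independent Poisson with mean $N\beta_{|A|}/\binom{N}{|A|}$. For $S\subset V$, $\Lambda^S(A)=\sum_{B\supset A,\,B\setminus S=A}\Lambda(B)$. Hypergraph collapse: while some vertex $v$ has $\Lambda(\{v\})\ge1$, choose one, replace $V$ by $V\setminus\{v\}$ and $\Lambda$ by $\Lambda^{\{v\}}$; removed vertices are identifiable and a hyperedge is identifiable if all its vertices are. For patch-free $\Lambda$, a vertex is in the domain of $v_0$ if it is identifiable in $\Lambda+\mathbf 1_{\{v_0\}}$ (one extra hyperedge $\{v_0\}$ added), and a hyperedge is identifiable from $v_0$ if it is identifiable in $\Lambda+\mathbf 1_{\{v_0\}}$. *)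

(* Defs.v *)
From HB Require Import structures.
From mathcomp Require Import all_boot all_order all_algebra.
From mathcomp Require Import all_classical all_reals all_analysis.
Set Implicit Arguments. Unset Strict Implicit. Unset Printing Implicit Defensive.
Import Order.TTheory GRing.Theory Num.Theory numFieldNormedType.Exports.

Local Open Scope ring_scope.

Section Defs.
Variable R : realType.

Definition poisson_pmf (m : R) (k : nat) : R := expR (- m) * m ^+ k / (k`!)%:R.

Definition Edisc (T : choiceType) (p : T -> R) (h : T -> R) : R :=
  fine (\esum_(t in setT) (p t * Num.max (h t) 0)%:E)%E
  - fine (\esum_(t in setT) (p t * Num.max (- h t) 0)%:E)%E.

Definition conv_in_dist (S : topologicalType) (Ω : nat -> choiceType)
  (p : forall n, Ω n -> R) (X : forall n, Ω n -> S)
  (Ω' : choiceType) (q : Ω' -> R) (Y : Ω' -> S) : Prop :=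
  forall f : S -> R, continuous f -> (exists C : R, forall s, `|f s| <= C) ->
    ((fun n => Edisc (p n) (f \o X n)) @ \oo --> Edisc q (f \o Y))%classic.

Variable beta : nat -> R.
Definition betaF (x : R) : R := fine (\esum_(k in setT) (beta k * x ^+ k)%:E)%E.
Definition betaD (x : R) : R :=
  fine (\esum_(k in setT) (k%:R * beta k * x ^+ k.-1)%:E)%E.
Definition gcrit : R := inf [set x : R | 0 <= x < 1 /\ betaD x + ln (1 - x) < 0]%classic.

Definition hypergraph N := {ffun {set 'I_N} -> nat}.

Definition hyp_pmf N (L : hypergraph N) : R :=
  \prod_(A : {set 'I_N}) poisson_pmf (N%:R * beta #|A| / ('C(N, #|A|))%:R) (L A).

Definition collapse1 N (L : hypergraph N) (v : 'I_N) : hypergraph N :=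
  [ffun A => \sum_(B : {set 'I_N} | B :\ v == A) L B].

Fixpoint valid_run N (L : hypergraph N) (s : seq 'I_N) : bool :=
  if s is v :: s' then (0 < L [set v])%N && valid_run (collapse1 L v) s' else true.

Definition run_result N (L : hypergraph N) (s : seq 'I_N) : hypergraph N :=
  foldl (@collapse1 N) L s.

Definition identifiable N (L : hypergraph N) (v : 'I_N) : Prop :=
  exists s : seq 'I_N, [/\ valid_run L s,
    (forall w : 'I_N, run_result L s [set w] = 0%N) & v \in s].

Definition add_single N (L : hypergraph N) (v0 : 'I_N) : hypergraph N :=
  [ffun A => (L A + (A == [set v0]))%N].

Definition domain N (L : hypergraph N) (v0 : 'I_N) : {set 'I_N} :=
  [set v | `[< identifiable (add_single L v0) v >]].

Definition TN N (L : hypergraph N) (v0 : 'I_N) : nat := #|domain L v0|.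
Definition ZN N (L : hypergraph N) (v0 : 'I_N) : nat :=
  (\sum_(A : {set 'I_N} | A \subset domain L v0) add_single L v0 A)%N.

(* increments x_1..x_n (Poisson(2 beta_2) parts) give M = n iff
   xi_m = 1 + sum_{i<m} (x_i - 1) > 0 for m < n and xi_n = 0 *)
Definition hits_at n (x : {ffun 'I_n -> nat}) : bool :=
  [forall m : 'I_n, (m < 1 + \sum_(i : 'I_n | (i < m)%N) x i)%N]
  && (1 + \sum_(i : 'I_n) x i == n)%N.

Definition PM (n : nat) : R :=
  fine (\esum_(x in [set x : {ffun 'I_n -> nat} | hits_at x]%classic)
          (\prod_(i : 'I_n) poisson_pmf (2 * beta 2) (x i))%:E)%E.

Definition PMinf : R := 1 - fine (\esum_(n in setT) (PM n)%:E)%E.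

Definition M_law (m : one_point_compactification nat) : R :=
  if m is Some n then PM n else PMinf.

End Defs.

(* Main.v *)
Require Import Defs.
From HB Require Import structures.
From mathcomp Require Import all_boot all_order all_algebra.
From mathcomp Require Import all_classical all_reals all_analysis.
From mathcomp Require Import zify ring lra.
Import Order.TTheory GRing.Theory Num.Theory numFieldNormedType.Exports.

(**
The set of vertices found by collapsing from [v0] is the least set [S] containing [v0] such that
no hyperedge has exactly one vertex outside [S]. The event that the domain is [S] is the
intersection of two independent events: the hyperedges inside [S] generate [S] from [v0], and no
hyperedge has exactly one vertex outside [S]. Summing over [S] in an arbitrary vertex set gives a
triangular system of equations which determines the generation probabilities from the rates [r k]
at which hyperedges point from a set of size [k] to a given outside vertex. The same system is
satisfied by independent arrival times [tau w] with [P (tau w >= k) = exp (- r k)], so the size of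
the domain has the law of the first time [k] before which fewer than [k] vertices have arrived.
Fixed-time marginals of this process are binomial, and Chernoff bounds show that the size is either
bounded or close to [g N]; the law of a bounded size converges to the first passage law [PM].
For the hyperedges, the exponential moment of their number on the event that the domain has size
[k] is the probability of the same event for multiplied means, up to an explicit factor, which gives
concentration around the mean number of hyperedges revealed.
*)
Set Implicit Arguments. Unset Strict Implicit. Unset Printing Implicit Defensive.
Local Open Scope ring_scope.

(** * The domain as a closure *)

(** The collapse is never followed step by step: vertices are removed in an arbitrary order, and
    conditioning on a removal biases the hyperedges not yet seen. All probabilities concern the
    static events [cl v0 U E == S], for which independence of disjoint families of Poisson variables
    suffices. In the triangular system the leading unknown has coefficient 1, since no vertex is
    left outside when [S] is the whole set; the arrival process enters only as another solution,
    without any coupling to the hypergraph. Its one-dimensional form explains [g]: about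
    [(1 - expR (- betaD x)) * N] vertices arrive before time [x * N], which exceeds [x * N] exactly
    when [betaD x + ln (1 - x) > 0]. For bounded sizes, the generation probabilities and the first
    passage law are both weighted counts of parking functions, which identifies the limit. The
    exponential moment of the hyperedges stays computable because those with exactly one vertex
    outside the domain are absent: counting them in the exponent changes nothing on the event, and
    then all relevant rates are multiplied by one common factor. *)

Section Closure.
Import boot.fintype boot.finset.
Variables (V : finType) (v0 : V).
Implicit Types (U S : {set V}) (E : {set {set V}}) (w : V).

(** The vertex set [U] is a parameter because the analysis of [cl U E == S] runs the same closure
    again inside the smaller set [S]. A singleton hyperedge is allowed: its vertex is reachable from
    any [S]. *)
Definition reach U E S : {set V} :=
  v0 |: [set w in U | [exists B in E, [&& B \subset U, w \in B & B :\ w \subset S]]].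

Lemma reach_mono U E : {homo reach U E : S S' / S \subset S'}.
Proof.
move=> S S' sSS'; apply: finset.setUS; apply/subsetP => w; rewrite !inE.
case/andP=> -> /= /exists_inP[B BE /and3P[BU wB BS]].
by apply/exists_inP; exists B => //; rewrite BU wB (subset_trans BS).
Qed.

Definition cl U E : {set V} := fixset (reach U E).

Lemma clK U E : reach U E (cl U E) = cl U E.
Proof. exact: fixsetK (@reach_mono U E). Qed.

Lemma cl_min U E S : reach U E S \subset S -> cl U E \subset S.
Proof.
move=> cS; rewrite /cl /fixset; elim: #|V| => [|n IHn] /=; first by rewrite finset.sub0set.
exact: subset_trans (@reach_mono U E _ _ IHn) cS.
Qed.

Lemma cl_v0 U E : v0 \in cl U E.
Proof. by rewrite -clK setU11. Qed.

Lemma cl_step U E B w : B \in E -> B \subset U -> w \in B ->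
  B :\ w \subset cl U E -> w \in cl U E.
Proof.
move=> BE BU wB BS; rewrite -clK !inE (subsetP BU) //=.
by apply/orP; right; apply/exists_inP; exists B => //; rewrite BU wB.
Qed.

Lemma cl_sub U E : v0 \in U -> cl U E \subset U.
Proof.
by move=> v0U; apply: cl_min; rewrite subUset sub1set v0U; apply/subsetP => w; rewrite inE => /andP[].
Qed.

Lemma reach_closed U E S : v0 \in S ->
  (forall B w, B \in E -> B \subset U -> w \in B -> B :\ w \subset S -> w \in S) ->
  reach U E S \subset S.
Proof.
move=> v0S cS; rewrite subUset sub1set v0S; apply/subsetP => w; rewrite inE.
by case/andP=> wU /exists_inP[B BE /and3P[BU wB BS]]; exact: cS BS.
Qed.

Lemma setD_eq1 B S w : (B :\: S == [set w]) = [&& w \in B, w \notin S & B :\ w \subset S].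
Proof.
apply/eqP/and3P => [e|[wB wS BS]].
  have: w \in B :\: S by rewrite e set11.
  rewrite inE => /andP[wS wB]; split=> //; apply/subsetP => x.
  rewrite !inE => /andP[xw xB]; apply/negPn/negP => xS.
  have: x \in B :\: S by rewrite inE xS.
  by rewrite e inE (negPf xw).
apply/setP => x; rewrite !inE; apply/andP/eqP => [[xS xB]|-> //].
apply/eqP; apply: contraNT xS => xw; apply: (subsetP BS).
by rewrite !inE xw.
Qed.

(** Both inclusions are minimality of a fixpoint: if no hyperedge in [U] has exactly one vertex
    outside [S], then [S] is closed in [U]; and [cl U E] is closed for the hyperedges inside [S].
    The last two conditions look at disjoint families of hyperedges. *)
Lemma cl_eq U E S : v0 \in U ->
  (cl U E == S) = [&& S \subset U, cl S E == S &
    [forall B in E, (B \subset U) ==> (#|B :\: S| != 1%N)]].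
Proof.
move=> v0U; apply/eqP/and3P => [<-|[SU /eqP SS /forall_inP nB]].
  split; first exact: cl_sub.
    rewrite eqEsubset cl_sub ?cl_v0 //=; apply: cl_min.
    apply: reach_closed; first exact: cl_v0.
    move=> B w BE BU wB BS.
    have BcS : B :\ w \subset cl U E.
      by apply: subset_trans BS (cl_sub _ _); exact: cl_v0.
    have wcl := cl_step BE BU wB BcS.
    apply: cl_step BS => //; apply/subsetP => x xB.
    by case: (eqVneq x w) => [->//|xw]; apply: (subsetP BcS); rewrite !inE xw.
  apply/forall_inP => B BE; apply/implyP => BU; apply/negP => /cards1P[w /eqP].
  rewrite setD_eq1 => /and3P[wB wS BS].
  by rewrite (cl_step BE) in wS.
apply/eqP; rewrite eqEsubset; apply/andP; split.
  apply: cl_min; apply: reach_closed; first by rewrite -SS cl_v0.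
  move=> B w BE BU wB BS; apply/negPn/negP => wS.
  move/implyP: (nB _ BE) => /(_ BU); apply/negP; rewrite negbK.
  by apply/cards1P; exists w; apply/eqP; rewrite setD_eq1 wB wS.
rewrite -{1}SS; apply: cl_min; apply: reach_closed; first exact: cl_v0.
by move=> B w BE BU wB BS; apply: cl_step BS => //; exact: subset_trans BU SU.
Qed.

(** Source of the independence in [perc_cl]: resampling a hyperedge that sticks out of [S] does not
    affect [cl S E]. *)
Lemma cl_inside U E : cl U E = cl U [set B in E | B \subset U].
Proof.
rewrite /cl; apply: eq_iter => S; congr (_ |: _); apply/setP => w; rewrite !inE.
congr (_ && _); apply/exists_inP/exists_inP => -[B BE /and3P[BU wB BS]]; exists B.
- by rewrite inE BE.
- by rewrite BU wB.
- by move: BE; rewrite inE => /andP[].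
- by rewrite BU wB.
Qed.

End Closure.
Definition supp (I : finType) (L : {ffun I -> nat}) : {set I} := [set i | 0 < L i]%N.

(** * Collapse runs compute the closure *)

Section Domain.
Import boot.fintype boot.finset.
Local Open Scope nat_scope.
Variables (N : nat).
Implicit Types (L : hypergraph N) (s : seq 'I_N) (v w : 'I_N).

Lemma run_resultE L s A :
  run_result L s A = \sum_(B : {set 'I_N} | B :\: [set x in s] == A) L B.
Proof.
elim: s L A => [|v s IHs] L A /=.
  rewrite (eq_bigl (pred1 A)) ?big_pred1_eq // => B /=.
  by congr (_ == _); apply/setP => x; rewrite !inE.
rewrite [LHS](IHs (collapse1 L v)) [RHS](partition_big (fun B : {set 'I_N} => B :\ v)
  (fun B : {set 'I_N} => B :\: [set x in s] == A)) /=.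
  apply: eq_bigr => C /eqP CA; rewrite ffunE; apply: eq_bigl => B.
  apply/idP/idP => [/eqP e|/andP[_ ->//]].
  rewrite -e in CA; rewrite e eqxx andbT -CA; apply/eqP/setP => x.
  by rewrite !inE negb_or; case: (x == v); case: (x \in s).
move=> B /eqP <-; apply/eqP/setP => x.
by rewrite !inE negb_or; case: (x == v); case: (x \in s).
Qed.

Lemma valid_run_rcons L s v :
  valid_run L (rcons s v) = valid_run L s && (0 < run_result L s [set v]).
Proof.
elim: s L => [|w s IHs] L /=; first by rewrite andbT.
by rewrite IHs andbA.
Qed.

Lemma run_result_gt0 L s A :
  reflect (exists2 B, 0 < L B & B :\: [set x in s] = A) (0 < run_result L s A).
Proof.
rewrite run_resultE lt0n sum_nat_eq0 negb_forall; apply: (iffP existsP).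
  by case=> B; rewrite negb_imply -lt0n => /andP[/eqP e LB]; exists B.
by case=> B LB e; exists B; rewrite negb_imply -lt0n LB e eqxx.
Qed.

Lemma valid_run_uniq L s : valid_run L s -> uniq s.
Proof.
elim/last_ind: s => [//|s v IHs]; rewrite valid_run_rcons rcons_uniq.
case/andP=> /IHs -> /run_result_gt0[B _ e]; rewrite andbT.
have: v \in B :\: [set x in s] by rewrite e set11.
by rewrite !inE => /andP[].
Qed.

Lemma run_sub_cl L v0 s : valid_run (add_single L v0) s ->
  {subset s <= cl v0 setT (supp L)}.
Proof.
elim/last_ind: s => [//|s v IHs]; rewrite valid_run_rcons.
case/andP=> /IHs sub /run_result_gt0[B LB /eqP]; rewrite setD_eq1 => /and3P[vB vs Bs].
have {}sub : [set x in s] \subset cl v0 setT (supp L).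
  by apply/subsetP => x; rewrite inE; exact: sub.
move=> x; rewrite mem_rcons inE => /predU1P[->|xs]; last by rewrite (subsetP sub) ?inE.
move: LB; rewrite ffunE addn_gt0 lt0b => /orP[LB|/eqP Bv].
  by apply: (@cl_step _ _ _ _ B) => //; rewrite ?inE ?subsetT //; exact: subset_trans Bs sub.
by move: vB; rewrite Bv inE => /eqP ->; exact: cl_v0.
Qed.

Lemma cl_sub_run L v0 s :
  (forall w, run_result (add_single L v0) s [set w] = 0) ->
  cl v0 setT (supp L) \subset [set x in s].
Proof.
move=> fin; apply: cl_min; apply: reach_closed.
  rewrite inE; apply/negPn/negP => v0s.
  have : 0 < run_result (add_single L v0) s [set v0].
    apply/run_result_gt0; exists [set v0]; first by rewrite ffunE eqxx addn1.
    by apply/eqP; rewrite setD_eq1 set11 inE v0s setDv finset.sub0set.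
  by rewrite fin.
move=> B w; rewrite [B \in _]inE => LB _ wB Bs; apply/negPn/negP => ws.
have : 0 < run_result (add_single L v0) s [set w].
  apply/run_result_gt0; exists B; first by rewrite ffunE addn_gt0 LB.
  by apply/eqP; rewrite setD_eq1 wB ws.
by rewrite fin.
Qed.

Lemma complete_run L : exists2 s, valid_run L s & forall w, run_result L s [set w] = 0.
Proof.
(* Either some run cannot be extended, or runs of every length exist; valid runs have distinct
   vertices, which excludes length [N.+1]. *)
suff H k : (exists2 s, valid_run L s & forall w, run_result L s [set w] = 0) \/
           (exists2 s, valid_run L s & size s = k).
  case: (H N.+1) => // -[s /valid_run_uniq us ss].
  by have := uniq_leq_size us (fun x _ => mem_enum 'I_N x); rewrite size_enum_ord ss ltnn.
elim: k => [|k [IHk|[s vs ss]]]; [by right; exists [::] | by left |].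
have [/existsP[v vP]|] := boolP [exists v, 0 < run_result L s [set v]].
  by right; exists (rcons s v); rewrite ?valid_run_rcons ?vs ?size_rcons ?ss.
rewrite negb_exists => /forallP fin; left; exists s => // w.
by apply/eqP; rewrite -leqn0 leqNgt fin.
Qed.

(** Confluence of the collapse: every valid run stays inside the closure, and any list whose result
    has no singleton covers it. Existence of one complete run then makes every vertex of the closure
    identifiable. *)
Lemma domainE L v0 : Defs.domain L v0 = cl v0 setT (supp L).
Proof.
have [s vs fin] := complete_run (add_single L v0).
have e : cl v0 setT (supp L) = [set x in s].
  apply/eqP; rewrite eqEsubset cl_sub_run //=.
  by apply/subsetP => x; rewrite inE; exact: run_sub_cl.
apply/setP => v; rewrite inE; apply/asboolP/idP => [[s' [vs' _ vs'v]]|].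
  exact: run_sub_cl vs'v.
by rewrite e inE => vs'; exists s.
Qed.

(** The successor is the added hyperedge at [v0]; later bounds therefore speak of [(ZN L v0).-1]. *)
Lemma ZNE L v0 : ZN L v0 = (\sum_(A : {set 'I_N} | A \subset Defs.domain L v0) L A).+1.
Proof.
rewrite /ZN; under eq_bigr do rewrite ffunE; rewrite big_split /= -addn1; congr (_ + _).
rewrite (bigD1 [set v0]) /=; last by rewrite sub1set domainE cl_v0.
by rewrite eqxx big1 // => A /andP[_ /negPf->].
Qed.

(** Each removal of a vertex [v] can be charged to a hyperedge that contains [v] and otherwise only
    removed vertices, so that it becomes identifiable at this very step. Thanks to this
    deterministic bound only an upper bound on [ZN] is needed for bounded sizes. *)
Lemma leq_TN_ZN L v0 : TN L v0 <= ZN L v0.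
Proof.
have [s vs fin] := complete_run (add_single L v0).
have e : Defs.domain L v0 = [set x in s].
  apply/eqP; rewrite domainE eqEsubset cl_sub_run //=.
  by apply/subsetP => x; rewrite inE; exact: run_sub_cl.
rewrite /TN /ZN {}e {fin}.
have /card_uniqP us := valid_run_uniq vs.
rewrite (eq_card (B := mem s)) => [|x]; last by rewrite inE.
rewrite us {us}.
elim/last_ind: s vs => [//|s v IHs]; rewrite valid_run_rcons size_rcons.
case/andP=> /IHs {}IHs /run_result_gt0[B LB /eqP]; rewrite setD_eq1 => /and3P[vB vs Bs].
have sub (A : {set 'I_N}) : A \subset [set x in s] -> A \subset [set x in rcons s v].
  by move=> /subset_trans; apply; apply/subsetP => x; rewrite !inE mem_rcons inE orbC => ->.
rewrite (bigID (fun A : {set 'I_N} => A \subset [set x in s])) /= -addn1; apply: leq_add.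
  apply: leq_trans IHs _; rewrite leq_eqVlt; apply/orP; left; apply/eqP/eq_bigl => A.
  by apply/idP/andP => [As|[]//]; split=> //; exact: sub.
rewrite (bigD1 B) /=; first by rewrite addn_gt0 LB.
apply/andP; split.
  apply/subsetP => x xB; rewrite inE mem_rcons inE.
  case: (eqVneq x v) => //= xv; have := subsetP Bs x; rewrite !inE xv => H; exact: H.
by apply: contra vs => /subsetP /(_ v vB).
Qed.

End Domain.

(** * Finite product measures *)

Section ProductWeight.
Import boot.fintype boot.finset.
Variables (R : comNzRingType) (I J : finType) (q : I -> J -> R).
Hypothesis q1 : forall i, \sum_a q i a = 1.
Implicit Types (x : {ffun I -> J}) (h : {ffun I -> J} -> R).

Definition upd x i a : {ffun I -> J} := [ffun j => if j == i then a else x j].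
Definition wprod x : R := \prod_i q i (x i).
Definition wsum h : R := \sum_x wprod x * h x.

(** Exchanging the value at [i] with an independent copy is a weight-preserving involution. All
    independence statements below come from it. *)
Lemma wsum_resample i h : wsum h = wsum (fun x => \sum_a q i a * h (upd x i a)).
Proof.
transitivity (\sum_(p : {ffun I -> J} * J) wprod p.1 * h p.1 * q i p.2).
  rewrite -(pair_bigA _ (fun x a => wprod x * h x * q i a)) /=.
  by apply: eq_bigr => x _; rewrite -mulr_sumr q1 mulr1.
pose f (p : {ffun I -> J} * J) := (upd p.1 i p.2, p.1 i).
have fK : involutive f.
  case=> x a; rewrite /f /=; congr (_, _); last by rewrite ffunE eqxx.
  by apply/ffunP => j; rewrite !ffunE; case: eqVneq => [->|].
rewrite (reindex_inj (inv_inj fK)) /wsum /=.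
under [RHS]eq_bigr do rewrite mulr_sumr.
rewrite [RHS]pair_bigA /=; apply: eq_bigr => -[x a] _ /=.
rewrite /wprod !(bigD1 (P := predT) i) //= ffunE eqxx.
rewrite (eq_bigr (fun j => q j (x j))) => [|j /negPf ji]; last by rewrite ffunE ji.
by ring.
Qed.

Lemma wsum_indep i h g : (forall x a, h (upd x i a) = h x) ->
  wsum (fun x => h x * g (x i)) = wsum h * \sum_a q i a * g a.
Proof.
move=> hi; rewrite (wsum_resample i) /wsum mulr_suml; apply: eq_bigr => x _.
rewrite -mulrA; congr (_ * _); rewrite mulr_sumr; apply: eq_bigr => a _.
by rewrite hi ffunE eqxx mulrCA.
Qed.

Lemma wsum_indep_set (X : {set I}) h (g : I -> J -> R) :
  (forall i, i \in X -> forall x a, h (upd x i a) = h x) ->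
  wsum (fun x => h x * \prod_(i in X) g i (x i)) =
  wsum h * \prod_(i in X) \sum_a q i a * g i a.
Proof.
move=> hX; have: {subset enum X <= X} by move=> i; rewrite mem_enum.
suff H s : uniq s -> {subset s <= X} ->
    wsum (fun x => h x * \prod_(i <- s) g i (x i)) =
    wsum h * \prod_(i <- s) \sum_a q i a * g i a.
  move/(H _ (enum_uniq X)); rewrite big_enum /= => <-.
  by apply: eq_bigr => x _; rewrite big_enum.
elim: s => [|i s IHs] /=.
  by move=> _ _; rewrite big_nil mulr1; apply: eq_bigr => x _; rewrite big_nil mulr1.
case/andP=> si us sX; have iX : i \in X by apply: sX; exact: mem_head.
have {}IHs := IHs us (fun j js => sX j (mem_behead (s := i :: s) js)).
rewrite big_cons mulrCA mulrC -IHs -wsum_indep.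
  by apply: eq_bigr => x _; rewrite big_cons; ring.
move=> x a; rewrite hX //; congr (_ * _); apply: eq_big_seq => j js.
by rewrite ffunE; case: eqVneq => // ji; rewrite -ji js in si.
Qed.

Lemma wsum_prod (g : I -> J -> R) :
  wsum (fun x => \prod_i g i (x i)) = \prod_i \sum_a q i a * g i a.
Proof.
by rewrite bigA_distr_bigA; apply: eq_bigr => x _; rewrite -big_split.
Qed.

Lemma wsum1 : wsum (fun=> 1) = 1.
Proof.
have := wsum_prod (fun _ _ => 1); rewrite /wsum big1_eq => ->.
by rewrite big1 // => i _; under eq_bigr do rewrite mulr1.
Qed.

Lemma wsum_sum (T : finType) (P : pred T) (h : T -> {ffun I -> J} -> R) :
  wsum (fun x => \sum_(t | P t) h t x) = \sum_(t | P t) wsum (h t).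
Proof. by rewrite /wsum exchange_big /=; apply: eq_bigr => x _; rewrite mulr_sumr. Qed.

Lemma eq_wsum h h' : h =1 h' -> wsum h = wsum h'.
Proof. by move=> e; apply: eq_bigr => x _; rewrite e. Qed.

End ProductWeight.

(** * The generation probabilities *)

(* The numerical form of the statement that, among [m] vertices besides [v0], the domain of
   [v0] has exactly one size. It determines [th]. *)
Definition renewal (R : comNzRingType) (e th : nat -> R) (m : nat) : Prop :=
  \sum_(k < m.+1) 'C(m, k)%:R * th k * e k.+1 ^+ (m - k) = 1.

Section SumBySize.
Import boot.fintype boot.finset.
Variables (R : comNzRingType) (V : finType).

Lemma sum_subsets_card (U : {set V}) (f : nat -> R) :
  \sum_(S : {set V} | S \subset U) f #|S| = \sum_(k < #|U|.+1) 'C(#|U|, k)%:R * f k.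
Proof.
rewrite (partition_big (fun S : {set V} => inord #|S| : 'I_#|U|.+1) predT) //=.
apply: eq_bigr => k _.
transitivity (\sum_(A in [set A : {set V} | A \subset U & #|A| == k]) f k); last first.
  by rewrite sumr_const cards_draws mulr_natl.
apply: eq_big => [S|S /andP[SU /eqP <-]].
  rewrite inE; case SU: (S \subset U) => //=.
  by rewrite -val_eqE /= inordK // ltnS subset_leq_card.
by rewrite inordK // ltnS subset_leq_card.
Qed.

Lemma sum_subsets_card1 (U : {set V}) v0 (f : nat -> R) : v0 \in U ->
  \sum_(S : {set V} | (v0 \in S) && (S \subset U)) f #|S| =
  \sum_(k < #|U|) 'C(#|U|.-1, k)%:R * f k.+1.
Proof.
move=> v0U; have cU : #|U| = #|U :\ v0|.+1 by rewrite (cardsD1 v0) v0U.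
rewrite cU /= -(sum_subsets_card _ (fun k => f k.+1)).
rewrite (reindex_onto (fun S => v0 |: S) (fun S => S :\ v0)) /=; last first.
  by move=> S /andP[v0S _]; rewrite setD1K.
apply: eq_big => [S|S /andP[_ /eqP e]].
  rewrite setU11 subUset sub1set v0U /= subsetD1; congr (_ && _).
  by apply/eqP/idP => [<-|/setU1K//]; rewrite !inE eqxx.
by rewrite cardsU1 -{1}e !inE eqxx.
Qed.

(** The term [X = U] carries the power 0 of [e], hence coefficient 1, and the terms with [X] a
    proper subset agree by induction. Thus the leading unknowns cancel without any division, and
    [psi] is forced to depend on the cardinality alone. *)
Lemma renewal_unique (e th : nat -> R) (psi : {set V} -> R) (U : {set V}) :
  (forall m, (m <= #|U|)%N -> renewal e th m) ->
  (forall W : {set V}, W \subset U ->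
     \sum_(X : {set V} | X \subset W) psi X * e #|X|.+1 ^+ #|W :\: X| = 1) ->
  psi U = th #|U|.
Proof.
have [n] := ubnP #|U|; elim: n U => // n IHn U; rewrite ltnS => Un rth rpsi.
have := rth _ (leqnn _); rewrite /renewal.
under eq_bigr do rewrite -mulrA.
rewrite -(sum_subsets_card U (fun k => th k * e k.+1 ^+ (#|U| - k))).
rewrite -[RHS](rpsi U (subxx _)) !(bigD1 U (subxx _)) /= setDv cards0 subnn !expr0 !mulr1.
rewrite (eq_bigr (fun X => psi X * e #|X|.+1 ^+ #|U :\: X|)); first by move/addIr.
move=> X /andP[XU XnU]; rewrite cardsDS // IHn //.
- by apply: leq_trans Un; apply: proper_card; rewrite properEneq XnU.
- by move=> m mX; apply: rth; apply: leq_trans mX (subset_leq_card XU).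
- by move=> W WX; apply: rpsi; exact: subset_trans WX XU.
Qed.
End SumBySize.
(** Law of the indicator that a Poisson variable of mean [mu i] is positive: the domain sees
    multiplicities only through it, which makes the probability space finite. *)
Definition bern (R : realType) (I : finType) (mu : I -> R) (i : I) (b : bool) : R :=
  if b then 1 - expR (- mu i) else expR (- mu i).

Lemma bern1 (R : realType) (I : finType) (mu : I -> R) i : \sum_b bern mu i b = 1.
Proof. by rewrite big_bool /= subrK. Qed.

Definition edges (I : finType) (x : {ffun I -> bool}) : {set I} := [set i | x i].

Section Percolation.
Import boot.fintype boot.finset.
Variables (R : realType) (V : finType) (v0 : V).
Implicit Types (mu : {set V} -> R) (U S : {set V}).

Definition perc mu (ev : pred {set {set V}}) : R :=
  wsum (bern mu) (fun x => (ev (edges x))%:R).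

Definition bdry U S : {set {set V}} := [set B : {set V} | (B \subset U) && (#|B :\: S| == 1%N)].

Lemma perc_cl mu U S : v0 \in U -> S \subset U ->
  perc mu (fun E => cl v0 U E == S) =
  perc mu (fun E => cl v0 S E == S) * expR (- \sum_(B in bdry U S) mu B).
Proof.
move=> v0U SU.
have e x : ((cl v0 U (edges x) == S)%:R : R) =
  (cl v0 S (edges x) == S)%:R * \prod_(B in bdry U S) (~~ x B)%:R.
  rewrite cl_eq // SU /=; case: eqP => _ /=; rewrite ?mul0r // mul1r.
  case: (boolP [forall B in edges x, (B \subset U) ==> (#|B :\: S| != 1%N)]) => [/forall_inP H|/forall_inPn[B]].
    rewrite big1 // => B; rewrite inE => /andP[BU B1].
    case xB: (x B) => //; have := H B; rewrite inE xB BU B1 => /(_ isT).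
    by [].
  rewrite inE negb_imply negbK => xB /andP[BU B1].
  by rewrite (bigD1 B) ?inE ?BU //= xB mul0r.
rewrite /perc (eq_wsum _ e).
rewrite (wsum_indep_set (bern1 mu) (fun (_ : {set V}) b => (~~ b)%:R)).
  congr (_ * _); rewrite -sumrN expR_sum; apply: eq_bigr => B _.
  by rewrite big_bool /= mulr0 mulr1 add0r.
move=> B; rewrite inE => /andP[BU /cards1P[w Bw]] x a.
rewrite cl_inside [in RHS]cl_inside; congr (nat_of_bool (cl _ _ _ == _))%:R.
apply/setP => A; rewrite !inE ffunE; case: eqVneq => // ->.
have /negPf -> : ~~ (B \subset S).
  have : w \in B :\: S by rewrite Bw set11.
  by rewrite inE => /andP[wS wB]; apply/subsetPn; exists w.
by rewrite !andbF.
Qed.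

Lemma perc_cl_total mu U : v0 \in U ->
  \sum_(S : {set V} | (v0 \in S) && (S \subset U)) perc mu (fun E => cl v0 U E == S) = 1.
Proof.
move=> v0U; rewrite -wsum_sum -[RHS](wsum1 (bern1 mu)); apply: eq_wsum => x.
rewrite (bigD1 (cl v0 U (edges x))) /=; last by rewrite cl_v0 cl_sub.
by rewrite eqxx big1 ?addr0 // => S /andP[_ /negPf]; rewrite eq_sym => ->.
Qed.

(** Restricted to subsets of [U], because the tilted means used for the hyperedge count have uniform
    rates only inside the domain under consideration. *)
Definition rates mu (r : nat -> R) U := forall S w, v0 \in S -> S \subset U ->
  w \in U -> w \notin S -> \sum_(B : {set V} | B :\: S == [set w]) mu B = r #|S|.

Lemma sum_bdry mu r U S : rates mu r U -> v0 \in S -> S \subset U ->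
  \sum_(B in bdry U S) mu B = r #|S| *+ #|U :\: S|.
Proof.
move=> rmu v0S SU.
(* Hyperedges are sorted by their unique vertex outside [S]; the default [v0] is never reached. *)
rewrite (partition_big (fun B => odflt v0 [pick w in B :\: S]) (mem (U :\: S))) /=; last first.
  move=> B; rewrite inE => /andP[BU /cards1P[w Bw]].
  case: pickP => [x|/(_ w)]; last by rewrite Bw set11.
  by rewrite !inE => /andP[-> /(subsetP BU)].
rewrite -sumr_const; apply: eq_bigr => w; rewrite inE => /andP[wS wU].
rewrite -(rmu S w) //; apply: eq_bigl => B; rewrite inE.
apply/idP/eqP => [/andP[/andP[BU /cards1P[x Bx]] /eqP]|Bw].
  case: pickP => [y|/(_ x)]; last by rewrite Bx set11.
  by rewrite Bx inE => /eqP -> /= ->.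
rewrite Bw cards1 eqxx andbT; apply/andP; split.
  apply/subsetP => x xB; case xS: (x \in S); first exact: (subsetP SU).
  have : x \in B :\: S by rewrite inE xS.
  by rewrite Bw inE => /eqP ->.
by case: pickP => [y|/(_ w)]; [rewrite inE => /eqP ->|rewrite set11].
Qed.

Lemma rates_sub mu r U U' : U' \subset U -> rates mu r U -> rates mu r U'.
Proof.
move=> UU rmu S w v0S SU wU wS; apply: rmu => //; first exact: subset_trans SU UU.
exact: (subsetP UU).
Qed.

(** Total probability over the domain inside [v0 |: W], for each [W], is exactly the system of
    [renewal_unique]; the unknowns are indexed by the domain with [v0] removed. *)
Lemma perc_clE mu r th U : v0 \in U -> rates mu r U ->
  (forall m, (m < #|U|)%N -> renewal (fun k => expR (- r k)) th m) ->
  perc mu (fun E => cl v0 U E == U) = th #|U|.-1.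
Proof.
move=> v0U rmu rth; pose psi X := perc mu (fun E => cl v0 (v0 |: X) E == v0 |: X).
have cU : #|U :\ v0| = #|U|.-1 by rewrite [in RHS](cardsD1 v0) v0U.
transitivity (psi (U :\ v0)); first by rewrite /psi setD1K.
rewrite -cU; apply: (renewal_unique (e := fun k => expR (- r k))) => [m|W WU].
  by rewrite cU => mU; apply: rth; rewrite -(ltn_predK (m := 0) (n := #|U|)) //; apply/card_gt0P; exists v0.
have v0W : v0 \notin W by apply/negP => /(subsetP WU); rewrite !inE eqxx.
have WU' : v0 |: W \subset U.
  by rewrite subUset sub1set v0U; apply: subset_trans WU (subsetDl _ _).
rewrite -[RHS](perc_cl_total mu (setU11 v0 W)).
rewrite [RHS](reindex_onto (fun X => v0 |: X) (fun X => X :\ v0)) /=; last first.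
  by move=> S /andP[v0S _]; rewrite setD1K.
apply: eq_big => [X|X XW].
  rewrite setU11 subUset sub1set setU11 /=; apply/idP/andP => [XW|[XW /eqP <-]].
    have v0X : v0 \notin X by apply: contra v0W => /(subsetP XW).
    by rewrite (subset_trans XW (subsetUr _ _)) setU1K.
  by rewrite -(setU1K v0W) finset.setSD // subUset sub1set setU11.
have v0X : v0 \notin X by apply: contra v0W => /(subsetP XW).
have XW' : v0 |: X \subset v0 |: W by apply: setUS.
rewrite perc_cl ?setU11 // /psi; congr (_ * _).
rewrite (sum_bdry (rates_sub WU' rmu)) ?setU11 // cardsU1 v0X -mulNrn -mulr_natr expRM_natr.
  congr (expR _ ^+ _).
  apply: eq_card => x; rewrite !inE negb_or.
  by case: eqVneq => [->|] //=; rewrite (negPf v0W) andbF.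
Qed.

End Percolation.

(** * Independent arrival times *)

Section Arrivals.
Import boot.fintype boot.finset.
Variables (R : realType) (e : nat -> R).
Hypothesis e0 : e 0%N = 1.

(* An arrival time [a < K] has probability [e a - e a.+1]; the value [K] stands for "never". *)
Definition arr K (a : 'I_K.+1) : R := if (a < K)%N then e a - e a.+1 else e K.

Lemma sum_arr_tail K k : (k <= K)%N -> \sum_(a < K.+1) arr a * (k <= a)%N%:R = e k.
Proof.
move=> kK; rewrite big_ord_recr /= /arr ltnn kK mulr1.
under eq_bigr => a _ do rewrite /= ltn_ord.
rewrite (eq_bigr (fun a : 'I_K => (fun i => (e i - e i.+1) * (k <= i)%N%:R) a)) //.
rewrite -(big_mkord xpredT (fun i => (e i - e i.+1) * (k <= i)%N%:R)).
rewrite (big_cat_nat (n := k)) //= big_nat big1 ?add0r; last first.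
  by move=> i /andP[_ ik]; rewrite leqNgt ik mulr0.
rewrite big_nat (eq_bigr (fun i => - (e i.+1 - e i))) => [|i /andP[-> _]]; last first.
  by rewrite mulr1 opprB.
by rewrite -big_nat sumrN telescope_sumr // opprB subrK.
Qed.

Lemma sum_arr K : \sum_(a < K.+1) arr a = 1.
Proof. by rewrite -[RHS]e0 -(sum_arr_tail (leq0n K)); apply: eq_bigr => a _; rewrite mulr1. Qed.

Section Space.
Variables (V : finType) (K : nat).
Implicit Types (X W : {set V}) (x : {ffun V -> 'I_K.+1}).

Definition before X x k := #|[set j in X | x j < k]|%N.

(** A queue with one service per unit of time and [v0] as its first customer never empties before
    all of [X] has arrived. This is the condition defining parking functions. *)
Definition good X x := [forall j in X, x j <= #|X|]%N &&
  [forall l : 'I_#|X|.+1, l <= before X x l]%N.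

(* [X] is the set of arrivals in [W] up to the first time at which fewer vertices have arrived
   than time units have passed. *)
Definition hit W X x := good X x && [forall j in W :\: X, #|X| < x j]%N.

Definition theta X : R := wsum (fun=> @arr K) (fun x => (good X x)%:R).

Lemma hit_before W X x : X \subset W -> hit W X x ->
  X = [set j in W | x j < #|X|.+1]%N.
Proof.
move=> XW /andP[/andP[/forall_inP gX _] /forall_inP hX]; apply/setP => j; rewrite !inE ltnS.
case jX: (j \in X); first by rewrite (subsetP XW) // gX.
case jW: (j \in W) => //=; apply/esym/negbTE; rewrite -ltnNge.
by apply: hX; rewrite !inE jX jW.
Qed.

Lemma hit_leq W X x l : X \subset W -> hit W X x -> (l <= #|X|)%N -> (l <= before W x l)%N.
Proof.
move=> XW /andP[/andP[_ /forallP gX] _]; rewrite -ltnS => lX.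
apply: leq_trans (gX (Ordinal lX)) _; apply: subset_leq_card.
by apply/subsetP => j; rewrite !inE => /andP[/(subsetP XW) -> ->].
Qed.

(* The only candidate for [X] is the set of arrivals before the first [n] with fewer than [n]
   arrivals before [n]. *)
Lemma hit_unique W x : (\sum_(X : {set V} | X \subset W) hit W X x = 1)%N.
Proof.
have H : exists n, (before W x n < n)%N.
  by exists #|W|.+1; rewrite ltnS; apply: subset_leq_card; apply/subsetP => j; rewrite inE => /andP[].
case: (ex_minnP H) => n nP nmin {H}.
have n0 : (0 < n)%N by case: (n) nP.
pose X := [set j in W | x j < n]%N.
have cX : #|X|.+1 = n.
  apply/eqP; rewrite eqn_leq nP /=.
  have : (n.-1 <= before W x n.-1)%N.
    by rewrite leqNgt; apply/negP => /nmin; rewrite -ltnS prednK // ltnn.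
  rewrite -ltnS prednK // => /leq_trans -> //; rewrite ltnS; apply: subset_leq_card.
  apply/subsetP => j; rewrite !inE => /andP[-> xj] /=.
  by apply: leq_trans xj (leq_pred _).
have XW : X \subset W by apply/subsetP => j; rewrite inE => /andP[].
have hX : hit W X x.
  apply/andP; split; [apply/andP; split|].
  - by apply/forall_inP => j; rewrite -[(x j <= _)%N]ltnS cX inE => /andP[].
  - apply/forallP => l; have ln : (l < n)%N by rewrite -cX.
    have -> : before X x l = before W x l.
      apply: eq_card => j; rewrite !inE; case: (j \in W) => //=.
      by case xl : (x j < l)%N; rewrite ?andbF // (ltn_trans xl ln).
    by rewrite leqNgt; apply/negP => /nmin; rewrite leqNgt ln.
  - apply/forall_inP => j; rewrite !inE => /andP[jX jW].
    by rewrite -[(#|X| < _)%N]ltnS cX ltnS leqNgt; move: jX; rewrite jW.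
rewrite (bigD1 X) //= hX big1 // => Y /andP[YW YX]; apply/eqP; rewrite eqb0.
apply: contra YX => hY; apply/eqP.
(* The arrivals before [#|Y|.+1] are exactly [Y]; if [X] were larger, [hit_leq] at that time would
   ask for [#|Y|.+1] of them. The other case is symmetric. *)
have cXY : #|X| = #|Y|.
  apply/eqP; rewrite eqn_leq; apply/andP; split; rewrite leqNgt; apply/negP => lt.
    have := hit_leq XW hX lt; rewrite /before -(hit_before YW hY).
    by rewrite ltnn.
  have := hit_leq YW hY lt; rewrite /before -(hit_before XW hX).
  by rewrite ltnn.
by rewrite [LHS](hit_before YW hY) -cXY [RHS](hit_before XW hX).
Qed.

Lemma wsum_hit W X : X \subset W -> (#|X| < K)%N ->
  wsum (fun=> @arr K) (fun x => (hit W X x)%:R) = theta X * e #|X|.+1 ^+ #|W :\: X|.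
Proof.
move=> XW XK.
have -> : e #|X|.+1 ^+ #|W :\: X| =
    \prod_(j in W :\: X) \sum_(a < K.+1) arr a * (#|X|.+1 <= a)%N%:R.
  by rewrite sum_arr_tail // prodr_const.
rewrite -(wsum_indep_set (fun=> sum_arr K) (fun _ a => (#|X| < a)%N%:R)).
  apply: eq_wsum => x; rewrite /hit; case: (good X x) => /=; rewrite ?mul0r // mul1r.
  case: (boolP [forall j in W :\: X, (#|X| < x j)%N]) => [/forall_inP H|/forall_inPn[j jX /negbTE H]].
    by rewrite big1 // => j /H ->.
  by rewrite (bigD1 j) //= H mul0r.
move=> j; rewrite inE => /andP[jX _] x a; congr (nat_of_bool _)%:R.
have xX i : i \in X -> upd x j a i = x i.
  by rewrite ffunE; case: eqVneq => // ->; rewrite (negPf jX).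
congr (_ && _); first by apply: eq_forallb_in => i iX; rewrite xX.
apply: eq_forallb => l; congr (_ <= _)%N; apply: eq_card => i; rewrite !inE.
by case iX: (i \in X) => //=; rewrite xX.
Qed.

Lemma theta_total W : (#|W| < K)%N ->
  \sum_(X : {set V} | X \subset W) theta X * e #|X|.+1 ^+ #|W :\: X| = 1.
Proof.
move=> WK; rewrite -(wsum1 (I := V) (fun=> sum_arr K)).
rewrite (eq_wsum _ (h' := fun x => \sum_(X : {set V} | X \subset W) (hit W X x)%:R)); last first.
  by move=> x; rewrite -natr_sum hit_unique.
rewrite wsum_sum; apply: eq_bigr => X XW; rewrite wsum_hit //.
exact: leq_ltn_trans (subset_leq_card XW) WK.
Qed.

End Space.

(** A canonical choice of space; [k.+1] is the least truncation for which [thetaE] applies. *)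
Definition th k : R := @theta 'I_k k.+1 setT.

(** [theta_total] is the wanted identity on one fixed space, whereas [th] lives on a different space
    for each size. By induction [renewal_unique] identifies the two for proper subsets; for the full
    set they coincide by definition. *)
Lemma th_renewal m : renewal e th m.
Proof.
have [n] := ubnP m; elim: n m => // n IHn m mn.
have := @theta_total 'I_m m.+1 setT; rewrite cardsT card_ord => /(_ (ltnSn m)) tot.
rewrite /renewal -[RHS]tot; under eq_bigr do rewrite -mulrA.
have := sum_subsets_card [set: 'I_m] (fun k => th k * e k.+1 ^+ (m - k)).
rewrite cardsT card_ord /= => <-.
apply: eq_bigr => X _.
have -> : (m - #|X| = #|setT :\: X|)%N by rewrite cardsDS ?subsetT // cardsT card_ord.
congr (_ * _); have [->|XT] := eqVneq X setT; first by rewrite cardsT card_ord.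
have Xm : (#|X| < m)%N.
  by rewrite -[ltnRHS](card_ord m) -cardsT proper_card // properEneq XT subsetT.
rewrite -(renewal_unique (e := e) (th := th) (psi := @theta 'I_m m.+1)) //.
  by move=> k kX; apply: IHn; apply: leq_trans (leq_ltn_trans kX Xm) mn.
move=> W WX; apply: theta_total; apply: leq_ltn_trans (subset_leq_card WX) _.
exact: ltn_trans Xm _.
Qed.

Lemma thetaE (V : finType) K (X : {set V}) : (#|X| < K)%N -> theta K X = th #|X|.
Proof.
move=> XK; apply: (renewal_unique (e := e)) => [m _|W WX]; first exact: th_renewal.
by apply: theta_total; apply: leq_ltn_trans (subset_leq_card WX) _.
Qed.

End Arrivals.

(** * The law of the size and its Chernoff bounds *)

Section SizeLaw.
Import boot.fintype boot.finset.
Variables (R : realType) (e : nat -> R).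
Hypotheses (e0 : e 0%N = 1) (e_ge0 : forall k, 0 <= e k)
  (e_dec : forall k, e k.+1 <= e k).

(* The probability that the domain has [k.+1] vertices out of [m.+1]. *)
Definition size_law m k : R := 'C(m, k)%:R * th e k * e k.+1 ^+ (m - k).

Lemma arr_ge0 K (a : 'I_K.+1) : 0 <= arr e a.
Proof. by rewrite /arr; case: ifP => _ //; rewrite subr_ge0. Qed.

Lemma wsum_arr_le (V : finType) K (h h' : {ffun V -> 'I_K.+1} -> R) :
  (forall x, h x <= h' x) -> wsum (fun=> @arr R e K) h <= wsum (fun=> @arr R e K) h'.
Proof.
move=> hh'; apply: ler_sum => x _; apply: ler_wpM2l => //.
by apply: prodr_ge0 => i _; exact: arr_ge0.
Qed.

Lemma th_ge0 k : 0 <= th e k.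
Proof.
apply: sumr_ge0 => x _; rewrite mulr_ge0 ?ler0n //.
by apply: prodr_ge0 => i _; exact: arr_ge0.
Qed.

Lemma size_law_ge0 m k : 0 <= size_law m k.
Proof. by rewrite /size_law !mulr_ge0 ?ler0n ?th_ge0 ?exprn_ge0. Qed.

Lemma size_law_sum m : \sum_(k < m.+1) size_law m k = 1.
Proof. exact: th_renewal. Qed.

Lemma size_lawE m k : (k <= m)%N -> size_law m k =
  \sum_(X : {set 'I_m} | #|X| == k) wsum (fun=> @arr R e m.+1) (fun x => (hit setT X x)%:R).
Proof.
move=> km; rewrite /size_law.
rewrite (eq_bigr (fun=> th e k * e k.+1 ^+ (m - k))) => [|X /eqP Xk].
  rewrite sumr_const -[RHS]mulr_natl -mulrA; congr (_%:R * _).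
  by rewrite -[m in LHS]card_ord -card_draws; apply: eq_card => X; rewrite !inE.
rewrite wsum_hit ?subsetT ?ltnS ?Xk // thetaE ?Xk //.
by rewrite cardsDS ?subsetT // cardsT card_ord Xk.
Qed.

(** Generating function of a binomial variable with [m] trials and success probability [1 - e n]. *)
Lemma wsum_before m s n : (n <= m.+1)%N ->
  wsum (fun=> @arr R e m.+1) (fun x => s ^+ before [set: 'I_m] x n) =
  (1 + (s - 1) * (1 - e n)) ^+ m.
Proof.
move=> nm; rewrite (eq_wsum _ (h' := fun x : {ffun 'I_m -> 'I_m.+2} =>
    \prod_j if (x j < n)%N then s else 1)); last first.
  move=> x; rewrite -big_mkcond /= prodr_const; congr (_ ^+ _).
  by apply: eq_card => j; rewrite !inE.
rewrite (wsum_prod (fun=> @arr R e m.+1) (fun _ (a : 'I_m.+2) => if (a < n)%N then s else 1)).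
rewrite (eq_bigr (fun=> 1 + (s - 1) * (1 - e n))) ?prodr_const ?card_ord // => _ _.
rewrite (eq_bigr (fun a : 'I_m.+2 => s * arr e a + (1 - s) * (arr e a * (n <= a)%N%:R))).
  by rewrite big_split /= -!mulr_sumr sum_arr // sum_arr_tail //; ring.
by move=> a _; rewrite ltnNge; case: (n <= a)%N => /=; ring.
Qed.

(** When the size is [k], the number of arrivals before [k.+1] equals [k], so Markov's inequality
    for its exponential holds with [t] of either sign. Negative [t] serves where arrivals outrun
    time. *)
Lemma size_law_le m k t : (k <= m)%N ->
  size_law m k <= expR (- (t * k%:R) + (expR t - 1) * (1 - e k.+1) * m%:R).
Proof.
move=> km; rewrite size_lawE // -wsum_sum.
apply: (@le_trans _ _ (wsum (fun=> @arr R e m.+1)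
   (fun x => expR (- (t * k%:R)) * expR t ^+ before [set: 'I_m] x k.+1))).
  apply: wsum_arr_le => x.
  have [/forallP H|/forallPn[Y]] := boolP [forall X : {set 'I_m}, (#|X| == k) ==> ~~ hit setT X x].
    rewrite big1 ?mulr_ge0 ?expR_ge0 ?exprn_ge0 // ?expR_ge0 // => X Xk.
    by have := H X; rewrite Xk /= => /negPf ->.
  rewrite negb_imply negbK => /andP[/eqP Yk hY].
  apply: (@le_trans _ _ 1).
    rewrite -natr_sum lern1 -(hit_unique setT x).
    rewrite [leqRHS](bigID (fun X : {set 'I_m} => #|X| == k)) /= -[leqLHS]addn0 leq_add //.
    by rewrite leq_eqVlt; apply/orP; left; apply/eqP/eq_bigl => X; rewrite subsetT.
  rewrite /before -Yk -(hit_before _ hY) ?subsetT // -expRM_natr -expRD addNr expR0 //.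
rewrite /wsum; under eq_bigr do rewrite mulrCA.
rewrite -mulr_sumr -/(wsum _ _) wsum_before ?ltnS // expRD expRM_natr.
apply: ler_wpM2l; first exact: expR_ge0.
apply: lerXn2r; rewrite ?nnegrE ?expR_ge0 ?expR_ge1Dx //.
have e1 k0 : e k0 <= 1 by rewrite -e0; elim: k0 => // i; exact: le_trans.
have := expR_ge0 t; have := e1 k.+1; have := e_ge0 k.+1; nra.
Qed.

(** A size of at least [n] only yields that at least [n] vertices arrive before [n], hence the sign
    condition on [t]. *)
Lemma size_law_tail_le m n t : 0 <= t -> (n <= m)%N ->
  \sum_(k < m.+1 | (n <= k)%N) size_law m k <=
  expR (- (t * n%:R) + (expR t - 1) * (1 - e n) * m%:R).
Proof.
move=> t0 nm; rewrite (eq_bigr (fun k : 'I_m.+1 => \sum_(X : {set 'I_m} | #|X| == k)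
   wsum (fun=> @arr R e m.+1) (fun x => (hit setT X x)%:R))); last first.
  by move=> k _; rewrite size_lawE // -ltnS.
under eq_bigr do rewrite -wsum_sum.
rewrite -wsum_sum.
apply: (@le_trans _ _ (wsum (fun=> @arr R e m.+1)
   (fun x => expR (- (t * n%:R)) * expR t ^+ before [set: 'I_m] x n))).
  apply: wsum_arr_le => x.
  have -> : \sum_(k < m.+1 | (n <= k)%N) \sum_(X : {set 'I_m} | #|X| == k) (hit setT X x)%:R =
     \sum_(X : {set 'I_m} | (n <= #|X|)%N) (hit setT X x)%:R :> R.
    have sz (X : {set 'I_m}) : (#|X| < m.+1)%N by rewrite ltnS -[leqRHS]card_ord max_card.
    rewrite [RHS](partition_big (fun X => Ordinal (sz X)) (fun k : 'I_m.+1 => (n <= k)%N)) //=.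
    apply: eq_bigr => k nk; apply: eq_bigl => X; rewrite -val_eqE /=.
    by case: eqVneq => [->|]; rewrite ?nk ?andbF.
  have [/forallP H|/forallPn[Y]] := boolP [forall X : {set 'I_m}, (n <= #|X|)%N ==> ~~ hit setT X x].
    rewrite big1 ?mulr_ge0 ?expR_ge0 ?exprn_ge0 // ?expR_ge0 // => X Xk.
    by have := H X; rewrite Xk /= => /negPf ->.
  rewrite negb_imply negbK => /andP[Yn hY].
  apply: (@le_trans _ _ 1).
    rewrite -natr_sum lern1 -(hit_unique setT x).
    rewrite [leqRHS](bigID (fun X : {set 'I_m} => n <= #|X|)%N) /= -[leqLHS]addn0 leq_add //.
    by rewrite leq_eqVlt; apply/orP; left; apply/eqP/eq_bigl => X; rewrite subsetT.
  rewrite -expRM_natr -expRD -[leLHS]expR0 ler_expR addrC subr_ge0.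
  apply: ler_wpM2l => //; rewrite ler_nat; exact: hit_leq (subsetT _) hY Yn.
rewrite /wsum; under eq_bigr do rewrite mulrCA.
rewrite -mulr_sumr -/(wsum _ _) wsum_before ?(leqW nm) // expRD expRM_natr.
apply: ler_wpM2l; first exact: expR_ge0.
apply: lerXn2r; rewrite ?nnegrE ?expR_ge0 ?expR_ge1Dx //.
have e1 k0 : e k0 <= 1 by rewrite -e0; elim: k0 => // i; exact: le_trans.
have := expR_ge0 t; have := e1 n; have := e_ge0 n; nra.
Qed.

End SizeLaw.

(** * Expectations over discrete spaces *)

Section DiscreteExpectation.
Variables (R : realType) (T : choiceType).
Implicit Types (p h : T -> R).

Lemma esumZ c p : 0 <= c -> (forall t, 0 <= p t) ->
  (\esum_(t in setT) (c * p t)%:E = c%:E * \esum_(t in setT) (p t)%:E)%E.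
Proof.
have le1 (d : R) (q : T -> R) : 0 <= d -> (forall t, 0 <= q t) ->
    (\esum_(t in setT) (d * q t)%:E <= d%:E * \esum_(t in setT) (q t)%:E)%E.
  move=> d0 q0; apply: ge_ereal_sup => _ [X [finX _] <-].
  under eq_fsbigr do rewrite EFinM.
  rewrite -ge0_mule_fsumr => [|t]; last by rewrite lee_fin.
  apply: lee_wpmul2l; first by rewrite lee_fin.
  by apply: esum_ge; exists X.
move=> c0 p0; apply/eqP; rewrite eq_le le1 //=.
have [->|cN0] := eqVneq c 0.
  by rewrite mul0e; apply: esum_ge0 => t _; rewrite mul0r.
have c_gt0 : 0 < c by rewrite lt_neqAle eq_sym cN0.
(* The reverse inequality is the same bound for the factor [c^-1]. *)
have := le1 c^-1 (fun t => c * p t).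
rewrite invr_ge0 c0 => /(_ isT (fun t => mulr_ge0 c0 (p0 t))).
under eq_esum do rewrite mulKf //.
move=> /(@lee_wpmul2l _ c%:E); rewrite lee_fin => /(_ c0).
by rewrite muleA -EFinM divff // mul1e.
Qed.

Definition bounded_fct h := exists C : R, forall t, `|h t| <= C.

Lemma bounded_indic (P : T -> bool) : bounded_fct (fun t => (P t)%:R).
Proof. by exists 1 => t; case: (P t); rewrite ?normr1 ?normr0. Qed.

Lemma boundedD h h' : bounded_fct h -> bounded_fct h' -> bounded_fct (fun t => h t + h' t).
Proof.
by move=> [C hC] [D hD]; exists (C + D) => t; apply: le_trans (ler_normD _ _) (lerD _ _).
Qed.

Lemma boundedM h h' : bounded_fct h -> bounded_fct h' -> bounded_fct (fun t => h t * h' t).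
Proof.
by move=> [C hC] [D hD]; exists (C * D) => t; rewrite normrM ler_pM.
Qed.

Lemma bounded_cst c : bounded_fct (fun=> c).
Proof. by exists `|c|. Qed.

Lemma bounded_sum (I : Type) (r : seq I) (P : pred I) (h : I -> T -> R) :
  (forall i, bounded_fct (h i)) -> bounded_fct (fun t => \sum_(i <- r | P i) h i t).
Proof.
move=> hb; elim: r => [|i r [C IHr]].
  by exists 0 => t; rewrite big_nil normr0.
have [D hD] := hb i; exists (`|D| + C) => t; rewrite big_cons; case: ifP => _.
  by apply: le_trans (ler_normD _ _) (lerD _ _) => //; apply: le_trans (hD t) (ler_norm _).
by apply: le_trans (IHr t) _; rewrite lerDr.
Qed.

Variables (p : T -> R).
Hypotheses (p0 : forall t, 0 <= p t) (p1 : (\esum_(t in setT) (p t)%:E = 1)%E).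

Let S h : \bar R := (\esum_(t in setT) (p t * h t)%:E)%E.

Let S_fin h C : (forall t, 0 <= h t <= C) -> S h \is a fin_num.
Proof.
move=> hC; rewrite ge0_fin_numE; last first.
  by apply: esum_ge0 => t _; rewrite lee_fin mulr_ge0 //; case/andP: (hC t).
apply: (@le_lt_trans _ _ (\esum_(t in setT) (`|C| * p t)%:E)%E).
  apply: le_esum => t _; rewrite lee_fin mulrC ler_wpM2r //.
  by case/andP: (hC t) => _ /le_trans; apply; exact: ler_norm.
by rewrite esumZ // p1 mule1 ltry.
Qed.

Let SD h h' : (forall t, 0 <= h t) -> (forall t, 0 <= h' t) ->
  S (fun t => h t + h' t) = (S h + S h')%E.
Proof.
move=> h0 h'0; rewrite /S -esumD => [|t _|t _]; rewrite ?lee_fin ?mulr_ge0 //.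
by apply: eq_esum => t _; rewrite mulrDr EFinD.
Qed.

Lemma Edisc_ge0E h : (forall t, 0 <= h t) ->
  Edisc p h = fine (\esum_(t in setT) (p t * h t)%:E)%E.
Proof.
move=> h0; rewrite /Edisc [X in _ - fine X]esum1 => [|t _]; last first.
  by rewrite (max_idPr _) ?mulr0 // oppr_le0.
by rewrite subr0; congr fine; apply: eq_esum => t _; rewrite (max_idPl _).
Qed.

(** [Edisc] is defined by positive and negative parts; since the positive part plus [h2] equals [h1]
    plus the negative part, any bounded non-negative decomposition computes it. Linearity follows by
    shifting each function by its bound. *)
Lemma Edisc_splitE h h1 h2 C : (forall t, 0 <= h1 t <= C) -> (forall t, 0 <= h2 t <= C) ->
  (forall t, h t = h1 t - h2 t) -> Edisc p h = fine (S h1) - fine (S h2).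
Proof.
move=> H1 H2 e; rewrite /Edisc -/(S (fun t => Num.max (h t) 0)) -/(S (fun t => Num.max (- h t) 0)).
have ge0 (h' : T -> R) (H : forall t, 0 <= h' t <= C) t : 0 <= h' t by case/andP: (H t).
have leC (h' : T -> R) (H : forall t, 0 <= h' t <= C) t : h' t <= C by case/andP: (H t).
have Hp t : 0 <= Num.max (h t) 0 <= C.
  have /andP[? ?] := H1 t; have /andP[? ?] := H2 t.
  by rewrite le_max lexx orbT ge_max e /=; apply/andP; split; lra.
have Hn t : 0 <= Num.max (- h t) 0 <= C.
  have /andP[? ?] := H1 t; have /andP[? ?] := H2 t.
  by rewrite le_max lexx orbT ge_max e /=; apply/andP; split; lra.
have : S (fun t => Num.max (h t) 0 + h2 t) = S (fun t => h1 t + Num.max (- h t) 0).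
  apply: eq_esum => t _; congr (_ * _)%:E; rewrite e.
  by case: (leP (h1 t - h2 t) 0) => ?; case: (leP (- (h1 t - h2 t)) 0) => ?; lra.
rewrite !SD; try by [exact: ge0 H1|exact: ge0 H2|exact: ge0 Hp|exact: ge0 Hn].
move/(congr1 fine); rewrite !fineD ?(S_fin Hp) ?(S_fin Hn) ?(S_fin H1) ?(S_fin H2) //.
by move: (fine _) (fine _) (fine _) (fine _) => a b c d; lra.
Qed.

Lemma EdiscD h h' : bounded_fct h -> bounded_fct h' ->
  Edisc p (fun t => h t + h' t) = Edisc p h + Edisc p h'.
Proof.
move=> [C hC] [D hD].
have B (g : T -> R) (c d : R) : (forall t, `|g t| <= c) -> `|c| <= d -> forall t, 0 <= g t + c <= d *+ 2.
  move=> gc cd t; have := gc t; rewrite ler_norml => /andP[? ?].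
  have ? := ler_norm c; rewrite mulr2n; apply/andP; split; lra.
have cb (c d : R) : `|c| <= d -> 0 <= c -> T -> 0 <= c <= d *+ 2.
  move=> cd c0 _; have ? := ler_norm c; have ? := normr_ge0 c; rewrite c0 mulr2n /=; lra.
case: (pselect (exists t0 : T, True)) => [[t0 _]|noT]; last first.
  rewrite /Edisc !esum1; try by [move=> t; case: noT; exists t].
  by rewrite !subrr addr0.
have C0 : 0 <= C by apply: le_trans (hC t0).
have D0 : 0 <= D by apply: le_trans (hD t0).
pose M := C + D.
have CM : `|C| <= M by rewrite ger0_norm // lerDl.
have DM : `|D| <= M by rewrite ger0_norm // lerDr.
have MM : `|M| <= M by rewrite ger0_norm // addr_ge0.
have hM t : `|h t + h' t| <= M by apply: le_trans (ler_normD _ _) (lerD _ _).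
rewrite (@Edisc_splitE _ (fun t => (h t + h' t) + M) (fun=> M) _ (B _ _ _ hM MM) (cb _ _ MM (addr_ge0 C0 D0))); last first.
  by move=> t; rewrite addrK.
rewrite (@Edisc_splitE h (fun t => h t + C) (fun=> C) _ (B _ _ _ hC CM) (cb _ _ CM C0)); last first.
  by move=> t; rewrite addrK.
rewrite (@Edisc_splitE h' (fun t => h' t + D) (fun=> D) _ (B _ _ _ hD DM) (cb _ _ DM D0)); last first.
  by move=> t; rewrite addrK.
have -> : S (fun=> M) = (S (fun=> C) + S (fun=> D))%E by rewrite -SD.
have -> : S (fun t => h t + h' t + M) = (S (fun t => (h t + C)%R) + S (fun t => (h' t + D)%R))%E.
  rewrite -SD => [|t|t]; first by apply: eq_esum => t _; congr (_ * _)%:E; rewrite /M; ring.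
    by case/andP: (B _ _ _ hC CM t).
  by case/andP: (B _ _ _ hD DM t).
rewrite !fineD ?(S_fin (B _ _ _ hC CM)) ?(S_fin (B _ _ _ hD DM)) ?(S_fin (cb _ _ CM C0)) ?(S_fin (cb _ _ DM D0)) //.
by ring.
Qed.

Lemma EdiscN h : Edisc p (fun t => - h t) = - Edisc p h.
Proof.
rewrite /Edisc opprB; congr (_ - fine _); apply: eq_esum => t _.
by rewrite opprK.
Qed.

Lemma EdiscZ c h : bounded_fct h -> Edisc p (fun t => c * h t) = c * Edisc p h.
Proof.
have pos d : 0 <= d -> Edisc p (fun t => d * h t) = d * Edisc p h.
  move=> d0; rewrite /Edisc mulrBr.
  have E (g : T -> R) : (forall t, 0 <= g t) ->
      fine (\esum_(t in setT) (d * (p t * g t))%:E)%E = d * fine (\esum_(t in setT) (p t * g t)%:E)%E.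
    move=> g0; rewrite esumZ // => [|t]; last by rewrite mulr_ge0.
    have [->|dN0] := eqVneq d 0; first by rewrite mul0e mul0r.
    have [fin|] := boolP ((\esum_(t in setT) (p t * g t)%:E)%E \is a fin_num).
      by rewrite fineM.
    rewrite ge0_fin_numE ?ltey ?negbK => [/eqP ->|]; last first.
      by apply: esum_ge0 => t _; rewrite lee_fin mulr_ge0.
    by rewrite mulry gtr0_sg ?mul1e ?mulr0 // lt_neqAle eq_sym dN0.
  rewrite -!E; try by [move=> t; rewrite le_max lexx orbT].
  congr (fine _ - fine _); apply: eq_esum => t _; congr _%:E; rewrite mulrCA; congr (_ * _).
    by rewrite maxr_pMr // mulr0.
  by rewrite maxr_pMr // mulr0 mulrN.
move=> _; have [/pos //|c0] := leP 0 c.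
rewrite -[c]opprK [LHS](_ : _ = Edisc p (fun t => - (- c * h t))); last first.
  by congr (Edisc p); apply/funext => t; rewrite mulNr.
by rewrite EdiscN pos ?mulNr // oppr_ge0 ltW.
Qed.

Lemma Edisc_ge0 h : (forall t, 0 <= h t) -> 0 <= Edisc p h.
Proof.
by move=> h0; rewrite Edisc_ge0E // fine_ge0 //; apply: esum_ge0 => t _; rewrite lee_fin mulr_ge0.
Qed.

Lemma Edisc_le h h' : bounded_fct h -> bounded_fct h' -> (forall t, h t <= h' t) ->
  Edisc p h <= Edisc p h'.
Proof.
move=> hb h'b hh'; rewrite -subr_ge0 -EdiscN -EdiscD //; last first.
  by case: hb => C hC; exists C => t; rewrite normrN.
by apply: Edisc_ge0 => t; rewrite subr_ge0.
Qed.

Lemma Edisc_cst c : Edisc p (fun=> c) = c.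
Proof.
have -> : (fun=> c) = (fun t : T => c * 1) by apply/funext => t; rewrite mulr1.
rewrite EdiscZ; last exact: bounded_cst.
rewrite Edisc_ge0E // (eq_esum (b := fun t => (p t)%:E)) => [|t _]; last by rewrite mulr1.
by rewrite p1 mulr1.
Qed.

Lemma Edisc_sum (I : Type) (r : seq I) (P : pred I) (h : I -> T -> R) :
  (forall i, bounded_fct (h i)) ->
  Edisc p (fun t => \sum_(i <- r | P i) h i t) = \sum_(i <- r | P i) Edisc p (h i).
Proof.
move=> hb; elim: r => [|i r IHr].
  by rewrite big_nil -[RHS](Edisc_cst 0); congr (Edisc p); apply/funext => t; rewrite big_nil.
rewrite big_cons -IHr; case: ifP => Pi.
  rewrite -EdiscD //; last exact: bounded_sum.
  by congr (Edisc p); apply/funext => t; rewrite big_cons Pi.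
by congr (Edisc p); apply/funext => t; rewrite big_cons Pi.
Qed.

Definition Prob (P : T -> bool) : R := Edisc p (fun t => (P t)%:R).

Lemma Prob_sub (P Q : T -> bool) : (forall t, P t -> Q t) -> Prob P <= Prob Q.
Proof.
move=> PQ; apply: Edisc_le; try exact: bounded_indic.
by move=> t; rewrite ler_nat; case Pt: (P t) => //; rewrite PQ.
Qed.

Lemma Prob_orb (P Q : T -> bool) : Prob (fun t => P t || Q t) <= Prob P + Prob Q.
Proof.
rewrite /Prob -EdiscD; try exact: bounded_indic.
apply: Edisc_le; try exact: bounded_indic.
  by apply: boundedD; exact: bounded_indic.
by move=> t; rewrite -natrD ler_nat; case: (P t); case: (Q t).
Qed.

Lemma Prob_bigor K (P : nat -> T -> bool) :
  Prob (fun t => [exists k : 'I_K, P k t]) <= \sum_(k < K) Prob (P k).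
Proof.
rewrite /Prob -Edisc_sum; last by move=> k; exact: bounded_indic.
apply: Edisc_le; first exact: bounded_indic.
  by apply: bounded_sum => k; exact: bounded_indic.
move=> t; have [/existsP[k Pk]|_] := boolP [exists k : 'I_K, P k t]; last first.
  by apply: sumr_ge0.
by rewrite (bigD1 k) //= Pk lerDl sumr_ge0.
Qed.

End DiscreteExpectation.

(** * Products of Poisson laws *)

Section EsumProduct.
Variables (R : realType) (I : finType) (f : I -> nat -> R) (s : I -> R).
Hypotheses (f0 : forall i k, 0 <= f i k)
  (fs : forall i, (\esum_(k in setT) (f i k)%:E = (s i)%:E)%E).

Let F (L : {ffun I -> nat}) : R := \prod_i f i (L i).

Let F0 L : 0 <= F L.
Proof. exact: prodr_ge0. Qed.

Let lift K (g : {ffun I -> 'I_K}) : {ffun I -> nat} := [ffun i => val (g i)].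

Let lift_inj K : injective (@lift K).
Proof.
by move=> g g' /ffunP e; apply/ffunP => i; have := e i; rewrite !ffunE => /val_inj.
Qed.

Let sum_lift K : \sum_(g : {ffun I -> 'I_K}) F (lift g) = \prod_i \sum_(k < K) f i k.
Proof.
rewrite bigA_distr_bigA; apply: eq_bigr => g _; apply: eq_bigr => i _.
by rewrite ffunE.
Qed.

Let psum_cvg i : (\sum_(k < K) f i k @[K --> \oo] --> s i)%classic.
Proof.
have : (\sum_(0 <= k < K) (f i k)%:E @[K --> \oo] --> (s i)%:E)%classic%E.
  rewrite -fs -nneseries_esumT => [|k]; last by rewrite lee_fin.
  by apply: is_cvg_nneseries => k _ _; rewrite lee_fin.
under eq_cvg do rewrite sumEFin big_mkord.
by move/fine_cvgP => [_].
Qed.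

Let psum_le i K : \sum_(k < K) f i k <= s i.
Proof.
rewrite -lee_fin -fs -nneseries_esumT => [|k]; last by rewrite lee_fin.
rewrite -sumEFin -(big_mkord xpredT (fun k => (f i k)%:E)).
by apply: nneseries_lim_ge => k _ _; rewrite lee_fin.
Qed.

Let fsum_range K : (\sum_(L \in range (@lift K)) (F L)%:E = (\prod_i \sum_(k < K) f i k)%:E)%E.
Proof.
have fin : finite_set (range (@lift K)) by apply: finite_image; exact: finite_finset.
rewrite fsbig_finite //= sumEFin -sum_lift; congr _%:E.
rewrite -[RHS](big_map (@lift K) xpredT F); apply: perm_big; apply: uniq_perm.
- exact: finmap.fset_uniq.
- by rewrite map_inj_uniq ?index_enum_uniq //; exact: lift_inj.
move=> L; rewrite in_fset_set //; apply/idP/mapP => [|[g _ ->]]; last by rewrite inE; exists g.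
by rewrite inE => -[g _ <-]; exists g => //; exact: mem_index_enum.
Qed.

(** Over the box of functions with values below [K] the sum factorises into partial sums, and every
    finite set of functions lies in such a box. *)
Lemma esum_prod : (\esum_(L in setT) (F L)%:E = (\prod_i s i)%:E)%E.
Proof.
apply/eqP; rewrite eq_le; apply/andP; split.
  apply: ge_ereal_sup => _ [X [finX _] <-].
  pose K := (\max_(L <- finmap.enum_fset (fset_set X)) \max_i (L : {ffun I -> nat}) i).+1.
  have LK (L : {ffun I -> nat}) i : L \in X -> (L i < K)%N.
    move=> LX; have {}LX : L \in finmap.enum_fset (fset_set X) by rewrite in_fset_set.
    rewrite ltnS; apply: leq_trans (@leq_bigmax_seq _ _ xpredT (fun L : {ffun I -> nat} => \max_i L i) L LX isT).
    exact: (leq_bigmax_cond (F := fun i => L i)).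
  apply: (@le_trans _ _ (\sum_(L \in range (@lift K)) (F L)%:E)%E).
    apply: lee_fsum_nneg_subset => //.
    - by apply: finite_image; exact: finite_finset.
    - move=> L LX; rewrite inE; exists [ffun i => Ordinal (LK L i LX)] => //.
      by apply/ffunP => i; rewrite !ffunE.
    - by move=> L _; rewrite lee_fin.
  rewrite fsum_range lee_fin; apply: ler_prod => i _.
  by rewrite sumr_ge0 //=; exact: psum_le.
have cv : (\prod_i \sum_(k < K) f i k @[K --> \oo] --> \prod_i s i)%classic.
  apply: (@cvg_big R I *%R 1 xpredT _ nat eventually (index_enum I) (fun i K => \sum_(k < K) f i k) s).
    exact: mul_continuous.
  by move=> i _; exact: psum_cvg.
have E0 : (0 <= \esum_(L in setT) (F L)%:E)%E by apply: esum_ge0 => L _; rewrite lee_fin.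
case E: (\esum_(L in setT) (F L)%:E)%E E0 => [x| |] // _; last by rewrite leey.
rewrite lee_fin; apply: (cvgr_to_le cv); apply: nearW => K.
rewrite -lee_fin -E -fsum_range; apply: esum_ge; exists (range (@lift K)) => //.
by split => //; apply: finite_image; exact: finite_finset.
Qed.

End EsumProduct.

Section PoissonProduct.
Variable R : realType.

Lemma poisson_pmf_ge0 (m : R) k : 0 <= m -> 0 <= Defs.poisson_pmf m k.
Proof. by move=> m0; rewrite /Defs.poisson_pmf divr_ge0 ?mulr_ge0 ?expR_ge0 ?exprn_ge0. Qed.

Lemma esum_poisson_pmf (m : R) : 0 <= m ->
  (\esum_(k in setT) (Defs.poisson_pmf m k)%:E = 1)%E.
Proof.
move=> m0; rewrite (eq_esum (b := fun k => (expR (- m) * exp_coeff m k)%:E)) => [|k _]; last first.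
  by rewrite /Defs.poisson_pmf /exp_coeff /= mulrA.
have c0 k : 0 <= exp_coeff m k by exact: exp_coeff_ge0.
rewrite esumZ ?expR_ge0 // -nneseries_esumT => [|k]; last by rewrite lee_fin.
have -> : (\sum_(k <oo) (exp_coeff m k)%:E)%E = (expR m)%:E.
  rewrite /expR -EFin_lim; last exact: is_cvg_series_exp_coeff.
  by apply/congr_lim/funext => n /=; rewrite /series /= -sumEFin.
by rewrite -EFinM expRN mulVf // gt_eqF // expR_gt0.
Qed.

Lemma poisson_pmf0 (m : R) : Defs.poisson_pmf m 0 = expR (- m).
Proof. by rewrite /Defs.poisson_pmf expr0 fact0 divr1 mulr1. Qed.

Lemma esum_poisson_bern (I : finType) (mu : I -> R) i b : 0 <= mu i ->
  (\esum_(k in setT) (Defs.poisson_pmf (mu i) k * ((0 < k)%N == b)%:R)%:E = (bern mu i b)%:E)%E.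
Proof.
move=> m0.
have E0 : (\esum_(k in setT) (Defs.poisson_pmf (mu i) k * ((0 < k)%N == false)%:R)%:E =
    (expR (- mu i))%:E)%E.
  rewrite -(poisson_pmf0 (mu i)) -(esum_set1 (t := 0%N) (a := fun k => (Defs.poisson_pmf (mu i) k)%:E)).
    rewrite [RHS]esum_mkcond; apply: eq_esum => k _.
    case: k => [|k]; first by rewrite mulr1 mem_set.
    by rewrite mulr0 memNset.
  by rewrite lee_fin poisson_pmf_ge0.
case: b => //=.
have := esum_poisson_pmf m0.
rewrite (eq_esum (b := fun k => ((Defs.poisson_pmf (mu i) k * ((0 < k)%N == true)%:R)%:E +
  (Defs.poisson_pmf (mu i) k * ((0 < k)%N == false)%:R)%:E)%E)); last first.
  by move=> k _; rewrite -EFinD -mulrDr; case: (0 < k)%N; rewrite ?addr0 ?add0r mulr1.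
rewrite esumD => [|k _|k _]; rewrite ?lee_fin 1?mulr_ge0 ?poisson_pmf_ge0 //.
rewrite E0 EFinB => <-; rewrite addeK //.
Qed.

Variables (I : finType).
Implicit Types (mu : I -> R) (L : {ffun I -> nat}).

Definition ppois mu L : R := \prod_i Defs.poisson_pmf (mu i) (L i).

Lemma ppois_ge0 mu L : (forall i, 0 <= mu i) -> 0 <= ppois mu L.
Proof. by move=> mu0; apply: prodr_ge0 => i _; rewrite poisson_pmf_ge0. Qed.

(** Splitting by the pattern [x] of positive multiplicities makes each piece a product of
    one-coordinate events. *)
Lemma esum_ppois_supp mu (ev : pred {set I}) : (forall i, 0 <= mu i) ->
  (\esum_(L in setT) (ppois mu L * (ev (supp L))%:R)%:E =
   (wsum (bern mu) (fun x => (ev (edges x))%:R))%:E)%E.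
Proof.
move=> mu0; pose g x L := \prod_i (Defs.poisson_pmf (mu i) (L i) * ((0 < L i)%N == x i)%:R).
have g0 x L : 0 <= g x L.
  by apply: prodr_ge0 => i _; rewrite mulr_ge0 // poisson_pmf_ge0.
rewrite (eq_esum (b := fun L => (\sum_(x : {ffun I -> bool}) ((ev (edges x))%:R * g x L)%:E)%E)).
  rewrite esum_sum => [|L x _ _]; last by rewrite lee_fin mulr_ge0.
  rewrite -sumEFin; apply: eq_bigr => x _.
  rewrite esumZ // (@esum_prod _ _ (fun i k => Defs.poisson_pmf (mu i) k * ((0 < k)%N == x i)%:R)
    (fun i => bern mu i (x i))) ?EFinM 1?muleC // => [i k|i].
    by rewrite mulr_ge0 // poisson_pmf_ge0.
  exact: esum_poisson_bern.
move=> L _; rewrite sumEFin; congr _%:E; pose xL : {ffun I -> bool} := [ffun i => (0 < L i)%N].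
rewrite (bigD1 xL) //= [X in _ = _ + X]big1 ?addr0.
  rewrite /g big_split /= [X in _ * (_ * X)]big1 => [|i _]; last by rewrite ffunE eqxx.
  rewrite mulr1 mulrC; congr ((ev _)%:R * _); apply/setP => i.
  by rewrite !inE ffunE.
move=> x xN; have /existsP[i xi] : [exists i, x i != xL i].
  by rewrite -negb_forall; apply: contra xN => /forallP e; apply/eqP/ffunP => i; apply/eqP.
rewrite /g (bigD1 i) //=; move: xi; rewrite ffunE eq_sym => /negPf ->.
by rewrite mulr0 mul0r mulr0.
Qed.

Lemma esum_ppois mu : (forall i, 0 <= mu i) -> (\esum_(L in setT) (ppois mu L)%:E = 1)%E.
Proof.
move=> mu0; have := esum_ppois_supp predT mu0.
rewrite (wsum1 (bern1 mu)) => <-; apply: eq_esum => L _.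
by rewrite mulr1.
Qed.

Lemma Prob_supp mu (ev : pred {set I}) : (forall i, 0 <= mu i) ->
  Prob (ppois mu) (fun L => ev (supp L)) = wsum (bern mu) (fun x => (ev (edges x))%:R).
Proof.
move=> mu0; rewrite /Prob Edisc_ge0E // esum_ppois_supp //.
Qed.

Lemma poisson_tilt (m t : R) k :
  Defs.poisson_pmf m k * expR (t * k%:R) = expR ((expR t - 1) * m) * Defs.poisson_pmf (expR t * m) k.
Proof.
have E : expR ((expR t - 1) * m) * expR (- (expR t * m)) = expR (- m).
  by rewrite -expRD; congr expR; ring.
by rewrite /Defs.poisson_pmf exprMn -expRM_natr -E; ring.
Qed.

Lemma ppois_tilt mu t (Q : pred I) L :
  ppois mu L * expR (t * (\sum_(i | Q i) L i)%:R) =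
  expR ((expR t - 1) * \sum_(i | Q i) mu i) *
    ppois (fun i => if Q i then expR t * mu i else mu i) L.
Proof.
rewrite natr_sum !mulr_sumr !expR_sum !(big_mkcond Q) /= /ppois -!big_split /=.
apply: eq_bigr => i _; case: (Q i); last by rewrite mulr1 mul1r.
exact: poisson_tilt.
Qed.

End PoissonProduct.
Lemma Prob_change (R : realType) (T : choiceType) (p p' : T -> R) (c : R) (P P' : T -> bool) :
  (forall t, 0 <= p t) -> (\esum_(t in setT) (p t)%:E = 1)%E ->
  (forall t, 0 <= p' t) -> (\esum_(t in setT) (p' t)%:E = 1)%E ->
  0 <= c -> (forall t, p t * (P t)%:R <= c * (p' t * (P' t)%:R)) ->
  Prob p P <= c * Prob p' P'.
Proof.
move=> p0 p1 p'0 p'1 c0 H.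
have fin (q : T -> R) (Q : T -> bool) : (forall t, 0 <= q t) ->
    (\esum_(t in setT) (q t)%:E = 1)%E ->
    (\esum_(t in setT) (q t * (Q t)%:R)%:E)%E \is a fin_num.
  move=> q0 q1; rewrite ge0_fin_numE; last first.
    by apply: esum_ge0 => t _; rewrite lee_fin mulr_ge0.
  apply: (@le_lt_trans _ _ 1%E); last exact: ltry.
  rewrite -q1; apply: le_esum => t _; rewrite lee_fin.
  by case: (Q t); rewrite ?mulr1 ?mulr0.
rewrite /Prob !Edisc_ge0E // -[c]/(fine c%:E) -fineM ?fin //.
rewrite -esumZ //; last by move=> t; rewrite mulr_ge0.
rewrite fine_le ?fin //.
  by rewrite esumZ // ?fin_numM ?fin // => t; rewrite mulr_ge0.
by apply: le_esum => t _; rewrite lee_fin.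
Qed.

(** * The laws of the domain and of the identifiable hyperedges *)

Section HypergraphLaw.
Import boot.fintype boot.finset.
Variables (R : realType).
Implicit Types (beta : nat -> R).

Definition hmean beta N (A : {set 'I_N}) : R := N%:R * beta #|A| / 'C(N, #|A|)%:R.

(* For a set [S] of [k] vertices and [w] outside [S]: the mean number of hyperedges [B] with
   [B :\: S = [set w]]. *)
Definition hrate beta N k : R :=
  \sum_(j < k.+1) 'C(k, j)%:R * (N%:R * beta j.+1 / 'C(N, j.+1)%:R).

(* The mean number of hyperedges inside a set of [k] vertices. *)
Definition hinner beta N k : R :=
  \sum_(j < k.+1) 'C(k, j)%:R * (N%:R * beta j / 'C(N, j)%:R).

Definition hsurv beta N k : R := expR (- hrate beta N k).

(** Mean number of hyperedges whose multiplicity is constrained when the domain is a given set of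
    [k] vertices: those inside it and those with exactly one vertex outside. *)
Definition hrevealed beta N k : R := hinner beta N k + (N - k)%:R * hrate beta N k.

Lemma hyp_pmfE beta N : @hyp_pmf R beta N = ppois (@hmean beta N).
Proof. by []. Qed.

Lemma hmean_rates beta N (v0 : 'I_N) U : rates v0 (@hmean beta N) (hrate beta N) U.
Proof.
move=> S w _ _ _ wS.
rewrite /hrate -(sum_subsets_card S (fun j => N%:R * beta j.+1 / 'C(N, j.+1)%:R)).
rewrite (reindex_onto (fun C => w |: C) (fun B => B :\ w)) /=; last first.
  by move=> B; rewrite setD_eq1 => /and3P[wB _ _]; rewrite setD1K.
apply: eq_big => [C|C /andP[_ /eqP e]].
  rewrite setD_eq1 setU11 wS /=; apply/andP/idP => [[CS /eqP <-]//|CS].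
  have wC : w \notin C by apply: contra wS => /(subsetP CS).
  by rewrite setU1K.
by rewrite /hmean cardsU1 -{1 3}e !inE eqxx.
Qed.

Lemma sum_hmean_inner beta N (S : {set 'I_N}) :
  \sum_(A : {set 'I_N} | A \subset S) hmean beta A = hinner beta N #|S|.
Proof. by rewrite /hinner -(sum_subsets_card S (fun j => N%:R * beta j / 'C(N, j)%:R)). Qed.

Lemma hmean_ge0 beta N (A : {set 'I_N}) : (forall k, 0 <= beta k) -> 0 <= hmean beta A.
Proof. by move=> b0; rewrite /hmean divr_ge0 ?mulr_ge0. Qed.

Lemma hrate0 beta N : beta 1%N = 0 -> hrate beta N 0 = 0.
Proof. by move=> b1; rewrite /hrate big_ord_recl big_ord0 /= b1; ring. Qed.

Lemma hsurv0 beta N : beta 1%N = 0 -> hsurv beta N 0 = 1.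
Proof. by move=> b1; rewrite /hsurv hrate0 // oppr0 expR0. Qed.

Lemma hrate_le beta N k : (forall k, 0 <= beta k) -> hrate beta N k <= hrate beta N k.+1.
Proof.
move=> b0; rewrite /hrate [leRHS]big_ord_recr /= -[leLHS]addr0 lerD //.
  apply: ler_sum => j _; apply: ler_wpM2r; first by rewrite divr_ge0 ?mulr_ge0.
  by rewrite ler_nat /=; case: (nat_of_ord j) => [|i]; rewrite ?bin0 // binS leq_addr.
by rewrite mulr_ge0 // divr_ge0 ?mulr_ge0.
Qed.

Lemma hsurv_dec beta N k : (forall k, 0 <= beta k) -> hsurv beta N k.+1 <= hsurv beta N k.
Proof. by move=> b0; rewrite ler_expR lerN2 hrate_le. Qed.

Lemma hrateZ c beta N k : hrate (fun j => c * beta j) N k = c * hrate beta N k.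
Proof. by rewrite /hrate mulr_sumr; apply: eq_bigr => j _; ring. Qed.

Lemma hrate_ge0 beta N k : (forall k, 0 <= beta k) -> 0 <= hrate beta N k.
Proof. by move=> b0; apply: sumr_ge0 => j _; rewrite mulr_ge0 // divr_ge0 ?mulr_ge0. Qed.

Lemma hsurv_le1 beta N k : (forall k, 0 <= beta k) -> hsurv beta N k <= 1.
Proof. by move=> b0; rewrite -[leRHS]expR0 ler_expR oppr_le0 hrate_ge0. Qed.

Section Fixed.
Variables (N : nat) (v0 : 'I_N).
Implicit Types (L : hypergraph N) (S : {set 'I_N}) (mu : {set 'I_N} -> R).

Lemma Prob_domain mu r S : (forall A, 0 <= mu A) -> r 0%N = 0 -> v0 \in S -> rates v0 mu r S ->
  Prob (ppois mu) (fun L => cl v0 setT (supp L) == S) =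
  th (fun k => expR (- r k)) #|S|.-1 * expR (- \sum_(B in bdry setT S) mu B).
Proof.
move=> mu0 r0 v0S rmu.
transitivity (perc mu (fun E => cl v0 setT E == S)).
  exact: (Prob_supp (fun E => cl v0 setT E == S)).
rewrite perc_cl ?subsetT ?inE //.
rewrite (perc_clE (th := th (fun k => expR (- r k))) v0S rmu) // => m _.
by apply: th_renewal; rewrite r0 oppr0 expR0.
Qed.

(** Freezes the domain at a deterministic [S], so that the hyperedge count in [b] becomes a sum over
    a fixed family. *)
Lemma Prob_size beta k (b : {set 'I_N} -> hypergraph N -> bool) : (forall k, 0 <= beta k) ->
  Prob (@hyp_pmf R beta N) (fun L => (TN L v0 == k) && b (Defs.domain L v0) L) =
  \sum_(S : {set 'I_N} | (v0 \in S) && (#|S| == k))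
    Prob (@hyp_pmf R beta N) (fun L => (cl v0 setT (supp L) == S) && b S L).
Proof.
move=> b0; rewrite /Prob -Edisc_sum; last by move=> S; exact: bounded_indic.
- congr (Edisc _); apply/funext => L; rewrite domainE /TN domainE.
  have [/eqP Tk|Tk] := boolP (#|cl v0 setT (supp L)| == k).
    rewrite (bigD1 (cl v0 setT (supp L))) ?cl_v0 ?Tk ?eqxx //= big1 ?addr0 // => S.
    by case/andP=> _; rewrite eq_sym => /negPf ->.
  rewrite big1 // => S /andP[_ /eqP Sk]; case: eqP => // e.
  by rewrite e Sk eqxx in Tk.
- by move=> L; rewrite hyp_pmfE ppois_ge0 // => A; exact: hmean_ge0.
- by rewrite hyp_pmfE esum_ppois // => A; exact: hmean_ge0.
Qed.

Lemma Prob_size1 beta k : (forall k, 0 <= beta k) ->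
  Prob (@hyp_pmf R beta N) (fun L => TN L v0 == k) =
  \sum_(S : {set 'I_N} | (v0 \in S) && (#|S| == k))
    Prob (@hyp_pmf R beta N) (fun L => cl v0 setT (supp L) == S).
Proof.
move=> b0; have := Prob_size k (fun _ _ => true) b0.
rewrite [X in Prob _ X = _](_ : _ = fun L => TN L v0 == k); last first.
  by apply/funext => L; rewrite andbT.
move=> ->; apply: eq_bigr => S _; congr (Prob _); apply/funext => L.
by rewrite andbT.
Qed.

Lemma card_sets_containing k :
  #|[set S : {set 'I_N} | (v0 \in S) && (#|S| == k.+1)]| = 'C(N.-1, k).
Proof.
have N0 : (0 < N)%N by case: (N) v0 => // -[].
have := sum_subsets_card1 (fun n => (n == k.+1)%:R : int) (in_setT v0).
rewrite cardsT card_ord (eq_bigl (fun S : {set 'I_N} => v0 \in S)) => [|S]; last by rewrite subsetT andbT.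
move=> e.
have {}e : (#|[set S : {set 'I_N} | (v0 \in S) && (#|S| == k.+1)]|)%:R = ('C(N.-1, k))%:R :> int.
  rewrite -sum1_card natr_sum (eq_bigl (fun S : {set 'I_N} => (v0 \in S) && (#|S| == k.+1))) => [|S]; last by rewrite inE.
  rewrite big_mkcondr /= (eq_bigr (fun S : {set 'I_N} => (#|S| == k.+1)%:R)) => [|S _]; last by case: eqP.
  rewrite e; have [kN|kN] := ltnP k N.
    rewrite (bigD1 (Ordinal kN)) //= eqxx mulr1 big1 ?addr0 // => i.
    by rewrite -val_eqE /= eqSS => /negPf ->; rewrite mulr0.
  rewrite bin_small ?prednK // big1 // => i _; rewrite eqSS ltn_eqF ?mulr0 //.
  exact: leq_trans (ltn_ord i) kN.
by move/eqP: e; rewrite eqr_nat => /eqP.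
Qed.

Lemma sum_bdry_hmean beta S : v0 \in S ->
  \sum_(B in bdry setT S) hmean beta B = (N - #|S|)%:R * hrate beta N #|S|.
Proof.
move=> v0S; rewrite (sum_bdry (@hmean_rates beta N v0 setT)) ?subsetT // -[LHS]mulr_natl.
by rewrite cardsDS ?subsetT // cardsT card_ord.
Qed.

Lemma Prob_TN beta k : (forall k, 0 <= beta k) -> beta 1%N = 0 -> (k < N)%N ->
  Prob (@hyp_pmf R beta N) (fun L => TN L v0 == k.+1) = size_law (hsurv beta N) N.-1 k.
Proof.
move=> b0 b1 kN; transitivity (\sum_(S : {set 'I_N} | (v0 \in S) && (#|S| == k.+1))
    th (hsurv beta N) k * hsurv beta N k.+1 ^+ (N.-1 - k)).
  rewrite Prob_size1 //; apply: eq_bigr => S /andP[v0S /eqP Sk].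
  rewrite hyp_pmfE (Prob_domain (r := hrate beta N)) ?Sk //=; last first.
  - exact: hmean_rates.
  - exact: hrate0.
  - by move=> A; exact: hmean_ge0.
  congr (_ * _); rewrite sum_bdry_hmean // Sk /hsurv -expRM_natl mulrN.
  by rewrite (_ : (N - k.+1 = N.-1 - k)%N) // -subn1 -subnDA add1n.
rewrite /size_law -mulrA -card_sets_containing sumr_const -[LHS]mulr_natl; congr (_%:R * _).
by apply: eq_card => S; rewrite !inE.
Qed.

(* Tilting the Poisson means by [expR t] on the revealed hyperedges: those inside [S], and those
   with exactly one vertex outside [S], which are absent when the domain is [S]. *)
Lemma Prob_ZN_le beta k t (b : R) : (forall k, 0 <= beta k) -> beta 1%N = 0 -> (k < N)%N ->
  Prob (@hyp_pmf R beta N) (fun L => (TN L v0 == k.+1) && (t * b <= t * (ZN L v0).-1%:R)) <=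
  expR (- (t * b) + (expR t - 1) * hrevealed beta N k.+1) *
    size_law (hsurv (fun j => expR t * beta j) N) N.-1 k.
Proof.
move=> b0 b1 kN; set beta' := fun j => expR t * beta j.
have b0' j : 0 <= beta' j by rewrite mulr_ge0 ?expR_ge0.
have b1' : beta' 1%N = 0 by rewrite /beta' b1 mulr0.
rewrite -(Prob_TN b0' b1' kN).
have := Prob_size k.+1 (fun S L => t * b <= t * (\sum_(A : {set 'I_N} | A \subset S) L A)%N%:R) b0.
rewrite (_ : Prob _ _ = Prob (@hyp_pmf R beta N)
  (fun L => (TN L v0 == k.+1) && (t * b <= t * (ZN L v0).-1%:R))); last first.
  by congr (Prob _); apply/funext => L; rewrite ZNE.
move=> ->; rewrite Prob_size1 // mulr_sumr; apply: ler_sum => S /andP[v0S /eqP Sk].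
pose Q (A : {set 'I_N}) := (A \subset S) || (A \in bdry setT S).
have SQ (W : nmodType) (F : {set 'I_N} -> W) :
    \sum_(A | Q A) F A = \sum_(A : {set 'I_N} | A \subset S) F A + \sum_(A in bdry setT S) F A.
  rewrite (bigID (fun A : {set 'I_N} => A \subset S)) /=; congr (_ + _); apply: eq_bigl => A.
    by rewrite /Q; case: (A \subset S); rewrite ?andbF.
  rewrite /Q inE subsetT /=; case AS: (A \subset S) => /=; last by rewrite andbT.
  by move: AS; rewrite -setD_eq0 => /eqP ->; rewrite cards0.
have SQn L : \sum_(A | Q A) L A = (\sum_(A : {set 'I_N} | A \subset S) L A + \sum_(A in bdry setT S) L A)%N.
  exact: (SQ nat).
pose mu'' (A : {set 'I_N}) := if Q A then expR t * hmean beta A else hmean beta A.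
have mu0'' A : 0 <= mu'' A.
  by rewrite /mu''; case: ifP => _; rewrite ?mulr_ge0 ?expR_ge0 ?hmean_ge0.
have rates'' : rates v0 mu'' (hrate beta' N) S.
  move=> W w v0W WS wS wW; rewrite hrateZ -(@hmean_rates beta N v0 setT W w v0W) // ?inE // mulr_sumr.
  apply: eq_bigr => B; rewrite setD_eq1 => /and3P[wB _ BW].
  rewrite /mu'' /Q; suff -> : B \subset S by [].
  apply/subsetP => x xB; have [->//|xw] := eqVneq x w.
  by apply: (subsetP WS); apply: (subsetP BW); rewrite !inE xw.
(* The means tilted on [Q] and the means all scaled by [expR t] agree on every hyperedge that
   decides whether the domain is [S]. *)
have e'' : Prob (ppois mu'') (fun L => cl v0 setT (supp L) == S) =
    Prob (@hyp_pmf R beta' N) (fun L => cl v0 setT (supp L) == S).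
  rewrite (Prob_domain mu0'' (hrate0 N b1') v0S rates'') hyp_pmfE.
  rewrite (Prob_domain (r := hrate beta' N)) //; last first.
  - exact: hmean_rates.
  - exact: hrate0.
  - by move=> A; exact: hmean_ge0.
  congr (_ * expR (- _)); apply: eq_bigr => B BS; rewrite /mu'' /Q BS orbT.
  by rewrite /hmean /beta'; ring.
rewrite -{}e'' hyp_pmfE; apply: Prob_change.
- by move=> L; rewrite ppois_ge0 // => A; exact: hmean_ge0.
- by rewrite esum_ppois // => A; exact: hmean_ge0.
- by move=> L; rewrite ppois_ge0.
- by rewrite esum_ppois.
- exact: expR_ge0.
move=> L; have [clS|_] /= := boolP (cl v0 setT (supp L) == S); last by rewrite !mulr0.
rewrite mulr1 expRD -mulrA.
have -> : hrevealed beta N k.+1 = \sum_(A | Q A) hmean beta A.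
  by rewrite SQ sum_hmean_inner sum_bdry_hmean // Sk.
rewrite -(ppois_tilt (@hmean beta N) t Q L) mulrCA -expRD.
rewrite ler_wpM2l //; first by rewrite ppois_ge0 // => A; exact: hmean_ge0.
(* On the event the hyperedges with one vertex outside [S] are absent, so the tilted count is the
   count inside [S]. *)
rewrite SQn [X in (_ + X)%N]big1 ?addn0 => [|A AB]; last first.
  move: clS; rewrite cl_eq ?inE // => /and3P[_ _ /forall_inP H].
  move: AB; rewrite inE => /andP[AT A1]; have := H A; rewrite inE AT A1 /=.
  by case: (L A) => // n /(_ isT).
case: (leP (t * b)) => [H|_]; last by rewrite /= expR_ge0.
by rewrite -[leLHS]expR0 ler_expR addrC subr_ge0.
Qed.

End Fixed.
End HypergraphLaw.

(** * Functions with prescribed fibres, and the law of [M] *)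

Section Fibres.
Import boot.fintype boot.finset.
Local Open Scope nat_scope.

Definition fibre k (J : finType) (f : {ffun 'I_k -> J}) (y : J) : nat := \sum_i (f i == y).

Definition ffun_cons k (J : finType) (x : J) (f : {ffun 'I_k -> J}) : {ffun 'I_k.+1 -> J} :=
  [ffun i => if unlift ord0 i is Some j then f j else x].

Lemma big_ffun_cons (R : Type) (idx : R) (op : Monoid.com_law idx) k (J : finType)
    (F : {ffun 'I_k.+1 -> J} -> R) :
  \big[op/idx]_f F f = \big[op/idx]_x \big[op/idx]_f F (ffun_cons x f).
Proof.
rewrite pair_bigA /= (reindex (fun p : J * {ffun 'I_k -> J} => ffun_cons p.1 p.2)) //.
exists (fun f : {ffun 'I_k.+1 -> J} => (f ord0, [ffun j => f (lift ord0 j)])).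
  move=> [x f] _ /=; rewrite ffunE unlift_none; congr (_, _).
  by apply/ffunP => j; rewrite !ffunE liftK.
move=> f _ /=; apply/ffunP => i; rewrite ffunE.
by case: unliftP => [j ->|->]; rewrite ?ffunE.
Qed.

Lemma fibre_cons k (J : finType) (x y : J) (f : {ffun 'I_k -> J}) :
  fibre (ffun_cons x f) y = (x == y) + fibre f y.
Proof.
rewrite /fibre big_ord_recl ffunE unlift_none; congr (_ + _).
by apply: eq_bigr => i _; rewrite ffunE liftK.
Qed.

Lemma sum_fibre k (J : finType) (f : {ffun 'I_k -> J}) (P : pred J) :
  \sum_(y | P y) fibre f y = #|[set i | P (f i)]|.
Proof.
rewrite /fibre exchange_big /= -sum1_card [RHS]big_mkcond /=; apply: eq_bigr => i _.
rewrite inE; case: ifP => Pi.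
  by rewrite (bigD1 (f i)) //= eqxx big1 // => y /andP[_ /negPf]; rewrite eq_sym => ->.
by apply: big1 => y Py; case: eqP => // e; rewrite -e Pi in Py.
Qed.

(** The multinomial coefficient in division-free form, by induction on [k] after fixing the value at
    [ord0]. *)
Lemma card_fibre k (J : finType) (a : J -> nat) : \sum_y a y = k ->
  #|[set f : {ffun 'I_k -> J} | [forall y, fibre f y == a y]]| * \prod_y (a y)`! = k`!.
Proof.
move=> ak0; rewrite -sum1_card (eq_bigl (fun f : {ffun 'I_k -> J} => [forall y, fibre f y == a y])); last first.
  by move=> f; rewrite inE.
rewrite big_mkcond /=; move: ak0.
elim: k a => [|k IHk] a ak.
  have a0 y : a y = 0.
    by apply/eqP; rewrite -leqn0 -ak (bigD1 y) //= leq_addr.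
  have -> : \prod_y (a y)`! = 1 by rewrite big1 // => y _; rewrite a0.
  rewrite muln1 (eq_bigr (fun=> 1)); first by rewrite sum1_card card_ffun card_ord.
  move=> f _; case: ifP => // /negbT /forallPn[y].
  by rewrite a0 /fibre big_ord0.
rewrite big_ffun_cons big_distrl /= factS -[X in _ = X * _]ak big_distrl /=; apply: eq_bigr => x _.
have [ax|ax] := posnP (a x).
  rewrite ax mul0n [X in X * _]big1 ?mul0n // => f _.
  by case: ifP => // /forallP /(_ x); rewrite fibre_cons ax eqxx.
pose b y := a y - (x == y).
have ab y : a y = (x == y) + b y by rewrite /b; case: eqVneq => [<-|_]; lia.
have bk : \sum_y b y = k.
  move: ak; under eq_bigr do rewrite ab.
  rewrite big_split /= (bigD1 x) //= eqxx big1 => [|y /negPf]; last by rewrite eq_sym => ->.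
  by rewrite addn0 add1n => -[].
rewrite -(IHk b bk) [RHS]mulnCA.
have -> : \prod_y (a y)`! = a x * \prod_y (b y)`!.
  rewrite !(bigD1 (P := predT) x) //= mulnA; congr (_ * _).
    by rewrite (ab x) eqxx add1n factS.
  by apply: eq_bigr => y /negPf yx; rewrite ab eq_sym yx.
congr (_ * _); apply: eq_bigr => f _; congr (if _ then _ else _).
by apply: eq_forallb => y; rewrite fibre_cons (ab y) eqn_add2l.
Qed.

Definition parking k (f : {ffun 'I_k -> 'I_k.+1}) : bool :=
  [forall l : 'I_k.+1, l <= #|[set j | f j < l]|].

Definition nparking k : nat := #|[set f : {ffun 'I_k -> 'I_k.+1} | parking f]|.

(** With the occupation numbers as increments, the parking condition says that the walk is positive
    before time [k.+1]; it vanishes at that time because the occupation numbers always sum to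
    [k]. *)
Lemma parkingE k (f : {ffun 'I_k -> 'I_k.+1}) :
  parking f = hits_at [ffun i => fibre f i].
Proof.
rewrite /parking /hits_at.
have E (P : pred 'I_k.+1) : \sum_(i | P i) [ffun i0 => fibre f i0] i = #|[set j | P (f j)]|.
  by rewrite -sum_fibre; apply: eq_bigr => i _; rewrite ffunE.
rewrite (E predT) [X in (1 + X == _)](_ : _ = k) ?add1n ?eqxx ?andbT; last first.
  by rewrite (eq_card (B := predT)) ?card_ord // => i; rewrite !inE.
by apply: eq_forallb => l; rewrite E ltnS.
Qed.

Lemma nparkingE k :
  nparking k = \sum_(a : {ffun 'I_k.+1 -> 'I_k.+1} | hits_at [ffun i => a i : nat])
    #|[set f : {ffun 'I_k -> 'I_k.+1} | [forall y, fibre f y == a y]]|.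
Proof.
rewrite /nparking -sum1_card.
rewrite (eq_bigl (fun f : {ffun 'I_k -> 'I_k.+1} => parking f)) => [|f]; last by rewrite inE.
have fk (f : {ffun 'I_k -> 'I_k.+1}) i : fibre f i < k.+1.
  rewrite ltnS; apply: (@leq_trans (\sum_(j : 'I_k) 1)); last by rewrite sum1_card card_ord.
  by apply: leq_sum => j _; case: (_ == _).
rewrite (partition_big (fun f : {ffun 'I_k -> 'I_k.+1} => [ffun i => Ordinal (fk f i)])
  (fun a : {ffun 'I_k.+1 -> 'I_k.+1} => hits_at [ffun i => a i : nat])) /=; last first.
  move=> f; rewrite parkingE; congr hits_at; apply/ffunP => i; rewrite !ffunE //.
apply: eq_bigr => a ha; rewrite -sum1_card; apply: eq_bigl => f; rewrite inE.
apply/andP/forallP => [[_ /eqP <-] y|H]; first by rewrite ffunE.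
have e : [ffun i => Ordinal (fk f i)] = a.
  by apply/ffunP => i; apply: val_inj; rewrite ffunE /=; apply/eqP.
split; last by apply/eqP.
rewrite parkingE; move: ha; congr (is_true (hits_at _)); apply/ffunP => i.
by rewrite !ffunE; apply/esym/eqP.
Qed.

End Fibres.

Section LawM.
Import boot.fintype boot.finset.
Variable R : realType.

(** The condition [good] keeps all arrival times at most [k], below the truncation value [k.+1], so
    only differences of [e] occur. *)
Lemma thE (e : nat -> R) k : th e k =
  \sum_(f : {ffun 'I_k -> 'I_k.+1} | parking f) \prod_j (e (f j) - e (f j).+1).
Proof.
rewrite /th /theta /wsum.
rewrite (bigID (fun x => good setT x)) /= [X in _ + X]big1 ?addr0 => [|x /negPf ->]; last by rewrite mulr0.
rewrite (reindex_onto (fun f : {ffun 'I_k -> 'I_k.+1} => [ffun j => widen_ord (leqnSn k.+1) (f j)])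
  (fun x : {ffun 'I_k -> 'I_k.+2} => [ffun j => inord (x j)])) /=; last first.
  move=> x /andP[/forall_inP gx _]; apply/ffunP => j; rewrite !ffunE; apply: val_inj => /=.
  by rewrite inordK //; have := gx j; rewrite inE cardsT card_ord ltnS => /(_ isT).
apply: eq_big => [f|f].
  rewrite [X in _ && X](_ : _ = true) ?andbT; last first.
    by apply/eqP/ffunP => j; rewrite !ffunE; apply: val_inj; rewrite /= inordK.
  rewrite /good /parking cardsT card_ord.
  rewrite [X in X && _](_ : _ = true) /=; last first.
    by apply/forall_inP => j _; rewrite ffunE /= -ltnS.
  apply: eq_forallb => l; congr (_ <= _)%N; apply: eq_card => j.
  by rewrite !inE ffunE.
move=> /andP[-> _]; rewrite mulr1; apply: eq_bigr => j _.
by rewrite ffunE /arr /= ltn_ord.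
Qed.

(** The factorials of the Poisson weights combine, by the multinomial coefficient, into the same
    count [nparking] that governs the limit of [th]. *)
Lemma PME (beta : nat -> R) k : 0 <= beta 2%N ->
  PM beta k.+1 = expR (- (2 * beta 2%N * k.+1%:R)) * (2 * beta 2%N) ^+ k * (nparking k)%:R / k`!%:R.
Proof.
set lam := 2 * beta 2%N; move=> b2; have lam0 : 0 <= lam by rewrite mulr_ge0.
rewrite /PM -/lam.
pose lift (a : {ffun 'I_k.+1 -> 'I_k.+1}) : {ffun 'I_k.+1 -> nat} := [ffun i => a i : nat].
have lift_inj : injective lift.
  by move=> a b /ffunP e; apply/ffunP => i; have := e i; rewrite !ffunE => /val_inj.
(* The increments of a path that hits 0 at [k.+1] sum to [k], so the infinite sum reduces to a
   finite one. *)
have hk (x : {ffun 'I_k.+1 -> nat}) : hits_at x -> forall i, (x i < k.+1)%N.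
  move=> /andP[_ /eqP[e]] i; rewrite ltnS -[leqRHS]e (bigD1 i) //= leq_addr //.
have -> : (\esum_(x in [set x : {ffun 'I_k.+1 -> nat} | hits_at x]%classic)
      (\prod_(i < k.+1) Defs.poisson_pmf lam (x i))%:E =
    \esum_(a in [set a | hits_at (lift a)]%classic)
      (\prod_(i < k.+1) Defs.poisson_pmf lam (lift a i))%:E)%E.
  apply: (@reindex_esum _ _ _ _ _ lift (fun x => (\prod_(i < k.+1) Defs.poisson_pmf lam (x i))%:E)).
  split; first by move=> a.
    by move=> a b _ _; exact: lift_inj.
  move=> x hx; have e : lift [ffun i => Ordinal (hk x hx i)] = x.
    by apply/ffunP => i; rewrite !ffunE.
  by exists [ffun i => Ordinal (hk x hx i)] => //=; rewrite e.
rewrite esum_fset; last first.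
- by move=> a _; rewrite lee_fin; apply: prodr_ge0 => i _; exact: poisson_pmf_ge0.
- exact: finite_finset.
rewrite (_ : [set a | hits_at (lift a)]%classic = [set` [pred a | hits_at (lift a)]]%classic); last first.
  by apply/seteqP; split => a /=; rewrite inE.
rewrite -(@bigfs _ _ _ _ (index_enum {ffun 'I_k.+1 -> 'I_k.+1})) ?index_enum_uniq //; last first.
  by move=> a _; rewrite mem_index_enum.
rewrite sumEFin /= nparkingE natr_sum mulr_sumr mulr_suml; apply: eq_bigr => a ha.
have ak : (\sum_(i : 'I_k.+1) (a i : nat) = k)%N.
  move: ha => /andP[_ /eqP[e]]; apply/(etrans _ e)/eq_bigr => i _; by rewrite ffunE.
have := card_fibre ak; set c := #|_|%N => ck.
rewrite /Defs.poisson_pmf !big_split /= prodr_const card_ord -expRM_natr mulNr -!mulrA.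
congr (_ * _).
rewrite (eq_bigr (fun i => lam ^+ a i)) => [|i _]; last by rewrite ffunE.
rewrite -expr_sum ak; congr (_ * _).
rewrite (eq_bigr (fun i => ((a i)`!%:R)^-1)) => [|i _]; last by rewrite ffunE.
rewrite prodfV -natr_prod -ck natrM.
have c0 : (c%:R : R) != 0.
  rewrite pnatr_eq0 -lt0n; have : (0 < k`!)%N by exact: fact_gt0.
  by rewrite -ck muln_gt0 => /andP[].
have p0 : ((\prod_(i : 'I_k.+1) (a i)`!)%N%:R : R) != 0.
  rewrite pnatr_eq0 -lt0n; have : (0 < k`!)%N by exact: fact_gt0.
  by rewrite -ck muln_gt0 => /andP[].
by rewrite invfM mulrA divff // mul1r.
Qed.

Lemma PM0 (beta : nat -> R) : PM beta 0 = 0.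
Proof.
rewrite /PM (_ : [set x | _]%classic = classical_sets.set0) ?esum_set0 //.
apply/seteqP; split=> // x /= /andP[_]; by rewrite big_ord0.
Qed.

Lemma PM_ge0 (beta : nat -> R) k : 0 <= beta 2%N -> 0 <= PM beta k.
Proof.
case: k => [|k] b2; first by rewrite PM0.
by rewrite PME // !mulr_ge0 ?expR_ge0 ?exprn_ge0 ?invr_ge0 ?mulr_ge0.
Qed.
End LawM.

(** * Convergence of the law of the size *)

Section SizeLimit.
Local Open Scope classical_set_scope.
Variables (R : realType).
Implicit Types (beta c : nat -> R).

(** The power series with coefficients [c] at [k / M], with falling factorials in place of
    powers. *)
Definition binratio c k M : R := \sum_(j < k.+1) c j * ('C(k, j)%:R / 'C(M, j)%:R).

Lemma hrateE beta n k :
  hrate beta n.+1 k = binratio (fun j => j.+1%:R * beta j.+1) k n.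
Proof.
apply: eq_bigr => j _.
have key : n.+1%:R / 'C(n.+1, j.+1)%:R = j.+1%:R / 'C(n, j)%:R :> R.
  have := mul_bin_diag n.+1 j => /(congr1 (fun i => i%:R : R)); rewrite !natrM /= => e.
  have [nj|nj] := ltnP n j.
    by rewrite (@bin_small n j) // (@bin_small n.+1 j.+1) // !invr0 !mulr0.
  have b0 : 'C(n.+1, j.+1)%:R != 0 :> R by rewrite pnatr_eq0 -lt0n bin_gt0 ltnS.
  have b0' : 'C(n, j)%:R != 0 :> R by rewrite pnatr_eq0 -lt0n bin_gt0.
  by apply/eqP; rewrite eqr_div // e.
transitivity ('C(k, j)%:R * beta j.+1 * (n.+1%:R / 'C(n.+1, j.+1)%:R)); first by ring.
by rewrite key; ring.
Qed.

Lemma hinnerE beta N k : hinner beta N k = N%:R * binratio beta k N.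
Proof. by rewrite mulr_sumr; apply: eq_bigr => j _; ring. Qed.

Lemma cvg_exprn (u : nat -> R) (l : R) k :
  u n @[n --> \oo] --> l -> u n ^+ k @[n --> \oo] --> l ^+ k.
Proof.
move=> ul; elim: k => [|k IHk].
  by under eq_cvg do rewrite expr0; rewrite expr0; exact: cvg_cst.
by under eq_cvg do rewrite exprS; rewrite exprS; exact: cvgM.
Qed.

Lemma natr1_cvg_inv : (n.+1%:R^-1 : R) @[n --> \oo] --> (0 : R).
Proof. exact: cvg_harmonic. Qed.

Lemma bin_cvg k : ('C(n, k)%:R / n.+1%:R ^+ k : R) @[n --> \oo] --> (k`!%:R^-1 : R).
Proof.
elim: k => [|k IHk].
  by under eq_cvg do rewrite bin0 expr0 divr1; rewrite fact0 invr1; exact: cvg_cst.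
have H : (('C(n, k)%:R / n.+1%:R ^+ k) * ((1 - k.+1%:R * n.+1%:R^-1) / k.+1%:R) : R) @[n --> \oo] -->
    (k`!%:R^-1 * ((1 - k.+1%:R * 0) / k.+1%:R) : R).
  apply: cvgM => //; apply: cvgMl; apply: cvgB; first exact: cvg_cst.
  by apply: cvgMr; exact: natr1_cvg_inv.
have -> : (k.+1`!%:R^-1 : R) = k`!%:R^-1 * ((1 - k.+1%:R * 0) / k.+1%:R).
  by rewrite mulr0 subr0 mul1r factS natrM invfM mulrC.
apply: cvg_trans H; apply: near_eq_cvg; near=> n.
have kn : (k <= n)%N by near: n; exact: nbhs_infty_ge.
have := mul_bin_left n k => /(congr1 (fun i => i%:R : R)); rewrite !natrM natrB // => e.
have k0 : k.+1%:R != 0 :> R by rewrite pnatr_eq0.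
have n0 : n.+1%:R != 0 :> R by rewrite pnatr_eq0.
have -> : 'C(n, k.+1)%:R = (n%:R - k%:R) * 'C(n, k)%:R / k.+1%:R :> R by rewrite -e mulrC mulKf.
have -> : (1 - k.+1%:R / n.+1%:R : R) = (n%:R - k%:R) / n.+1%:R.
  by apply: (mulIf n0); rewrite mulrBl !divfK // mul1r -[n.+1]addn1 -[k.+1]addn1 !natrD; ring.
by rewrite exprS; field; rewrite expf_neq0 //= -!natr1 in k0 n0 *; rewrite ![1 + _]addrC n0 k0.
Unshelve. all: by end_near. Qed.

(** Only hyperedges of two vertices survive: the term of index [j] in [hrateE] has order [n ^- j],
    and the term [j = 0] vanishes with [beta 1]. *)
Lemma hrate_cvg beta k : beta 1%N = 0 ->
  (n.+1%:R * hrate beta n.+1 k : R) @[n --> \oo] --> (2 * beta 2%N * k%:R : R).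
Proof.
move=> b1; pose l j : R := if j == 1%N then 2 * beta 2%N * k%:R else 0.
have -> : 2 * beta 2%N * k%:R = \sum_(j < k.+1) l j.
  case: k @l => [|k] l; first by rewrite big_ord_recl big_ord0 /l /= mulr0 addr0.
  by rewrite !big_ord_recl /= /l /= add0r big1 ?addr0 // => i _.
under eq_cvg do rewrite hrateE mulr_sumr.
apply: (@cvg_big R _ +%R 0 xpredT _ nat eventually (index_enum 'I_k.+1)
  (fun j n => n.+1%:R * (j.+1%:R * beta j.+1 * ('C(k, j)%:R / 'C(n, j)%:R))) (fun j => l j)).
  exact: add_continuous.
move=> [[|[|j]] jk] _ /=.
- under eq_cvg do rewrite b1 mulr0 mul0r mulr0; exact: cvg_cst.
- rewrite /l /= bin1.
  have H : ((2 * beta 2%N * k%:R) * ('C(n, 1)%:R / n.+1%:R ^+ 1)^-1 : R) @[n --> \oo] -->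
     (2 * beta 2%N * k%:R * (1`!%:R^-1)^-1 : R).
    by apply: cvgMr; apply: cvgV; [rewrite invr_eq0 pnatr_eq0|exact: bin_cvg].
  move: H; rewrite (_ : 1`! = 1%N) // invrK mulr1; apply: cvg_trans; apply: near_eq_cvg; near=> n.
  by rewrite bin1 expr1 invfM invrK; ring.
- rewrite /l /=.
  have H : ((j.+3%:R * beta j.+3 * 'C(k, j.+2)%:R) * (('C(n, j.+2)%:R / n.+1%:R ^+ j.+2)^-1 *
      (n.+1%:R^-1) ^+ j.+1) : R) @[n --> \oo] -->
     (j.+3%:R * beta j.+3 * 'C(k, j.+2)%:R * ((j.+2`!%:R^-1)^-1 * 0 ^+ j.+1) : R).
    apply: cvgMr; apply: cvgM.
      by apply: cvgV; [rewrite invr_eq0 pnatr_eq0 -lt0n fact_gt0|exact: bin_cvg].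
    by apply: cvg_exprn; exact: natr1_cvg_inv.
  move: H; rewrite expr0n /= !mulr0; apply: cvg_trans; apply: near_eq_cvg; near=> n.
  have n0 : n.+1%:R != 0 :> R by rewrite pnatr_eq0.
  rewrite invfM invrK exprVn [n.+1%:R ^+ j.+2]exprS.
  have : n.+1%:R ^+ j.+1 != 0 :> R by rewrite expf_neq0.
  move: ('C(n, j.+2)%:R^-1) (n.+1%:R ^+ j.+1) => x y y0.
  by field.
Unshelve. all: by end_near. Qed.

Lemma hrate_cvg0 beta k : beta 1%N = 0 -> (hrate beta n.+1 k : R) @[n --> \oo] --> (0 : R).
Proof.
move=> b1; have H : (n.+1%:R^-1 * (n.+1%:R * hrate beta n.+1 k) : R) @[n --> \oo] -->
    (0 * (2 * beta 2%N * k%:R) : R) by apply: cvgM; [exact: natr1_cvg_inv|exact: hrate_cvg].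
rewrite mul0r in H; apply: cvg_trans H; apply: near_eq_cvg; near=> n.
by rewrite mulKf // pnatr_eq0.
Unshelve. all: by end_near. Qed.

Lemma expR_cvg (u : nat -> R) (l : R) :
  u n @[n --> \oo] --> l -> expR (u n) @[n --> \oo] --> expR l.
Proof. by move=> ul; apply: continuous_cvg => //; exact: continuous_expR. Qed.

Lemma hsurv_cvg1 beta k : beta 1%N = 0 -> (hsurv beta n.+1 k : R) @[n --> \oo] --> (1 : R).
Proof. by move=> b1; rewrite -expR0 -oppr0; apply: expR_cvg; apply: cvgN; exact: hrate_cvg0. Qed.

Lemma hsurv_cvg beta k : (forall k, 0 <= beta k) -> beta 1%N = 0 ->
  (n.+1%:R * (1 - hsurv beta n.+1 k) : R) @[n --> \oo] --> (2 * beta 2%N * k%:R : R).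
Proof.
move=> b0 b1.
have r0 n : 0 <= hrate beta n.+1 k by exact: hrate_ge0.
(* Uses [r * expR (- r) <= 1 - expR (- r) <= r]. *)
apply: (squeeze_cvgr (f := fun n => n.+1%:R * hrate beta n.+1 k * hsurv beta n.+1 k)
   (h := fun n => n.+1%:R * hrate beta n.+1 k)).
- near=> n; have := expR_ge1Dx (hrate beta n.+1 k); have := expR_ge1Dx (- hrate beta n.+1 k).
  have e1 : hsurv beta n.+1 k * expR (hrate beta n.+1 k) = 1 by rewrite -expRD addNr expR0.
  have e0 : 0 < hsurv beta n.+1 k := expR_gt0 _.
  rewrite -/(hsurv beta n.+1 k) => h1 h2; rewrite -mulrA !ler_pM2l ?ltr0n //.
  by apply/andP; split; nra.
- rewrite -[X in _ --> X]mulr1; apply: cvgM; [exact: hrate_cvg|exact: hsurv_cvg1].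
- exact: hrate_cvg.
Unshelve. all: by end_near. Qed.

(** By [thE] it suffices that each arrival time has a fixed finite value with probability asymptotic
    to [2 * beta 2 / n], whatever that value is. *)
Lemma th_cvg beta k : (forall k, 0 <= beta k) -> beta 1%N = 0 ->
  (n.+1%:R ^+ k * th (hsurv beta n.+1) k : R) @[n --> \oo] -->
  ((2 * beta 2%N) ^+ k * (nparking k)%:R : R).
Proof.
move=> b0 b1; set lam := 2 * beta 2%N.
have -> : lam ^+ k * (nparking k)%:R = \sum_(f : {ffun 'I_k -> 'I_k.+1} | parking f) \prod_(j < k) lam.
  rewrite (eq_bigr (fun=> lam ^+ k)) => [|f _]; last by rewrite prodr_const card_ord.
  by rewrite sumr_const mulr_natr; congr (_ *+ _); apply: eq_card => f; rewrite !inE.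
under eq_cvg => n do rewrite thE mulr_sumr.
apply: (@cvg_big R _ +%R 0 (@parking k) _ nat eventually (index_enum {ffun 'I_k -> 'I_k.+1})
  (fun f n => n.+1%:R ^+ k * \prod_j (hsurv beta n.+1 (f j) - hsurv beta n.+1 (f j).+1))
  (fun=> \prod_(j < k) lam)).
  exact: add_continuous.
move=> f _ /=.
have e n : n.+1%:R ^+ k * \prod_j (hsurv beta n.+1 (f j) - hsurv beta n.+1 (f j).+1) =
   \prod_(j < k) (n.+1%:R * (hsurv beta n.+1 (f j) - hsurv beta n.+1 (f j).+1)).
  by rewrite big_split /= prodr_const card_ord.
under eq_cvg do rewrite e.
apply: (@cvg_big R _ *%R 1 xpredT _ nat eventually (index_enum 'I_k)
  (fun j n => n.+1%:R * (hsurv beta n.+1 (f j) - hsurv beta n.+1 (f j).+1)) (fun=> lam)).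
  exact: mul_continuous.
move=> j _ /=.
have -> : lam = lam * (f j).+1%:R - lam * (f j)%:R by rewrite -natr1; ring.
have H : (n.+1%:R * (1 - hsurv beta n.+1 (f j).+1) - n.+1%:R * (1 - hsurv beta n.+1 (f j)) : R)
    @[n --> \oo] --> (lam * (f j).+1%:R - lam * (f j)%:R : R).
  by apply: cvgB; exact: hsurv_cvg.
by apply: cvg_trans H; apply: near_eq_cvg; near=> n => /=; ring.
Unshelve. all: by end_near. Qed.

Lemma size_law_cvg beta k : (forall k, 0 <= beta k) -> beta 1%N = 0 ->
  (size_law (hsurv beta n.+1) n k : R) @[n --> \oo] --> (PM beta k.+1 : R).
Proof.
move=> b0 b1; rewrite PME //; set lam := 2 * beta 2%N.
have H1 : (('C(n, k)%:R / n.+1%:R ^+ k) * (n.+1%:R ^+ k * th (hsurv beta n.+1) k) : R) @[n --> \oo] -->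
    (k`!%:R^-1 * (lam ^+ k * (nparking k)%:R) : R).
  by apply: cvgM; [exact: bin_cvg|exact: th_cvg].
have H2 : (hsurv beta n.+1 k.+1 ^+ (n - k) : R) @[n --> \oo] --> (expR (- (lam * k.+1%:R)) : R).
  have H : (expR (- (n.+1%:R * hrate beta n.+1 k.+1 - k.+1%:R * hrate beta n.+1 k.+1)) : R) @[n --> \oo]
      --> (expR (- (lam * k.+1%:R)) : R).
    apply: expR_cvg; apply: cvgN; rewrite -[X in _ --> X]subr0 -(mulr0 k.+1%:R).
    by apply: cvgB; [exact: hrate_cvg|apply: cvgMr; exact: hrate_cvg0].
  apply: cvg_trans H; apply: near_eq_cvg; near=> n.
  have kn : (k <= n)%N by near: n; exact: nbhs_infty_ge.
  by rewrite /hsurv -expRM_natr natrB // -!natr1; congr expR; ring.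
have -> : expR (- (lam * k.+1%:R)) * lam ^+ k * (nparking k)%:R / k`!%:R =
  k`!%:R^-1 * (lam ^+ k * (nparking k)%:R) * expR (- (lam * k.+1%:R)) by ring.
apply: cvg_trans (cvgM H1 H2); apply: near_eq_cvg; near=> n => /=.
rewrite /size_law; congr (_ * _); rewrite mulrA; congr (_ * _).
by rewrite divfK // expf_neq0 // pnatr_eq0.
Unshelve. all: by end_near. Qed.

End SizeLimit.

(** * Power series with summable non-negative coefficients *)

Section PowerSeries.
Variables (R : realType) (c : nat -> R).
Hypotheses (c_ge0 : forall k, 0 <= c k) (c_sum : (\esum_(k in setT) (c k)%:E < +oo)%E).

Implicit Types (x y e : R).

Definition powser (x : R) : R := fine (\esum_(k in setT) (c k * x ^+ k)%:E)%E.

Lemma powser_cvg x : 0 <= x <= 1 ->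
  (\sum_(j < J) c j * x ^+ j @[J --> \oo] --> powser x)%classic.
Proof.
move=> /andP[x0 x1].
have t0 k : 0 <= c k * x ^+ k by rewrite mulr_ge0 ?exprn_ge0.
have fin : (\esum_(k in setT) (c k * x ^+ k)%:E)%E \is a fin_num.
  rewrite ge0_fin_numE; last by apply: esum_ge0 => k _; rewrite lee_fin.
  apply: le_lt_trans c_sum; apply: le_esum => k _; rewrite lee_fin.
  by rewrite ler_piMr // exprn_ile1.
have : (\sum_(0 <= j < J) (c j * x ^+ j)%:E @[J --> \oo] --> (powser x)%:E)%classic%E.
  rewrite /powser fineK // -nneseries_esumT => [|k]; last by rewrite lee_fin.
  by apply: is_cvg_nneseries => k _ _; rewrite lee_fin.
under eq_cvg do rewrite sumEFin big_mkord.
by move/fine_cvgP => [_].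
Qed.

Lemma psum_le_powser x J : 0 <= x <= 1 -> \sum_(j < J) c j * x ^+ j <= powser x.
Proof.
move=> x01; have /andP[x0 x1] := x01; apply: (cvgr_to_ge (powser_cvg x01)); near=> K.
have JK : (J <= K)%N by near: K; exact: nbhs_infty_ge.
rewrite -(subnKC JK) big_split_ord /= lerDl sumr_ge0 // => j _.
by rewrite mulr_ge0 ?exprn_ge0.
Unshelve. all: by end_near. Qed.

Lemma powser_ge0 x : 0 <= x <= 1 -> 0 <= powser x.
Proof. by move=> x01; have := psum_le_powser 0 x01; rewrite big_ord0. Qed.

Lemma powser_le x y : 0 <= x -> x <= y -> y <= 1 -> powser x <= powser y.
Proof.
move=> x0 xy y1.
have x01 : 0 <= x <= 1 by rewrite x0 (le_trans xy).
have y01 : 0 <= y <= 1 by rewrite y1 (le_trans x0).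
apply: ler_cvg_to (powser_cvg x01) (powser_cvg y01) _; apply: nearW => J.
by apply: ler_sum => j _; apply: ler_wpM2l => //; apply: lerXn2r; rewrite ?nnegrE // (le_trans x0).
Qed.

(** The tail at [x] is dominated by the tail at 1; this uniformity replaces any differentiation of
    the series. *)
Lemma powser_tail e : 0 < e -> exists J, forall x, 0 <= x <= 1 ->
  powser x <= \sum_(j < J) c j * x ^+ j + e.
Proof.
move=> e0; have one01 : 0 <= (1 : R) <= 1 by rewrite ler01 lexx.
have /cvgrPdist_le /(_ e e0) [J _ HJ] := powser_cvg one01.
exists J => x x01; have /andP[x0 x1] := x01.
apply: (cvgr_to_le (powser_cvg x01)); near=> K.
have JK : (J <= K)%N by near: K; exact: nbhs_infty_ge.
have := HJ K JK; have := HJ J (leqnn J); have := psum_le_powser K one01.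
move=> K1 /ler_normlP[_ HJ1] _.
apply: (@le_trans _ _ (\sum_(j < J) c j * x ^+ j + (\sum_(j < K) c j * 1 ^+ j - \sum_(j < J) c j * 1 ^+ j))); last first.
  by rewrite lerD2l; apply: le_trans HJ1; rewrite lerB.
have H : \sum_(j < K - J) c (J + j)%N * x ^+ (J + j) <= \sum_(j < K - J) c (J + j)%N * 1 ^+ (J + j).
  by apply: ler_sum => j _; rewrite ler_wpM2l // expr1n exprn_ile1.
by rewrite -(subnKC JK) !big_split_ord /=; lra.
Unshelve. all: by end_near. Qed.

Lemma exprn_lip (x y : R) j : 0 <= x <= 1 -> 0 <= y <= 1 -> `|x ^+ j - y ^+ j| <= j%:R * `|x - y|.
Proof.
move=> /andP[x0 x1] /andP[y0 y1]; elim: j => [|j IHj]; first by rewrite !expr0 subrr normr0 mul0r.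
have -> : x ^+ j.+1 - y ^+ j.+1 = x * (x ^+ j - y ^+ j) + (x - y) * y ^+ j by rewrite !exprS; ring.
apply: le_trans (ler_normD _ _) _; rewrite !normrM -natr1 mulrDl mul1r lerD //.
  apply: le_trans IHj; rewrite ler_piMl // ger0_norm //.
by rewrite ler_piMr // ger0_norm ?exprn_ge0 // exprn_ile1.
Qed.

Lemma powser_unif e : 0 < e -> exists2 d, 0 < d & forall x y, 0 <= x <= 1 -> 0 <= y <= 1 ->
  `|x - y| <= d -> `|powser x - powser y| <= e.
Proof.
move=> e0; have e20 : 0 < e / 2 by lra.
have [J HJ] := powser_tail e20.
pose B := \sum_(j < J) c j * j%:R.
have B0 : 0 <= B by apply: sumr_ge0 => j _; rewrite mulr_ge0.
(* [B] is a Lipschitz constant of the truncated series; adding 1 keeps the divisor positive. *)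
exists (e / 2 / (B + 1)); first by rewrite divr_gt0 //; lra.
have half x y : 0 <= x <= 1 -> 0 <= y <= 1 -> `|x - y| <= e / 2 / (B + 1) ->
    powser x - powser y <= e.
  move=> x01 y01 xy; have Hx := HJ x x01; have Hy := psum_le_powser J y01.
  have : \sum_(j < J) c j * x ^+ j - \sum_(j < J) c j * y ^+ j <= e / 2.
    rewrite -sumrB; apply: (@le_trans _ _ (\sum_(j < J) c j * j%:R * `|x - y|)).
      apply: ler_sum => j _; rewrite -mulrBr -mulrA; apply: ler_wpM2l => //.
      exact: le_trans (ler_norm _) (exprn_lip _ x01 y01).
    rewrite -mulr_suml -/B; apply: (@le_trans _ _ (B * (e / 2 / (B + 1)))).
      by rewrite ler_wpM2l.
    have B1 : 0 < B + 1 by lra.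
    by rewrite mulrA ler_pdivrMr // [leLHS]mulrC ler_pM2l //; lra.
  lra.
move=> x y x01 y01 xy; rewrite ler_norml half // ?andbT.
by have := half y x y01 x01; rewrite distrC => /(_ xy); lra.
Qed.

(* The ratio [k ^_ j / M ^_ j] of falling factorials. *)
Let rho k M j : R := 'C(k, j)%:R / 'C(M, j)%:R.

Let rhoS k M j : (j < M)%N -> rho k M j.+1 = rho k M j * ((k - j)%:R / (M - j)%:R).
Proof.
move=> jM; rewrite /rho.
have /(congr1 (fun i => i%:R : R)) := mul_bin_left k j.
have /(congr1 (fun i => i%:R : R)) := mul_bin_left M j.
rewrite !natrM => eM ek.
have M0 : (M - j)%:R != 0 :> R by rewrite pnatr_eq0 -lt0n subn_gt0.
have CM : 'C(M, j)%:R != 0 :> R by rewrite pnatr_eq0 -lt0n bin_gt0 ltnW.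
have CM1 : 'C(M, j.+1)%:R != 0 :> R by rewrite pnatr_eq0 -lt0n bin_gt0.
have j0 : j.+1%:R != 0 :> R by rewrite pnatr_eq0.
have -> : 'C(k, j.+1)%:R = (k - j)%:R * 'C(k, j)%:R / j.+1%:R :> R by rewrite -ek mulrC mulKf.
have -> : 'C(M, j.+1)%:R = (M - j)%:R * 'C(M, j)%:R / j.+1%:R :> R by rewrite -eM mulrC mulKf.
by rewrite !invfM invrK; move: (j.+1%:R) j0 => J j0; field; rewrite ?j0 ?M0 ?CM.
Qed.

Let rho_ge0 k M j : 0 <= rho k M j.
Proof. by rewrite /rho divr_ge0. Qed.

Let step_le k M j : (k <= M)%N -> (j < M)%N -> (k - j)%:R / (M - j)%:R <= k%:R / M%:R :> R.
Proof.
move=> kM jM; have M0 : (0 < M)%N by lia.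
rewrite ler_pdivrMr ?ltr0n ?subn_gt0 // mulrAC ler_pdivlMr ?ltr0n // -!natrM ler_nat.
by nia.
Qed.

Let step_ge k M j : (k <= M)%N -> (j < M)%N ->
  k%:R / M%:R - j%:R / (M - j)%:R <= (k - j)%:R / (M - j)%:R :> R.
Proof.
move=> kM jM; have M0 : (0 < M)%N by lia.
rewrite lerBlDr -mulrDl -natrD ler_pdivrMr ?ltr0n // mulrAC ler_pdivlMr ?ltr0n ?subn_gt0 //.
by rewrite -!natrM ler_nat; nia.
Qed.

Let rho_le k M j : (k <= M)%N -> (j <= M)%N -> rho k M j <= (k%:R / M%:R) ^+ j.
Proof.
move=> kM; elim: j => [|j IHj] jM; first by rewrite /rho !bin0 divr1 expr0.
by rewrite rhoS // exprSr ler_pM // ?divr_ge0 //; [apply: IHj; exact: ltnW|exact: step_le].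
Qed.

(** Each factor [(k - i) / (M - i)] is at least [k / M] minus [i / (M - i)], which is at most
    [2 * J / M] because [M - i] is at least half of [M]. All factors lie in the unit interval, so
    the errors add. *)
Let rho_ge k M J j : (k <= M)%N -> (J.*2 <= M)%N -> (0 < M)%N -> (j <= J)%N ->
  (k%:R / M%:R) ^+ j - j%:R * (J.*2%:R / M%:R) <= rho k M j.
Proof.
move=> kM JM M0; elim: j => [|j IHj] jJ; first by rewrite /rho !bin0 divr1 expr0 mul0r subr0.
have jM : (j < M)%N by lia.
have {}IHj := IHj (ltnW jJ); rewrite rhoS //.
set x : R := k%:R / M%:R in IHj *.
have x01 : 0 <= x <= 1 by rewrite /x divr_ge0 //= ler_pdivrMr ?ltr0n // mul1r ler_nat.
have := step_ge kM jM; have := step_le kM jM; rewrite -/x.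
have : j%:R / (M - j)%:R <= J.*2%:R / M%:R :> R.
  rewrite ler_pdivrMr ?ltr0n ?subn_gt0 // mulrAC ler_pdivlMr ?ltr0n // -!natrM ler_nat.
  by nia.
have s0 : 0 <= (k - j)%:R / (M - j)%:R :> R by rewrite divr_ge0.
have r1 : rho k M j <= 1.
  by apply: le_trans (rho_le kM (ltnW jM)) _; rewrite exprn_ile1 //; case/andP: x01.
have := rho_ge0 k M j; have xj : 0 <= x ^+ j by rewrite exprn_ge0 //; case/andP: x01.
have d0 : 0 <= J.*2%:R / M%:R :> R by rewrite divr_ge0.
case/andP: x01 => x0 x1 r0 ad sx xs.
have j0 : 0 <= j%:R :> R by [].
have jd := mulr_ge0 j0 d0.
have h1 := ler_wpM2r x0 IHj.
have h2 : j%:R * (J.*2%:R / M%:R) * x <= j%:R * (J.*2%:R / M%:R) by rewrite ler_piMr.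
have h3 : rho k M j * (x - (k - j)%:R / (M - j)%:R) <= x - (k - j)%:R / (M - j)%:R.
  by rewrite ler_piMl // subr_ge0.
rewrite exprSr -natr1; lra.
Qed.

Lemma binratio_le k M : (k <= M)%N -> (0 < M)%N -> binratio c k M <= powser (k%:R / M%:R).
Proof.
move=> kM M0; apply: le_trans (psum_le_powser k.+1 _); last first.
  by rewrite divr_ge0 //= ler_pdivrMr ?ltr0n // mul1r ler_nat.
apply: ler_sum => j _; apply: ler_wpM2l => //; apply: rho_le => //.
by apply: leq_trans kM; rewrite -ltnS.
Qed.

Lemma psum_le_binratio k M J : \sum_(j < J) c j * ('C(k, j)%:R / 'C(M, j)%:R) <= binratio c k M.
Proof.
pose f j := c j * ('C(k, j)%:R / 'C(M, j)%:R).
have f0 j : 0 <= f j by rewrite mulr_ge0 // divr_ge0.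
have f_out j : (k < j)%N -> f j = 0 by move=> kj; rewrite /f bin_small // mul0r mulr0.
have [Jk|kJ] := leqP J k.+1.
  rewrite /binratio -(subnKC Jk) big_split_ord /= lerDl sumr_ge0 // => j _; exact: f0.
rewrite -(subnKC (ltnW kJ)) big_split_ord /= [X in _ + X]big1 ?addr0 // => j _.
by apply: f_out; rewrite /= addSn ltnS leq_addr.
Qed.

Lemma binratio_ge e : 0 < e -> exists M0, forall M k, (M0 <= M)%N -> (k <= M)%N ->
  powser (k%:R / M%:R) - e <= binratio c k M.
Proof.
move=> e0; have e20 : 0 < e / 2 by lra.
have [J HJ] := powser_tail e20.
pose B := \sum_(j < J) c j * j%:R.
have B0 : 0 <= B by apply: sumr_ge0 => j _; rewrite mulr_ge0.
pose D := B * J.*2%:R / (e / 2).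
have D0 : 0 <= D by rewrite /D divr_ge0 ?mulr_ge0 // ltW.
exists (maxn J.*2 (Num.truncn D).+1) => M k; rewrite geq_max => /andP[JM DM] kM.
have M0 : (0 < M)%N by apply: leq_trans DM.
have DM' : D <= M%:R.
  by apply: le_trans (ltW (truncnS_gt D)) _; rewrite ler_nat.
have x01 : 0 <= (k%:R / M%:R : R) <= 1 by rewrite divr_ge0 //= ler_pdivrMr ?ltr0n // mul1r ler_nat.
apply: le_trans (psum_le_binratio k M J); have := HJ _ x01.
have : \sum_(j < J) c j * (k%:R / M%:R) ^+ j - B * (J.*2%:R / M%:R) <=
    \sum_(j < J) c j * ('C(k, j)%:R / 'C(M, j)%:R).
  rewrite /B mulr_suml -sumrB; apply: ler_sum => j _.
  rewrite -mulrA -mulrBr; apply: ler_wpM2l => //.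
  exact: rho_ge kM JM M0 (ltnW (ltn_ord j)).
have : B * (J.*2%:R / M%:R) <= e / 2.
  rewrite mulrA ler_pdivrMr ?ltr0n //; move: DM'; rewrite /D ler_pdivrMr //.
  by rewrite mulrC [M%:R * _]mulrC [_ * B]mulrC.
lra.
Qed.

End PowerSeries.

(** * Large deviations of the size *)

Section Exponents.
Variable R : realType.
Implicit Types t u v : R.

Lemma expR_sub1_le t : t < 1 -> expR t - 1 <= t / (1 - t).
Proof.
move=> t1; have t1' : 0 < 1 - t by rewrite subr_gt0.
rewrite ler_pdivlMr //.
have e1 : expR t * expR (- t) = 1 by rewrite -expRD subrr expR0.
by have := expR_ge1Dx (- t); have := expR_gt0 t; nra.
Qed.

(** Chernoff exponent of a Poisson variable of mean [u] at level [v]. The minimiser [ln (v / u)] is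
    replaced by a rational choice, which stays meaningful for [u = 0]. *)
Lemma chernoff_exponent_gt0 u v : 0 <= u -> u < v ->
  exists2 t, 0 < t & exists2 kap, 0 < kap & (expR t - 1) * u - t * v <= - kap.
Proof.
move=> u0 uv; have v0 : 0 < v by lra.
pose t := (v - u) / (2 * v).
have tv : t * v = (v - u) / 2 by rewrite /t; field; rewrite gt_eqF.
have t0 : 0 < t by rewrite divr_gt0 //; lra.
have t1 : t <= 1 / 2 by rewrite ler_pdivrMr; lra.
exists t => //; exists (t * ((v - u) / 2)); first by rewrite mulr_gt0 //; lra.
have h := ler_wpM2r u0 (expR_sub1_le (le_lt_trans t1 (_ : 1 / 2 < 1))).
have {}h : (expR t - 1) * u <= t / (1 - t) * u by apply: h; lra.
apply: (@le_trans _ _ (t / (1 - t) * u - t * v)); first by rewrite lerD2r.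
have -> : t / (1 - t) * u - t * v = - (t * ((v - u) / 2)) / (1 - t).
  clearbody t; have -> : u = v - 2 * (t * v) by lra.
  by field; lra.
rewrite ler_pdivrMr; last lra.
by have : 0 <= t * ((v - u) / 2) by [rewrite mulr_ge0 //; lra]; nra.
Qed.

Lemma chernoff_exponent_lt0 u v : 0 <= v -> v < u ->
  exists2 t, t < 0 & exists2 kap, 0 < kap & (expR t - 1) * u - t * v <= - kap.
Proof.
move=> v0 vu; have u0 : 0 < u by lra.
pose s := (u - v) / (2 * u).
have su : s * u = (u - v) / 2 by rewrite /s; field; rewrite gt_eqF.
have s0 : 0 < s by rewrite divr_gt0 //; lra.
have s1 : s <= 1 / 2 by rewrite ler_pdivrMr; lra.
clearbody s; exists (- s); first lra.
(* The gain is at least [s * (u - v) / 2] divided by [1 + s], and [1 + s <= 3 / 2]. *)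
exists (s * (u - v) / 3); first by rewrite divr_gt0 ?mulr_gt0 //; lra.
have h : (expR (- s) - 1) * u <= - s / (1 - - s) * u.
  by apply: ler_wpM2r; [lra|apply: expR_sub1_le; lra].
apply: le_trans (lerD h (lexx _)) _.
have -> : - s / (1 - - s) * u - - s * v = - (s * (u - v * (1 + s))) / (1 + s).
  by field; lra.
rewrite ler_pdivrMr; last lra.
have vs : v * s <= u * s by rewrite ler_wpM2r //; lra.
have : (u - v) / 2 <= u - v * (1 + s) by lra.
have : 0 <= s * (u - v) by rewrite mulr_ge0 //; lra.
nra.
Qed.

Lemma geometric_tail (rho e : R) : 0 <= rho -> rho < 1 -> 0 < e ->
  exists K, forall m, \sum_(k < m | (K <= k)%N) rho ^+ k <= e.
Proof.
move=> r0 r1 e0; have r1' : 0 < 1 - rho by rewrite subr_gt0.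
have : (rho ^+ n @[n --> \oo] --> (0 : R))%classic by apply: cvg_expr; rewrite ger0_norm.
have er : 0 < e * (1 - rho) by rewrite mulr_gt0.
move=> /cvgrPdist_le /(_ _ er) [K _ HK]; exists K => m.
have {}HK := HK K (leqnn K); rewrite /= sub0r normrN ger0_norm ?exprn_ge0 // in HK.
rewrite -(ler_pM2r r1'); apply: le_trans HK.
suff -> : (\sum_(k < m | (K <= k)%N) rho ^+ k) * (1 - rho) = rho ^+ K - rho ^+ maxn K m.
  by rewrite gerBl exprn_ge0.
elim: m => [|m IHm]; first by rewrite big_ord0 maxn0 subrr mul0r.
rewrite big_mkcond /= (big_ord_recr m) /= -big_mkcond /= mulrDl IHm.
have [Km|mK] := leqP K m.
  by rewrite !(maxn_idPr _) ?(leqW Km) // exprS; ring.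
by rewrite !(maxn_idPl _) ?mul0r ?addr0 // ltnW.
Qed.

End Exponents.

Lemma esum_shift (R : realType) (f : nat -> R) : (forall k, 0 <= f k) -> f 0%N = 0 ->
  (\esum_(k in setT) (f k)%:E = \esum_(k in setT) (f k.+1)%:E)%E.
Proof.
move=> f0 f00; rewrite -(@reindex_esum _ _ _ setT [set k | (0 < k)%N]%classic succn (fun k => (f k)%:E)).
  rewrite [RHS]esum_mkcond; apply: eq_esum => -[|k] _; last by rewrite mem_set.
  by rewrite memNset // f00.
split=> //; first by move=> j k _ _ [].
by move=> [|k] // _; exists k.
Qed.

(** * The threshold [g] and the drift of the arrivals on either side of it *)

Section Threshold.
Variables (R : realType) (beta : nat -> R).
Hypotheses (b_ge0 : forall k, 0 <= beta k) (b0 : beta 0%N = 0) (b1 : beta 1%N = 0)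
  (b_sum : (\esum_(k in [set: nat]) (k%:R * beta k)%:E < +oo)%E)
  (b_pos : forall x : R, 0 < x < gcrit beta -> betaD beta x + ln (1 - x) > 0).

Implicit Types (x y d e : R).

Let c j : R := j.+1%:R * beta j.+1.
Let c_ge0 j : 0 <= c j.
Proof. by rewrite mulr_ge0. Qed.
Let c_sum : (\esum_(k in setT) (c k)%:E < +oo)%E.
Proof.
move: b_sum; rewrite (esum_shift (f := fun k => k%:R * beta k)) ?mul0r // => k.
by rewrite mulr_ge0.
Qed.
Let beta_sum : (\esum_(k in setT) (beta k)%:E < +oo)%E.
Proof.
apply: le_lt_trans b_sum; apply: le_esum => k _; rewrite lee_fin.
by case: k => [|k]; rewrite ?b0 ?mulr0 // ler_peMl // ler1n.
Qed.

Let B := powser c.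
Let g := gcrit beta.

Lemma betaDE x : 0 <= x -> betaD beta x = powser c x.
Proof.
move=> x0; rewrite /betaD /powser; congr fine.
rewrite (esum_shift (f := fun k => k%:R * beta k * x ^+ k.-1)) ?mul0r // => k.
by rewrite !mulr_ge0 ?exprn_ge0.
Qed.

Let F x := B x + ln (1 - x).

Lemma powser0 : B 0 = 0.
Proof.
rewrite /B /powser esum1 // => -[|k] _; last by rewrite expr0n mulr0.
by rewrite /c b1 mulr0 mul0r.
Qed.

Lemma gcrit_set_nonempty : exists2 x, 0 <= x < 1 & F x < 0.
Proof.
(* At [x = 1 - expR (- b)] the logarithm is [- b], which beats the bound [B 1] on the series. *)
pose b := B 1 + 1; have B1 : 0 <= B 1 by apply: powser_ge0 => //; rewrite ler01 lexx.
have e1 : expR (- b) <= 1 by rewrite -[leRHS]expR0 ler_expR; rewrite /b; lra.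
have e0 := expR_gt0 (- b).
exists (1 - expR (- b)); first by apply/andP; split; lra.
rewrite /F (_ : 1 - (1 - expR (- b)) = expR (- b)) ?expRK; last by ring.
have : B (1 - expR (- b)) <= B 1 by apply: powser_le => //; lra.
by rewrite /b; lra.
Qed.

Lemma gcrit_setE : [set x : R | 0 <= x < 1 /\ betaD beta x + ln (1 - x) < 0]%classic =
  [set x | 0 <= x < 1 /\ F x < 0]%classic.
Proof.
by apply/seteqP; split=> x /= [x01 H]; split=> //; move: H; rewrite betaDE //; case/andP: x01.
Qed.

Let gset_has_inf : has_inf [set x | 0 <= x < 1 /\ F x < 0]%classic.
Proof.
split; first by have [x x01 Fx] := gcrit_set_nonempty; exists x.
by exists 0 => x /= [/andP[]].
Qed.

Lemma gcrit_ge0 : 0 <= g.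
Proof.
rewrite /g /gcrit gcrit_setE; apply: lb_le_inf; first by case: gset_has_inf.
by move=> x /= [/andP[]].
Qed.

Lemma gcrit_lt1 : g < 1.
Proof.
have [x x01 Fx] := gcrit_set_nonempty; apply: (@le_lt_trans _ _ x); last by case/andP: x01.
rewrite /g /gcrit gcrit_setE; apply: ge_inf; first by case: gset_has_inf.
by split.
Qed.

Lemma gcrit_adherent d : 0 < d -> exists2 x, g <= x < g + d & x < 1 /\ F x < 0.
Proof.
move=> d0; have [x /= [x01 Fx] xg] := inf_adherent d0 gset_has_inf.
exists x; last by split=> //; case/andP: x01.
rewrite /g /gcrit gcrit_setE xg andbT; apply: ge_inf; first by case: gset_has_inf.
by split.
Qed.

Lemma F_continuous x : 0 <= x < 1 -> forall e, 0 < e -> exists2 d, 0 < d &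
  forall y, 0 <= y <= 1 -> `|x - y| <= d -> `|F x - F y| <= e.
Proof.
move=> /andP[x0 x1] e e0; have e20 : 0 < e / 2 by lra.
have [d d0 Hd] := powser_unif c_ge0 c_sum e20.
have x1' : 0 < 1 - x by lra.
have /cvgrPdist_le /(_ _ e20) := @continuous_ln R (1 - x) x1'.
move=> /nbhs_ballP[d' /= d'0 Hd'].
exists (Num.min d (d' / 2)); first by rewrite lt_min d0; lra.
move=> y y01; rewrite le_min => /andP[xyd xyd'].
have h1 : `|B x - B y| <= e / 2 by apply: Hd => //; rewrite x0 ltW.
have h2 : `|ln (1 - x) - ln (1 - y)| <= e / 2.
  apply: Hd'; rewrite /ball /= (_ : 1 - x - (1 - y) = - (x - y)) ?normrN; [lra|ring].
rewrite /F opprD addrACA; apply: le_trans (ler_normD _ _) _; lra.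
Qed.

(** [F g > 0] would persist near [g] and contradict the infimum; [F g < 0] would persist to the left
    and contradict positivity below [g], unless [g = 0], where [F] vanishes anyway. *)
Lemma F_gcrit : B g + ln (1 - g) = 0.
Proof.
have g0 := gcrit_ge0; have g1 := gcrit_lt1.
apply/eqP; rewrite eq_le; apply/andP; split; rewrite leNgt; apply/negP => Fg.
  have e0 : 0 < F g / 2 by rewrite divr_gt0.
  have [d d0 Hd] := F_continuous (introT andP (conj g0 g1)) e0.
  have [x /andP[gx xg] [x1 Fx]] := gcrit_adherent d0.
  have x01 : 0 <= x <= 1 by apply/andP; split; lra.
  have : `|g - x| <= d by rewrite distrC ger0_norm; lra.
  move=> /(Hd x x01) /ler_normlP[]; rewrite -/(F g) in Fg *; lra.
have [g00|gN0] := eqVneq g 0.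
  by move: Fg; rewrite g00 powser0 subr0 ln1 addr0 ltxx.
have gp : 0 < g by rewrite lt_neqAle eq_sym gN0.
have e0 : 0 < - F g / 2 by rewrite divr_gt0 // oppr_gt0.
have [d d0 Hd] := F_continuous (introT andP (conj g0 g1)) e0.
pose y := Num.max (g / 2) (g - d).
have yg : 0 < y < g by rewrite /y lt_max gt_max; apply/andP; split; [apply/orP; left|apply/andP; split]; lra.
have yd : g - d <= y by rewrite /y le_max lexx orbT.
have := b_pos yg; rewrite betaDE; last by case/andP: yg => /ltW.
rewrite -/B -/(F y) => Fy; case/andP: yg => y0 yg.
have y01 : 0 <= y <= 1 by apply/andP; split; lra.
have : `|g - y| <= d by rewrite ger0_norm; lra.
move=> /(Hd y y01) /ler_normlP[]; rewrite -/(F g) in Fg *; lra.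
Qed.

(** [F] vanishes at 0 and at [g], so a uniform bound comes from compactness and only away from both
    ends. *)
Lemma F_lower_bound a b : 0 < a -> b < g -> exists2 m, 0 < m & forall x, a <= x <= b -> m <= F x.
Proof.
move=> a0 bg; have g1 := gcrit_lt1.
have [ba|ab] := ltP b a.
  by exists 1 => // x /andP[ax xb]; lra.
have cF : ({within `[a, b], continuous F})%classic.
  apply: continuous_in_subspaceT => x; rewrite inE /= in_itv /= => /andP[ax xb].
  have x01 : 0 <= x < 1 by apply/andP; split; lra.
  apply/cvgrPdist_le => e e0; have [d d0 Hd] := F_continuous x01 e0.
  apply/nbhs_ballP; exists (Num.min d (Num.min x (1 - x))) => /=.
    by rewrite !lt_min d0 /=; apply/andP; split; lra.
  move=> y; rewrite /ball /= !lt_min => /and3P[yd yx yx1]; apply: Hd; last exact: ltW.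
  by move: yx yx1 => /ltr_normlP[? ?] /ltr_normlP[? ?]; apply/andP; split; lra.
have [x] := EVT_min ab cF; rewrite in_itv /= => /andP[ax xb] Hx.
exists (F x); last by move=> y yab; apply: Hx; rewrite in_itv.
rewrite /F /B -betaDE; last lra.
by apply: b_pos; apply/andP; split; [lra|apply: le_lt_trans bg].
Qed.

Let hsurvE n K : hsurv beta n.+1 K = expR (- binratio c K n).
Proof. by rewrite /hsurv hrateE. Qed.

(** Two regimes: near 0 the term of [beta 2] alone gives slope [lam > 1]; beyond [y0] the lower
    bound on [F] gives the excess. The estimate starts at [K = 1], so that it controls all sizes
    beyond a constant. *)
Lemma drift_below d : 1 < 2 * beta 2%N -> 0 < d -> exists2 eta, 0 < eta & exists n0,
  forall n K, (n0 <= n)%N -> (0 < K)%N -> K%:R <= (g - d) * n%:R ->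
  (1 + eta) * K%:R <= (1 - hsurv beta n.+1 K) * n%:R.
Proof.
set lam := 2 * beta 2%N => lam1 d0; have g1 := gcrit_lt1.
(* Chosen so that [lam * x <= (lam - 1) / 4] below [y0]; then [(1 + eta) * (1 + lam * x) <= lam], as
   [1 - expR (- (lam * x))] requires. *)
pose y0 := (lam - 1) / (4 * lam).
have y0lam : lam * y0 = (lam - 1) / 4 by rewrite /y0; field; lra.
have y00 : 0 < y0 by rewrite divr_gt0; lra.
have gd : g - d < g by lra.
have [m m0 Hm] := F_lower_bound y00 gd.
have m20 : 0 < m / 2 by lra.
have [n0 Hn0] := binratio_ge c_ge0 c_sum m20.
pose kap := 1 - expR (- (m / 2)).
have kap0 : 0 < kap by rewrite subr_gt0 expR_lt1; lra.
(* One entry per regime; the second rests on [(1 - g) * x <= 1 - x]. *)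
pose eta := Num.min ((lam - 1) / (3 + lam)) ((1 - g) * kap).
have eta0 : 0 < eta by rewrite lt_min divr_gt0 ?mulr_gt0; lra.
exists eta => //; exists n0 => n K nn0 K0 Kg.
have n_gt0 : (0 < n)%N.
  rewrite lt0n; apply/negP => /eqP n0'; move: Kg; rewrite n0' mulr0 lern0 => /eqP K0'.
  by rewrite K0' in K0.
have nR : 0 < n%:R :> R by rewrite ltr0n.
pose x : R := K%:R / n%:R.
have Kx : K%:R = x * n%:R by rewrite divfK // gt_eqF.
have x0 : 0 < x by rewrite divr_gt0 // ltr0n.
have xg : x <= g - d by rewrite ler_pdivrMr.
have Kn : (K <= n)%N by rewrite -(ler_nat R) Kx ler_piMl //; lra.
rewrite Kx mulrA ler_pM2r // hsurvE.
have [xy0|y0x] := ltP x y0.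
  have blam : lam * x <= binratio c K n.
    apply: le_trans (psum_le_binratio c_ge0 K n 2).
    rewrite !big_ord_recl big_ord0 /= /c b1 /= !bin1 mulr0 mul0r add0r addr0 -/x.
    by rewrite /lam.
  have h1 : expR (- binratio c K n) <= expR (- (lam * x)) by rewrite ler_expR lerN2.
  have h2 : expR (- (lam * x)) * (1 + lam * x) <= 1.
    rewrite expRN mulrC ler_pdivrMr ?expR_gt0 // mul1r; exact: expR_ge1Dx.
  have lx : lam * x <= (lam - 1) / 4 by rewrite -y0lam ler_pM2l; lra.
  have e1 : eta * (3 + lam) <= lam - 1.
    by rewrite -ler_pdivlMr ?ge_min ?lexx //; lra.
  apply: (@le_trans _ _ (1 - expR (- (lam * x)))); last by rewrite lerB.
  have lx0 : 0 <= lam * x by rewrite mulr_ge0; lra.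
  rewrite -(ler_pM2r (_ : 0 < 1 + lam * x)); last lra.
  apply: (@le_trans _ _ (lam * x)); last by rewrite mulrBl mul1r; lra.
  rewrite mulrAC ler_pM2r //.
  have : (1 + eta) * (1 + lam * x) <= (1 + eta) * (1 + (lam - 1) / 4).
    by rewrite ler_pM2l; lra.
  lra.
have Fx : m <= F x by apply: Hm; rewrite y0x.
have h := Hn0 n K nn0 Kn; rewrite -/x -/(B x) in h.
have h1 : expR (- binratio c K n) <= (1 - x) * expR (- (m / 2)).
  have x1 : 0 < 1 - x by lra.
  rewrite -[1 - x in leRHS](lnK _) ?posrE // -expRD ler_expR.
  by move: Fx; rewrite /F; lra.
have e1 : eta <= (1 - g) * kap by rewrite ge_min lexx orbT.
have : eta * x <= (1 - g) * kap * x by rewrite ler_wpM2r //; lra.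
have : (1 - g) * kap * x <= kap * (1 - x).
  rewrite -mulrA mulrCA ler_pM2l //; nra.
by rewrite /kap; lra.
Qed.

(** The infimum defining [g] yields a point [x] just above it with [F x < 0]; there the arrivals lag
    behind time. The window of length 1 for [K] allows for rounding [x * n]. *)
Lemma drift_above d : 0 < d -> exists x u, [/\ g <= x < g + d, x < 1, 0 <= u < x & exists n0,
  forall n K, (n0 <= n)%N -> x * n%:R <= K%:R -> K%:R <= x * n%:R + 1 ->
  (K <= n)%N /\ 1 - hsurv beta n.+1 K <= u].
Proof.
move=> d0; have [x xg [x1 Fx]] := gcrit_adherent d0.
have g0 := gcrit_ge0.
have x0 : 0 < x.
  rewrite lt_neqAle (le_trans g0) ?andbT; last by case/andP: xg.
  by apply/eqP => x00; move: Fx; rewrite -x00 /F powser0 subr0 ln1 addr0 ltxx.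
have x01 : 0 <= x < 1 by rewrite ltW.
have Fx2 : 0 < - F x / 2 by lra.
have [r r0 Hr] := powser_unif c_ge0 c_sum Fx2.
(* Half of [- F x] absorbs the rounding error, the other half keeps [u < x]; the maximum with 0
   makes [u] admissible as a mean in the Chernoff bound. *)
pose u := Num.max 0 (1 - (1 - x) * expR (- (F x / 2))).
have x1' : 0 < 1 - x by lra.
have eF : 1 < expR (- (F x / 2)) by rewrite expR_gt1; lra.
have ux : 0 <= u < x.
  by rewrite /u le_max lexx gt_max x0 /=; nra.
exists x, u; split=> //.
have rr : 0 < Num.min r (1 - x) by rewrite lt_min r0.
exists (Num.truncn (Num.min r (1 - x))^-1).+1 => n K nn0 Kx Kx1.
have n_gt0 : (0 < n)%N by apply: leq_trans nn0.
have nR : 0 < n%:R :> R by rewrite ltr0n.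
have nr : n%:R^-1 <= Num.min r (1 - x).
  rewrite -[leRHS]invrK lef_pV2 ?posrE ?invr_gt0 //.
  by apply: le_trans (ltW (truncnS_gt _)) _; rewrite ler_nat.
move: nr; rewrite le_min => /andP[nr nx].
pose y : R := K%:R / n%:R.
have xy : x <= y by rewrite ler_pdivlMr.
have yx : y <= x + n%:R^-1 by rewrite ler_pdivrMr // mulrDl mulVf // gt_eqF.
have y1 : y <= 1 by lra.
have Kn : (K <= n)%N by move: y1; rewrite ler_pdivrMr // mul1r ler_nat.
split=> //; rewrite hsurvE le_max; apply/orP; right.
rewrite lerD2l lerN2.
have h1 := binratio_le c_ge0 c_sum Kn n_gt0; rewrite -/y in h1.
have h2 : `|powser c x - powser c y| <= - F x / 2.
  have x01' : 0 <= x <= 1 by apply/andP; split; lra.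
  have y01 : 0 <= y <= 1 by apply/andP; split; lra.
  by apply: Hr => //; rewrite distrC ger0_norm; lra.
rewrite -[1 - x in leLHS](lnK _) ?posrE // -expRD ler_expR.
by move: h2 => /ler_normlP[]; rewrite /F /B; lra.
Qed.

(** Per vertex, the inner hyperedges contribute the series of [beta] and those with one vertex
    outside contribute [1 - g] times its derivative; [F_gcrit] turns the latter into the logarithm
    of the limit. *)
Lemma hrevealed_unif e : 0 < e -> exists2 d, 0 < d & exists n0, forall n K, (n0 <= n)%N ->
  (K <= n)%N -> `|K%:R / n.+1%:R - g| <= d ->
  `|hrevealed beta n.+1 K / n.+1%:R - (betaF beta g - (1 - g) * ln (1 - g))| <= e.
Proof.
move=> e0; have g0 := gcrit_ge0; have g1 := gcrit_lt1.
have e60 : 0 < e / 6 by lra.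
have g01 : 0 <= g <= 1 by rewrite g0 ltW.
have Bg0 : 0 <= B g by exact: powser_ge0.
have [d1 d10 Hd1] := powser_unif b_ge0 beta_sum e60.
have [d2 d20 Hd2] := powser_unif c_ge0 c_sum e60.
have [n1 Hn1] := binratio_ge b_ge0 beta_sum e60.
have [n2 Hn2] := binratio_ge c_ge0 c_sum e60.
pose d := Num.min (Num.min d1 (d2 / 2)) (e / 6 / (B g + 1)).
have Bg1 : 0 < B g + 1 by lra.
have dd : 0 < d by rewrite !lt_min d10 !divr_gt0.
exists d => //; exists (maxn 1 (maxn (maxn n1 n2) (Num.truncn (d2 / 2)^-1).+1)) => n K.
rewrite !geq_max => /and3P[n_gt0 /andP[nn1 nn2] nd2] Kn.
rewrite !le_min -andbA => /and3P[kd1 kd2 kd3].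
have nR : 0 < n%:R :> R by rewrite ltr0n.
have NR : 0 < n.+1%:R :> R by rewrite ltr0n.
pose x : R := K%:R / n.+1%:R; pose y : R := K%:R / n%:R.
have x01 : 0 <= x <= 1 by rewrite divr_ge0 //= ler_pdivrMr // mul1r ler_nat leqW.
have y01 : 0 <= y <= 1 by rewrite divr_ge0 //= ler_pdivrMr // mul1r ler_nat.
have xy : 0 <= y - x <= n.+1%:R^-1.
  have -> : y - x = y * n.+1%:R^-1.
    have N0 : n%:R + 1 != 0 :> R by rewrite natr1 gt_eqF.
    have n0 : n%:R != 0 :> R by rewrite gt_eqF.
    by rewrite /x /y -natr1; field; rewrite n0 ?[1 + _]addrC N0.
  by rewrite mulr_ge0 ?ler_piMl ?invr_ge0 //; case/andP: y01.
have nd : n.+1%:R^-1 <= d2 / 2.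
  rewrite -[leRHS]invrK lef_pV2 ?posrE ?invr_gt0 ?divr_gt0 //.
  by apply: le_trans (ltW (truncnS_gt _)) _; rewrite ler_nat leqW.
have hy : `|y - g| <= d2.
  have -> : y - g = (x - g) + (y - x) by ring.
  apply: le_trans (ler_normD _ _) _; rewrite -/x in kd2.
  case/andP: xy => xy1 xy2; rewrite [`|y - x|]ger0_norm //.
  by apply: le_trans (lerD kd2 (le_trans xy2 nd)) _; rewrite -splitr.
have /ler_normlP[A1 A2] := Hd1 _ _ x01 g01 kd1.
have /ler_normlP[A3 A4] := Hd2 _ _ y01 g01 hy.
have A5 := Hn1 n.+1 K (leqW nn1) (leqW Kn).
have A6 := binratio_le b_ge0 beta_sum (leqW Kn) (ltn0Sn n).
have A7 := Hn2 n K nn2 Kn.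
have A8 := binratio_le c_ge0 c_sum Kn n_gt0.
rewrite -/x -/y in A5 A6 A7 A8.
have -> : hrevealed beta n.+1 K / n.+1%:R = binratio beta K n.+1 + (1 - x) * binratio c K n.
  rewrite /hrevealed hinnerE hrateE natrB ?(leqW Kn) // /x -/c.
  by field; rewrite gt_eqF.
have -> : betaF beta g - (1 - g) * ln (1 - g) = powser beta g + (1 - g) * B g.
  have /eqP := F_gcrit; rewrite addrC addr_eq0 => /eqP ->.
  by rewrite mulrN opprK.
have C1 : `|binratio beta K n.+1 - powser beta g| <= e / 3.
  by clear A3 A4 A7 A8 kd1 kd2 kd3 hy nd xy; apply/ler_normlP; split; lra.
have C2 : `|binratio c K n - B g| <= e / 3.
  by clear A1 A2 A5 A6 kd1 kd2 kd3 hy nd xy; apply/ler_normlP; split; rewrite /B; lra.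
have C3 : `|x - g| * B g <= e / 6.
  apply: (@le_trans _ _ (e / 6 / (B g + 1) * B g)); first by rewrite ler_wpM2r.
  by rewrite mulrAC ler_pdivrMr // ler_pM2l //; lra.
have -> : binratio beta K n.+1 + (1 - x) * binratio c K n - (powser beta g + (1 - g) * B g) =
  (binratio beta K n.+1 - powser beta g) + ((1 - x) * (binratio c K n - B g) - (x - g) * B g) by ring.
apply: le_trans (ler_normD _ _) _; apply: (@le_trans _ _ (e / 3 + (e / 3 + e / 6))); last lra.
apply: lerD => //; apply: le_trans (ler_normB _ _) _; apply: lerD; last by rewrite normrM (ger0_norm Bg0).
rewrite normrM ger0_norm; last by case/andP: x01; lra.
apply: le_trans C2; rewrite ler_piMl //; case/andP: x01; lra.
Qed.

End Threshold.

(** * Bounds on the joint law of the domain and the identifiable hyperedges *)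

Section PMScaling.
Local Open Scope classical_set_scope.
Variables (R : realType) (beta : nat -> R).
Hypotheses (b_ge0 : forall k, 0 <= beta k) (b1 : beta 1%N = 0).

Implicit Types (a e : R).

Lemma PM_scale a k : 0 <= a ->
  PM (fun j => a * beta j) k.+1 =
  a ^+ k * expR ((1 - a) * (2 * beta 2%N) * k.+1%:R) * PM beta k.+1.
Proof.
move=> a0; rewrite !PME ?mulr_ge0 //.
have -> : expR (- (2 * (a * beta 2%N) * k.+1%:R)) =
    expR ((1 - a) * (2 * beta 2%N) * k.+1%:R) * expR (- (2 * beta 2%N * k.+1%:R)).
  by rewrite -expRD; congr expR; ring.
have -> : (2 * (a * beta 2%N)) ^+ k = a ^+ k * (2 * beta 2%N) ^+ k by rewrite -exprMn; congr (_ ^+ _); ring.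
by ring.
Qed.

Lemma sum_PM_le1 K : \sum_(k < K) PM beta k.+1 <= 1.
Proof.
have H : (\sum_(k < K) size_law (hsurv beta n.+1) n k : R) @[n --> \oo] --> (\sum_(k < K) PM beta k.+1 : R).
  apply: (@cvg_big R _ +%R 0 xpredT _ nat eventually (index_enum 'I_K)
    (fun k n => size_law (hsurv beta n.+1) n k) (fun k => PM beta k.+1)).
    exact: add_continuous.
  by move=> k _; exact: size_law_cvg.
apply: (cvgr_to_le H); near=> n.
have Kn : (K <= n.+1)%N by apply: leqW; near: n; exact: nbhs_infty_ge.
rewrite -[leRHS](size_law_sum (e := hsurv beta n.+1) _ n) ?hsurv0 //.
rewrite -(subnKC Kn) big_split_ord /= lerDl sumr_ge0 // => k _.
by apply: size_law_ge0 => j; [exact: expR_ge0|exact: hsurv_dec].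
Unshelve. all: by end_near. Qed.

(* For [s < 1] the walk with mean [s * 2 * beta 2 < 1] dies out by the Chernoff bound, and
   [PM (s * beta) <= PM beta / s]; let [s] tend to 1. *)
Lemma sum_PM_subcritical e : 2 * beta 2%N <= 1 -> 0 < e ->
  exists K0, forall K, (K0 <= K)%N -> 1 - e <= \sum_(k < K) PM beta k.+1.
Proof.
set lam := 2 * beta 2%N => lam1 e0.
have lam0 : 0 <= lam by rewrite mulr_ge0.
(* The first entry keeps [s] positive for large [e]; the second limits the loss from the factor [s]
   to [e / 2]. *)
pose s := Num.max (1 / 2) (1 - e / 2).
have s0 : 0 < s by rewrite lt_max; apply/orP; left; lra.
have s1 : s < 1 by rewrite gt_max; apply/andP; split; lra.
have se : 1 - e / 2 <= s by rewrite le_max lexx orbT.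
have slam0 : 0 <= s * lam by rewrite mulr_ge0 // ltW.
have slam1 : s * lam < 1.
  by apply: le_lt_trans s1; rewrite ler_piMr // ltW.
have [t t0 [kap kap0 Ht]] := chernoff_exponent_gt0 slam0 slam1.
pose beta' j := s * beta j.
have b_ge0' j : 0 <= beta' j by rewrite mulr_ge0 // ltW.
have b1' : beta' 1%N = 0 by rewrite /beta' b1 mulr0.
have tail K : 1 - \sum_(k < K) PM beta' k.+1 <= expR (- kap) ^+ K.
  have H : (\sum_(k < K) size_law (hsurv beta' n.+1) n k : R) @[n --> \oo] --> (\sum_(k < K) PM beta' k.+1 : R).
    apply: (@cvg_big R _ +%R 0 xpredT _ nat eventually (index_enum 'I_K)
      (fun k n => size_law (hsurv beta' n.+1) n k) (fun k => PM beta' k.+1)).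
      exact: add_continuous.
    by move=> k _; exact: size_law_cvg.
  have H1 : (1 - \sum_(k < K) size_law (hsurv beta' n.+1) n k : R) @[n --> \oo] --> (1 - \sum_(k < K) PM beta' k.+1 : R).
    by apply: cvgB => //; exact: cvg_cst.
  have H2 : (expR (- (t * K%:R) + (expR t - 1) * (n.+1%:R * (1 - hsurv beta' n.+1 K))) : R) @[n --> \oo] -->
      (expR (- (t * K%:R) + (expR t - 1) * (2 * beta' 2%N * K%:R)) : R).
    apply: expR_cvg; apply: cvgD; first exact: cvg_cst.
    by apply: cvgMr; exact: hsurv_cvg.
  apply: (@le_trans _ _ (expR (- (t * K%:R) + (expR t - 1) * (2 * beta' 2%N * K%:R)))).
    apply: (ler_cvg_to H1 H2); near=> n.
    have Kn : (K <= n)%N by near: n; exact: nbhs_infty_ge.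
    have e0' : hsurv beta' n.+1 0 = 1 by rewrite hsurv0.
    have edec j := hsurv_dec n.+1 j b_ge0'.
    have ege j : 0 <= hsurv beta' n.+1 j := expR_ge0 _.
    have := size_law_tail_le e0' ege edec (ltW t0) Kn.
    have := size_law_sum e0' n.
    rewrite (bigID (fun k : 'I_n.+1 => (K <= k)%N)) /=.
    have -> : \sum_(k < n.+1 | ~~ (K <= k)%N) size_law (hsurv beta' n.+1) n k =
        \sum_(k < K) size_law (hsurv beta' n.+1) n k.
      rewrite (big_ord_widen n.+1 (fun k => size_law (hsurv beta' n.+1) n k)) ?(leqW Kn) //.
      by apply: eq_bigl => k; rewrite ltnNge.
    move=> e1 e2; rewrite -[X in X - _ <= _]e1 addrK; apply: le_trans e2 _; rewrite ler_expR lerD2l.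
    rewrite -mulrA; apply: ler_wpM2l; first by rewrite subr_ge0 -expR0 ler_expR ltW.
    rewrite mulrC; apply: ler_wpM2r; last by rewrite ler_nat.
    by rewrite subr_ge0 hsurv_le1.
  rewrite -expRM_natr ler_expR.
  have -> : - (t * K%:R) + (expR t - 1) * (2 * beta' 2%N * K%:R) =
    ((expR t - 1) * (s * lam) - t * 1) * K%:R by rewrite /beta' /lam; ring.
  by apply: ler_wpM2r.
(* The ratio is a power of [s * expR ((1 - s) * lam)], at most 1 because [s <= expR (s - 1)] and
   [lam <= 1]. *)
have scale k : s * PM beta' k.+1 <= PM beta k.+1.
  have -> : s * PM beta' k.+1 = s ^+ k.+1 * expR ((1 - s) * lam * k.+1%:R) * PM beta k.+1.
    by rewrite PM_scale ?(ltW s0) // exprS -/lam; ring.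
  rewrite ler_piMl ?PM_ge0 //.
  rewrite expRM_natr -exprMn; apply: exprn_ile1; first by rewrite mulr_ge0 ?expR_ge0 // ltW.
  apply: (@le_trans _ _ (expR (s - 1) * expR ((1 - s) * lam))).
    by rewrite ler_wpM2r ?expR_ge0 //; have := expR_ge1Dx (s - 1); rewrite addrC subrK.
  by rewrite -expRD -[leRHS]expR0 ler_expR; nra.
have e20 : 0 < e / 2 by lra.
have : (expR (- kap) ^+ n @[n --> \oo] --> (0 : R)).
  by apply: cvg_expr; rewrite ger0_norm ?expR_ge0 // expR_lt1; lra.
move=> /cvgrPdist_le /(_ _ e20) [K0 _ HK]; exists K0 => K KK.
have {}HK := HK K KK; rewrite /= sub0r normrN ger0_norm ?exprn_ge0 ?expR_ge0 // in HK.
have : s * \sum_(k < K) PM beta' k.+1 <= \sum_(k < K) PM beta k.+1.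
  by rewrite mulr_sumr; apply: ler_sum => k _.
have := tail K; set S' := \sum_(k < K) PM beta' k.+1; set S := \sum_(k < K) PM beta k.+1.
move=> h1.
have h2 : s * (1 - e / 2) <= s * S' by rewrite ler_pM2l //; lra.
have h3 : s * (e / 2) <= e / 2 by rewrite ler_piMl //; lra.
lra.
Unshelve. all: by end_near. Qed.

End PMScaling.

Section HypergraphProbability.
Local Open Scope classical_set_scope.
Variables (R : realType) (beta : nat -> R) (v0 : forall n : nat, 'I_n.+1).
Hypotheses (b_ge0 : forall k, 0 <= beta k) (b0 : beta 0%N = 0) (b1 : beta 1%N = 0).

Implicit Types (e : R).

Local Notation pN n := (@hyp_pmf R beta n.+1).
Local Notation T L := (TN L (v0 _)).
Local Notation Z L := (ZN L (v0 _)).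

Lemma hyp_pmf_ge0 n L : 0 <= pN n L.
Proof. by rewrite hyp_pmfE ppois_ge0 // => A; exact: hmean_ge0. Qed.

Lemma esum_hyp_pmf n : (\esum_(L in setT) (pN n L)%:E = 1)%E.
Proof. by rewrite hyp_pmfE esum_ppois // => A; exact: hmean_ge0. Qed.

Lemma TN_gt0 n (L : hypergraph n.+1) : (0 < T L)%N.
Proof. by rewrite /TN domainE; apply/card_gt0P; exists (v0 n); exact: cl_v0. Qed.

Lemma TN_le n (L : hypergraph n.+1) : (T L <= n.+1)%N.
Proof. by rewrite /TN -[leqRHS](card_ord n.+1) max_card. Qed.

Lemma Prob_TN_split n (Q : pred nat) (E : hypergraph n.+1 -> bool) :
  Prob (pN n) (fun L => Q (T L) && E L) =
  \sum_(k < n.+1 | Q k.+1) Prob (pN n) (fun L => (T L == k.+1) && E L).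
Proof.
rewrite /Prob -(Edisc_sum (@hyp_pmf_ge0 n) (esum_hyp_pmf n)); last first.
  by move=> k; exact: bounded_indic.
congr (Edisc _); apply/funext => L.
have Tk : ((T L).-1 < n.+1)%N by rewrite prednK ?TN_gt0 ?TN_le.
have Tk1 : (Ordinal Tk).+1 = T L by rewrite /= prednK // TN_gt0.
have uniq (k : 'I_n.+1) : (T L == k.+1) = (k == Ordinal Tk).
  by rewrite -val_eqE /= -{1}Tk1 eqSS eq_sym.
rewrite big_mkcond (bigD1 (Ordinal Tk)) //= big1 ?addr0 => [|k kT].
  by rewrite -Tk1 eqxx /=; case: (Q _).
by case: ifP => // _; rewrite uniq (negPf kT).
Qed.

Lemma Prob_TN_sum n (Q : pred nat) :
  Prob (pN n) (fun L => Q (T L)) = \sum_(k < n.+1 | Q k.+1) size_law (hsurv beta n.+1) n k.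
Proof.
have := Prob_TN_split Q (fun _ : hypergraph n.+1 => true).
rewrite [X in Prob _ X = _](_ : _ = fun L => Q (T L)); last first.
  by apply/funext => L; rewrite andbT.
move=> ->; apply: eq_bigr => k _; rewrite -(Prob_TN (v0 n) b_ge0 b1 (ltn_ord k)).
by congr Prob; apply/funext => L; rewrite andbT.
Qed.

Lemma Prob_TN_cvg k : (Prob (pN n) (fun L => T L == k) : R) @[n --> \oo] --> (PM beta k : R).
Proof.
case: k => [|k].
  rewrite PM0; apply: cvg_near_cst; near=> n.
  rewrite -[RHS](Edisc_cst (@hyp_pmf_ge0 n) (esum_hyp_pmf n) 0); congr (Edisc _); apply/funext => L.
  by rewrite eqn0Ngt TN_gt0.
have H := @size_law_cvg R beta k b_ge0 b1.
apply: cvg_trans H; apply: near_eq_cvg; near=> n.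
have kn : (k < n.+1)%N by rewrite ltnS; near: n; exact: nbhs_infty_ge.
by rewrite -(Prob_TN (v0 n) b_ge0 b1 kn).
Unshelve. all: by end_near. Qed.

Lemma Prob_TN_gt_cvg K : (Prob (pN n) (fun L => (K < T L)%N) : R) @[n --> \oo] -->
  (1 - \sum_(k < K) PM beta k.+1 : R).
Proof.
have H : (1 - \sum_(k < K) size_law (hsurv beta n.+1) n k : R) @[n --> \oo] --> (1 - \sum_(k < K) PM beta k.+1 : R).
  apply: cvgB; first exact: cvg_cst.
  apply: (@cvg_big R _ +%R 0 xpredT _ nat eventually (index_enum 'I_K)
    (fun k n => size_law (hsurv beta n.+1) n k) (fun k => PM beta k.+1)).
    exact: add_continuous.
  by move=> k _; exact: size_law_cvg.
apply: cvg_trans H; apply: near_eq_cvg; near=> n.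
have Kn : (K <= n.+1)%N by apply: leqW; near: n; exact: nbhs_infty_ge.
have e1 := size_law_sum (e := hsurv beta n.+1) (hsurv0 n.+1 b1) n.
rewrite (bigID (fun k : 'I_n.+1 => (K < k.+1)%N)) /= in e1.
rewrite (@Prob_TN_sum n (fun k => K < k)%N) -[X in X - _]e1.
have -> : \sum_(k < n.+1 | ~~ (K < k.+1)%N) size_law (hsurv beta n.+1) n k =
    \sum_(k < K) size_law (hsurv beta n.+1) n k.
  rewrite (big_ord_widen n.+1 (fun k => size_law (hsurv beta n.+1) n k)) //.
  by apply: eq_bigl => k; rewrite ltnS ltnNge.
by rewrite addrK.
Unshelve. all: by end_near. Qed.

Lemma hinnerS N k : hinner beta N k.+1 = hinner beta N k + hrate beta N k.
Proof.
rewrite /hinner /hrate big_ord_recl /= !bin0.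
under eq_bigr do rewrite /bump /= add1n binS natrD mulrDl.
rewrite big_split /= addrA; congr (_ + _).
rewrite [in RHS]big_ord_recl /= !bin0; congr (_ + _).
by rewrite big_ord_recr /= bin_small // mul0r addr0.
Qed.

Lemma hinner_cvg0 k : (hinner beta n.+1 k : R) @[n --> \oo] --> (0 : R).
Proof.
elim: k => [|k IHk].
  apply: cvg_near_cst; near=> n; rewrite /hinner big_ord_recl big_ord0 b0; ring.
under eq_cvg do rewrite hinnerS.
have H : (hinner beta n.+1 k + hrate beta n.+1 k : R) @[n --> \oo] --> (0 + 0 : R).
  by apply: cvgD; [exact: IHk|exact: hrate_cvg0].
by rewrite addr0 in H.
Unshelve. all: by end_near. Qed.

Lemma hrevealed_cvg k : (hrevealed beta n.+1 k : R) @[n --> \oo] --> (2 * beta 2%N * k%:R : R).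
Proof.
have H : (hinner beta n.+1 k + (n.+1%:R * hrate beta n.+1 k - k%:R * hrate beta n.+1 k) : R) @[n --> \oo]
   --> (0 + (2 * beta 2%N * k%:R - k%:R * 0) : R).
  apply: cvgD; first exact: hinner_cvg0.
  by apply: cvgB; [exact: hrate_cvg|apply: cvgMr; exact: hrate_cvg0].
rewrite mulr0 subr0 add0r in H; apply: cvg_trans H; apply: near_eq_cvg; near=> n.
have kn : (k <= n.+1)%N by apply: leqW; near: n; exact: nbhs_infty_ge.
by rewrite /hrevealed natrB //; ring.
Unshelve. all: by end_near. Qed.

(* The tilted bound tends to [expR (- t) * PM], and [t] is arbitrary. *)
Lemma Prob_TN_neq_ZN k e : 0 < e ->
  \forall n \near \oo, Prob (pN n) (fun L => (T L == k) && (Z L != k)) <= e.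
Proof.
move=> e0; case: k => [|k].
  near=> n; rewrite (_ : Prob _ _ = 0) ?ltW //.
  rewrite -[RHS](Edisc_cst (@hyp_pmf_ge0 n) (esum_hyp_pmf n) 0); congr (Edisc _); apply/funext => L.
  by rewrite eqn0Ngt TN_gt0.
pose P := PM beta k.+1; have P0 : 0 <= P by exact: PM_ge0.
(* Makes [expR (- t) * P <= e / 2] through [1 + t <= expR t]. *)
pose t := 2 * P / e + 1.
have t0 : 0 < t by rewrite /t ltr_wpDl // divr_ge0 ?mulr_ge0 // ltW.
have tP : expR (- t) * P <= e / 2.
  have := expR_ge1Dx t; rewrite expRN ler_pdivrMl ?expR_gt0 // => h.
  have : t * (e / 2) = P + e / 2 by rewrite /t; field; rewrite gt_eqF.
  nra.
pose beta' j := expR t * beta j.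
have b_ge0' j : 0 <= beta' j by rewrite mulr_ge0 ?expR_ge0.
have b1' : beta' 1%N = 0 by rewrite /beta' b1 mulr0.
have H : (expR (- (t * k.+1%:R) + (expR t - 1) * hrevealed beta n.+1 k.+1) *
    size_law (hsurv beta' n.+1) n k : R) @[n --> \oo] --> (expR (- t) * P : R).
  (* Scaling by [expR t] multiplies [PM] by [expR (t * k)] and by an exponential that cancels the
     one from [hrevealed]; against [expR (- (t * k.+1))] a single [expR (- t)] remains. *)
  have -> : expR (- t) * P =
     expR (- (t * k.+1%:R) + (expR t - 1) * (2 * beta 2%N * k.+1%:R)) * PM beta' k.+1.
    rewrite PM_scale ?expR_ge0 // -expRM_natr -expRD [RHS]mulrA -expRD; congr (expR _ * _).
    by rewrite -natr1; ring.
  apply: cvgM; last exact: size_law_cvg.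
  apply: expR_cvg; apply: cvgD; first exact: cvg_cst.
  by apply: cvgMr; exact: hrevealed_cvg.
have tPe : expR (- t) * P < e by lra.
near=> n; have kn : (k < n.+1)%N by rewrite ltnS; near: n; exact: nbhs_infty_ge.
apply: le_trans (_ : _ <= expR (- (t * k.+1%:R) + (expR t - 1) * hrevealed beta n.+1 k.+1) *
    size_law (hsurv beta' n.+1) n k) _; last by near: n; exact: cvgr_le H _ tPe.
apply: le_trans (Prob_ZN_le (v0 n) t k.+1%:R b_ge0 b1 kn).
apply: (Prob_sub (@hyp_pmf_ge0 n) (esum_hyp_pmf n)) => L /andP[/eqP Tk Zk].
rewrite Tk eqxx /= ler_pM2l // ler_nat.
have := leq_TN_ZN L (v0 n); rewrite Tk leq_eqVlt eq_sym (negPf Zk) /=.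
by case: (ZN _ _).
Unshelve. all: by end_near. Qed.

End HypergraphProbability.

(** * Concentration of the proportions of vertices and hyperedges *)

Section FluidLimit.
Local Open Scope classical_set_scope.
Variables (R : realType) (beta : nat -> R) (v0 : forall n : nat, 'I_n.+1).
Hypotheses (b_ge0 : forall k, 0 <= beta k) (b0 : beta 0%N = 0) (b1 : beta 1%N = 0)
  (b_sum : (\esum_(k in [set: nat]) (k%:R * beta k)%:E < +oo)%E)
  (b_pos : forall x : R, 0 < x < gcrit beta -> betaD beta x + ln (1 - x) > 0).

Implicit Types (d e : R).

Local Notation pN n := (@hyp_pmf R beta n.+1).
Local Notation T L := (TN L (v0 _)).
Local Notation Z L := (ZN L (v0 _)).
Local Notation g := (gcrit beta).
Local Notation zlim := (betaF beta g - (1 - g) * ln (1 - g)).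

Let pN_ge0 n L : 0 <= pN n L.
Proof. exact: hyp_pmf_ge0. Qed.
Let pN_sum n : (\esum_(L in setT) (pN n L)%:E = 1)%E.
Proof. exact: esum_hyp_pmf. Qed.
Let surv0 n : hsurv beta n.+1 0 = 1.
Proof. exact: hsurv0. Qed.
Let surv_ge0 n k : 0 <= hsurv beta n.+1 k.
Proof. exact: expR_ge0. Qed.
Let surv_dec n k : hsurv beta n.+1 k.+1 <= hsurv beta n.+1 k.
Proof. exact: hsurv_dec. Qed.

Lemma expRM_lt_cvg0 (kap e : R) : 0 < kap -> 0 < e ->
  \forall n \near \oo, expR (- kap * n%:R) <= e.
Proof.
move=> kap0 e0.
have : (expR (- kap) ^+ n @[n --> \oo] --> (0 : R)).
  by apply: cvg_expr; rewrite ger0_norm ?expR_ge0 // expR_lt1; lra.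
move=> /cvgrPdist_le /(_ _ e0); apply: filterS => n.
by rewrite sub0r normrN ger0_norm ?exprn_ge0 ?expR_ge0 // -expRM_natr.
Qed.

(** The drift makes each size probability at most a power of a fixed ratio below 1, so [K0] cuts a
    geometric tail uniformly in [n]. *)
Lemma Prob_TN_low d e : 1 < 2 * beta 2%N -> 0 < d -> 0 < e -> exists K0, \forall n \near \oo,
  Prob (pN n) (fun L => (K0 < T L)%N && ((T L)%:R <= (g - d) * n%:R)) <= e.
Proof.
move=> lam1 d0 e0.
have [eta eta0 [n0 Hn0]] := drift_below b_ge0 b1 b_sum b_pos lam1 d0.
have eta1 : 1 < 1 + eta by lra.
have [t t0 [kap kap0 Ht]] := chernoff_exponent_lt0 ler01 eta1.
have rho1 : expR (- kap) < 1 by rewrite expR_lt1; lra.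
have [K0 HK0] := geometric_tail (expR_ge0 _) rho1 e0.
exists K0; near=> n.
have nn0 : (n0 <= n)%N by near: n; exact: nbhs_infty_ge.
rewrite (@Prob_TN_sum _ _ _ b_ge0 b1 n (fun k => (K0 < k)%N && (k%:R <= (g - d) * n%:R))).
apply: le_trans (HK0 n.+1).
rewrite [leLHS]big_mkcond [leRHS]big_mkcond /=; apply: ler_sum => k _.
case: ifP => [/andP[K0k kg]|_]; last by case: ifP => _; rewrite ?exprn_ge0 ?expR_ge0.
rewrite -ltnS K0k; apply: le_trans (size_law_le (surv0 n) (@surv_ge0 n) (@surv_dec n) t _) _.
  by rewrite -ltnS.
rewrite -expRM_natr ler_expR.
have h := Hn0 n k.+1 nn0 (ltn0Sn k) kg.
have et : expR t - 1 <= 0 by rewrite subr_le0 -expR0 ler_expR ltW.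
have h1 : (expR t - 1) * ((1 - hsurv beta n.+1 k.+1) * n%:R) <= (expR t - 1) * ((1 + eta) * k%:R).
  apply: ler_wnM2l => //; apply: le_trans h; rewrite ler_pM2l; last lra.
  by rewrite ler_nat.
have h2 : ((expR t - 1) * (1 + eta) - t * 1) * k%:R <= - kap * k%:R by apply: ler_wpM2r.
apply: le_trans h2; rewrite -mulrA; move: h1; move: (expR t - 1) (1 - _) => a b; lra.
Unshelve. all: by end_near. Qed.

Lemma Prob_TN_high d e : 0 < d -> 0 < e -> \forall n \near \oo,
  Prob (pN n) (fun L => (g + d) * n.+1%:R <= (T L)%:R) <= e.
Proof.
move=> d0 e0.
have [x [u [/andP[gx xg] x1 /andP[u0 ux] [n0 Hn0]]]] := drift_above b_ge0 b1 b_sum d0.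
have [t t0 [kap kap0 Ht]] := chernoff_exponent_gt0 u0 ux.
have x0 : 0 < x by lra.
near=> n.
have nn0 : (n0 <= n)%N by near: n; exact: nbhs_infty_ge.
have nbig : 2 / (g + d - x) <= n%:R by near: n; exact: nbhs_infty_ger.
(* The first integer above [x * n]; for large [n] it stays below [(g + d) * n.+1]. *)
pose K := (Num.truncn (x * n%:R)).+1.
have /andP[K1 K2] := truncn_itv (mulr_ge0 (ltW x0) (ler0n R n)).
have Kx : x * n%:R <= K%:R by rewrite ltW.
have Kx1 : K%:R <= x * n%:R + 1 by rewrite /K -natr1 lerD2r.
have [Kn eu] := Hn0 n K nn0 Kx Kx1.
apply: (@le_trans _ _ (expR (- kap * n%:R))); last first.
  by near: n; exact: expRM_lt_cvg0.
apply: (@le_trans _ _ (Prob (pN n) (fun L => (K < T L)%N))).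
  apply: (Prob_sub (@pN_ge0 n) (@pN_sum n)) => L.
  move=> gT; rewrite -(ltr_nat R); apply: le_lt_trans Kx1 _.
  apply: lt_le_trans gT; rewrite -natr1.
  move: nbig; rewrite ler_pdivrMr; last lra.
  nra.
rewrite (@Prob_TN_sum _ _ _ b_ge0 b1 n (fun k => (K < k)%N)).
apply: le_trans (size_law_tail_le (surv0 n) (@surv_ge0 n) (@surv_dec n) (ltW t0) Kn) _.
rewrite ler_expR.
have et : 0 <= expR t - 1 by rewrite subr_ge0 -expR0 ler_expR ltW.
have h1 : (expR t - 1) * (1 - hsurv beta n.+1 K) * n%:R <= (expR t - 1) * u * n%:R.
  by apply: ler_wpM2r => //; apply: ler_wpM2l.
have h2 : t * (x * n%:R) <= t * K%:R by rewrite ler_pM2l.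
have h3 : ((expR t - 1) * u - t * x) * n%:R <= - kap * n%:R by apply: ler_wpM2r.
apply: le_trans h3; move: h1 h2; rewrite mulrBl; lra.
Unshelve. all: by end_near. Qed.

(** The tilted size laws sum to 1, so the union over sizes costs no factor. The sign of [t] selects
    upper or lower deviations. *)
Lemma Prob_ZN_tilt n t (b kap : R) (Q : pred nat) :
  (forall k, (k < n.+1)%N -> Q k.+1 ->
     - (t * b) + (expR t - 1) * hrevealed beta n.+1 k.+1 <= - kap) ->
  Prob (pN n) (fun L => Q (T L) && (t * b <= t * (Z L).-1%:R)) <= expR (- kap).
Proof.
move=> HQ; rewrite (@Prob_TN_split _ _ _ b_ge0 n Q (fun L => t * b <= t * (Z L).-1%:R)).
pose beta' j := expR t * beta j.
have b_ge0' j : 0 <= beta' j by rewrite mulr_ge0 ?expR_ge0.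
have b1' : beta' 1%N = 0 by rewrite /beta' b1 mulr0.
have e0' : hsurv beta' n.+1 0 = 1 by rewrite hsurv0.
have sl0 k : 0 <= size_law (hsurv beta' n.+1) n k.
  by apply: size_law_ge0 => j; [exact: expR_ge0|exact: hsurv_dec].
apply: (@le_trans _ _ (\sum_(k < n.+1 | Q k.+1) expR (- kap) * size_law (hsurv beta' n.+1) n k)).
  apply: ler_sum => k Qk; apply: le_trans (Prob_ZN_le (v0 n) t b b_ge0 b1 (ltn_ord k)) _.
  by apply: ler_wpM2r; [exact: sl0|rewrite ler_expR; exact: HQ].
rewrite -mulr_sumr ler_piMr ?expR_ge0 // -(size_law_sum e0' n).
rewrite [leLHS]big_mkcond; apply: ler_sum => k _ /=.
by case: ifP => _ //; exact: sl0.
Qed.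

Lemma Prob_ZN_far del : 0 < del -> exists2 d, 0 < d & forall e, 0 < e -> \forall n \near \oo,
  Prob (pN n) (fun L => (`|(T L)%:R / n.+1%:R - g| <= d) && ~~ (`|(Z L)%:R / n.+1%:R - zlim| <= del)) <= e.
Proof.
move=> del0; have del3 : 0 < del / 3 by lra.
have g1 := gcrit_lt1 b_ge0 b_sum; have g0 := gcrit_ge0 b_ge0 b_sum.
have [d1 d10 [n0 Hn0]] := hrevealed_unif b_ge0 b0 b1 b_sum b_pos del3.
(* The second entry keeps the size strictly below [n.+1], as [hrevealed_unif] requires. *)
pose d := Num.min d1 ((1 - g) / 2).
have d0 : 0 < d by rewrite lt_min d10; lra.
exists d => // e e0; have e20 : 0 < e / 2 by lra.
set z := zlim in Hn0 *.
have g1' : 0 < 1 - g by lra.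
have z0 : 0 <= z.
  rewrite /z subr_ge0; apply: (@le_trans _ _ 0).
    by rewrite mulr_ge0_le0 // ?ln_le0 //; lra.
  by rewrite fine_ge0 // esum_ge0 // => k _; rewrite lee_fin mulr_ge0 ?exprn_ge0.
pose Q n k := `|k%:R / n.+1%:R - g| <= d.
have QK n K : (n0 <= n)%N -> (K <= n.+1)%N -> Q n K ->
    (z - del / 3) * n.+1%:R <= hrevealed beta n.+1 K <= (z + del / 3) * n.+1%:R.
  move=> nn0 Kn QK; have NR : 0 < n.+1%:R :> R by rewrite ltr0n.
  move: (QK); rewrite /Q /d le_min => /andP[Qd1 Qg].
  have KN : (K <= n)%N.
    rewrite -ltnS -(ltr_nat R); move: Qg => /ler_normlP[_]; rewrite lerBlDr ler_pdivrMr // => h.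
    by apply: le_lt_trans h _; rewrite gtr_pMl //; lra.
  have /ler_normlP[h1 h2] := Hn0 n K nn0 KN Qd1.
  rewrite -ler_pdivlMr // -[X in _ && X]ler_pdivrMr //; move: h1 h2.
  by move: (_ / n.+1%:R) => w h1 h2; apply/andP; split; lra.
have zu : z + del / 3 < z + del / 2 by lra.
have zu0 : 0 <= z + del / 3 by lra.
have up : \forall n \near \oo, Prob (pN n) (fun L => Q n (T L) &&
    ((z + del / 2) * n.+1%:R <= (Z L).-1%:R)) <= e / 2.
  have [t t0 [kap kap0 Ht]] := chernoff_exponent_gt0 zu0 zu.
  near=> n; have nn0 : (n0 <= n)%N by near: n; exact: nbhs_infty_ge.
  apply: (@le_trans _ _ (expR (- (kap * n.+1%:R)))); last first.
    apply: (@le_trans _ _ (expR (- kap * n%:R))); last by near: n; exact: expRM_lt_cvg0.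
    by rewrite ler_expR mulNr lerN2 ler_pM2l // ler_nat.
  have := @Prob_ZN_tilt n t ((z + del / 2) * n.+1%:R) (kap * n.+1%:R) (Q n).
  under eq_fun do rewrite ler_pM2l //.
  apply=> k kn Qk; have /andP[_ h] := QK n k.+1 nn0 kn Qk.
  have et : 0 <= expR t - 1 by rewrite subr_ge0 -expR0 ler_expR ltW.
  have h1 := ler_wpM2l et h.
  have h2 : ((expR t - 1) * (z + del / 3) - t * (z + del / 2)) * n.+1%:R <= - kap * n.+1%:R.
    by apply: ler_wpM2r.
  move: h1 h2; move: (expR t - 1) (hrevealed _ _ _) (n.+1%:R) => a h' N; lra.
have down : del < z -> \forall n \near \oo, Prob (pN n) (fun L => Q n (T L) &&
    ((Z L).-1%:R <= (z - del / 2) * n.+1%:R)) <= e / 2.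
  move=> delz; have v0' : 0 <= z - del / 2 by lra.
  have vz : z - del / 2 < z - del / 3 by lra.
  have [t t0 [kap kap0 Ht]] := chernoff_exponent_lt0 v0' vz.
  near=> n; have nn0 : (n0 <= n)%N by near: n; exact: nbhs_infty_ge.
  apply: (@le_trans _ _ (expR (- (kap * n.+1%:R)))); last first.
    apply: (@le_trans _ _ (expR (- kap * n%:R))); last by near: n; exact: expRM_lt_cvg0.
    by rewrite ler_expR mulNr lerN2 ler_pM2l // ler_nat.
  have := @Prob_ZN_tilt n t ((z - del / 2) * n.+1%:R) (kap * n.+1%:R) (Q n).
  under eq_fun do rewrite ler_nM2l //.
  apply=> k kn Qk; have /andP[h _] := QK n k.+1 nn0 kn Qk.
  have et : expR t - 1 <= 0 by rewrite subr_le0 -expR0 ler_expR ltW.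
  have h1 := ler_wnM2l et h.
  have h2 : ((expR t - 1) * (z - del / 3) - t * (z - del / 2)) * n.+1%:R <= - kap * n.+1%:R.
    by apply: ler_wpM2r.
  move: h1 h2; move: (expR t - 1) (hrevealed _ _ _) (n.+1%:R) => a h' N; lra.
have Z1 n (L : hypergraph n.+1) : (Z L)%:R = (Z L).-1%:R + 1 :> R by rewrite natr1 ZNE.
(* If [z <= del], the count cannot be too small since it is non-negative, and the lower Chernoff
   bound would lack a meaningful level. *)
have [delz|zdel] := ltP del z.
  have := down delz => {}down.
  near=> n; have NR : 0 < n.+1%:R :> R by rewrite ltr0n.
  have nbig : 2 / del <= n.+1%:R by apply: (@le_trans _ _ n%:R); [near: n; exact: nbhs_infty_ger|rewrite ler_nat].
  have nb : 1 <= del / 2 * n.+1%:R by move: nbig; rewrite ler_pdivrMr // => h; lra.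
  have U : Prob (pN n) (fun L => Q n (T L) && ((z + del / 2) * n.+1%:R <= (Z L).-1%:R)) <= e / 2.
    by near: n; exact: up.
  have D : Prob (pN n) (fun L => Q n (T L) && ((Z L).-1%:R <= (z - del / 2) * n.+1%:R)) <= e / 2.
    by near: n; exact: down.
  rewrite [leRHS](splitr e); apply: le_trans (lerD U D).
  apply: le_trans (Prob_orb (@pN_ge0 n) (@pN_sum n) _ _).
  apply: (Prob_sub (@pN_ge0 n) (@pN_sum n)) => L /andP[QT /negP nZ].
  rewrite -/(Q n (T L)) in QT; rewrite QT /=; apply/orP.
  have [zZ|Zz] := leP ((z + del / 2) * n.+1%:R) (Z L).-1%:R; [by left|right].
  rewrite leNgt; apply/negP => zZ; apply: nZ.
  by rewrite ler_norml lerBrDr lerBlDr ler_pdivlMr // ler_pdivrMr // Z1; apply/andP; split; lra.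
near=> n; have NR : 0 < n.+1%:R :> R by rewrite ltr0n.
have nbig : 2 / del <= n.+1%:R by apply: (@le_trans _ _ n%:R); [near: n; exact: nbhs_infty_ger|rewrite ler_nat].
have nb : 1 <= del / 2 * n.+1%:R by move: nbig; rewrite ler_pdivrMr // => h; lra.
apply: (@le_trans _ _ (e / 2)); last lra.
apply: le_trans (_ : _ <= Prob (pN n) (fun L => Q n (T L) && ((z + del / 2) * n.+1%:R <= (Z L).-1%:R))) _.
  apply: (Prob_sub (@pN_ge0 n) (@pN_sum n)) => L /andP[QT /negP nZ].
  rewrite -/(Q n (T L)) in QT; rewrite QT /=.
  rewrite leNgt; apply/negP => zZ; apply: nZ.
  have Zge : 0 <= (Z L)%:R / n.+1%:R :> R by rewrite divr_ge0.
  rewrite ler_norml lerBrDr lerBlDr; apply/andP; split.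
    by apply: le_trans Zge; rewrite addrC subr_le0.
  by rewrite ler_pdivrMr // Z1; lra.
by near: n; exact: up.
Unshelve. all: by end_near. Qed.

(* If [2 * beta 2 <= 1], small domains already carry the full mass; otherwise the arrivals outrun
   the time up to time [g N]. *)
Lemma Prob_not_fluid del e : 0 < del -> 0 < e -> exists K0, forall K, (K0 <= K)%N -> \forall n \near \oo,
  Prob (pN n) (fun L => (K < T L)%N &&
    ~~ ((`|(T L)%:R / n.+1%:R - g| <= del) && (`|(Z L)%:R / n.+1%:R - zlim| <= del))) <= e.
Proof.
move=> del0 e0; have e20 : 0 < e / 2 by lra.
have [lam1|lam1] := leP (2 * beta 2%N) 1.
  have [K0 HK0] := sum_PM_subcritical b_ge0 b1 lam1 e20.
  exists K0 => K KK0; have := @Prob_TN_gt_cvg R beta v0 b_ge0 b1 K.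
  have lt : 1 - \sum_(k < K) PM beta k.+1 < e by have := HK0 K KK0; lra.
  move=> /cvgr_le /(_ _ lt); apply: filterS => n; apply: le_trans.
  by apply: (Prob_sub (@pN_ge0 n) (@pN_sum n)) => L /andP[].
have [d' d'0 Hd'] := Prob_ZN_far del0.
pose d := Num.min d' del; have d0 : 0 < d by rewrite lt_min d'0.
have d20 : 0 < d / 2 by lra.
have e40 : 0 < e / 4 by lra.
have [K0 HK0] := Prob_TN_low lam1 d20 e40.
have g0 := gcrit_ge0 b_ge0 b_sum; have g1 := gcrit_lt1 b_ge0 b_sum.
exists K0 => K KK0; near=> n.
have NR : 0 < n.+1%:R :> R by rewrite ltr0n.
have nbig : 2 / d <= n%:R by near: n; exact: nbhs_infty_ger.
have nb : 1 <= d / 2 * n%:R by move: nbig; rewrite ler_pdivrMr // => h; lra.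
have P1 : Prob (pN n) (fun L => (K0 < T L)%N && ((T L)%:R <= (g - d / 2) * n%:R)) <= e / 4.
  by near: n; exact: HK0.
have P2 : Prob (pN n) (fun L => (g + d) * n.+1%:R <= (T L)%:R) <= e / 4.
  by near: n; exact: Prob_TN_high.
have P3 : Prob (pN n) (fun L => (`|(T L)%:R / n.+1%:R - g| <= d') &&
    ~~ (`|(Z L)%:R / n.+1%:R - zlim| <= del)) <= e / 2.
  by near: n; exact: Hd'.
have -> : e = e / 4 + e / 4 + e / 2 by lra.
apply: le_trans (lerD (lerD P1 P2) P3).
apply: le_trans (lerD (Prob_orb (@pN_ge0 n) (@pN_sum n) _ _) (lexx _)).
apply: le_trans (Prob_orb (@pN_ge0 n) (@pN_sum n) _ _).
apply: (Prob_sub (@pN_ge0 n) (@pN_sum n)) => L /andP[KT].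
rewrite negb_and (leq_ltn_trans KK0 KT) /= -orbA.
have [//|hi /=] := leP ((g + d) * n.+1%:R) (T L)%:R; first by rewrite orbT.
have [//|lo /=] := leP (T L)%:R ((g - d / 2) * n%:R).
have Td : `|(T L)%:R / n.+1%:R - g| <= d.
  have w1 : (T L)%:R / n.+1%:R <= g + d by rewrite ler_pdivrMr // ltW.
  have w2 : g - d <= (T L)%:R / n.+1%:R.
    by rewrite ler_pdivlMr //; apply: le_trans (ltW lo); rewrite -natr1; nra.
  by rewrite ler_distl w2 w1.
move: Td; rewrite le_min => /andP[-> ->] /=; by [].
Unshelve. all: by end_near. Qed.

End FluidLimit.

(** * Convergence in distribution *)

Section OnePointNat.
Local Open Scope classical_set_scope.

(** In an unbounded set the tails generate a proper filter without cluster point, because points are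
    open. *)
Lemma compact_nat_bounded (U : set nat) : compact U -> exists K, forall m, U m -> (m < K)%N.
Proof.
move=> cU; apply/not_existsP => unb.
pose F : set_system nat := filter_from setT (fun n => U `&` [set m | (n <= m)%N]).
have FF : ProperFilter F.
  apply: filter_from_proper; first apply: filter_from_filter.
  - by exists 0%N.
  - move=> i j _ _; exists (maxn i j) => // m [Um /=]; rewrite geq_max => /andP[im jm].
    by split; split.
  - move=> n _; have /existsNP[m /not_implyP[Um /negP nm]] := unb n.
    by exists m; split=> //=; rewrite leqNgt.
have FU : F U by exists 0%N => // m [].
have [p [Up clp]] := cU F FF FU.
have Fp : F (U `&` [set m | (p.+1 <= m)%N]) by exists p.+1.
have [m [[_ /= pm] mp]] := clp _ _ Fp (discrete_set1 p).
by move: pm; rewrite mp ltnn.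
Qed.

Lemma continuous_at_infinity (R : realType)
    (f : one_point_compactification nat * one_point_compactification nat -> R) :
  continuous f -> forall e, 0 < e -> exists K, forall t z, (K <= t)%N -> (K <= z)%N ->
  `|f (Some t, Some z) - f (None, None)| <= e.
Proof.
move=> cf e e0; have /cvgrPdist_le /(_ e e0) := cf (None, None).
case=> -[A B] /= [[UA [cA _] HA] [UB [cB _] HB]] AB.
have [KA HKA] := compact_nat_bounded cA; have [KB HKB] := compact_nat_bounded cB.
exists (maxn KA KB) => t z; rewrite !geq_max => /andP[tA tB] /andP[zA zB].
rewrite distrC; apply: (AB (Some t, Some z)); split=> /=.
  by apply: HA; left; exists t => // /HKA; rewrite ltnNge tA.
by apply: HB; left; exists z => // /HKB; rewrite ltnNge zB.
Qed.
End OnePointNat.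

(** [h] is compared with the step function equal to [a k] on [X k] and to [ainf] elsewhere, whose
    expectation is explicit; on [bad] the two differ by at most [2 * C]. *)
Lemma Edisc_approx (R : realType) (W : choiceType) (p : W -> R)
    (p0 : forall t, 0 <= p t) (p1 : (\esum_(t in setT) (p t)%:E = 1)%E)
    (K : nat) (X : nat -> W -> bool) (bad : W -> bool) (h : W -> R)
    (a : nat -> R) (ainf C ep : R) :
  (forall w, `|h w| <= C) -> (forall k, `|a k| <= C) -> `|ainf| <= C -> 0 <= ep ->
  (forall w j k, X j w -> X k w -> j = k) ->
  (forall w k, (k < K)%N -> X k w -> ~~ bad w -> `|h w - a k| <= ep) ->
  (forall w, (forall k, (k < K)%N -> ~~ X k w) -> ~~ bad w -> `|h w - ainf| <= ep) ->
  `|Edisc p h - (\sum_(k < K) (a k - ainf) * Prob p (X k) + ainf)| <= ep + 2 * C * Prob p bad.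
Proof.
move=> hC aC aiC ep0 Xinj Hk Hinf.
pose A w := \sum_(k < K) (a k - ainf) * (X k w)%:R + ainf.
have C0 : 0 <= C := le_trans (normr_ge0 _) aiC.
have Ak w k : (k < K)%N -> X k w -> A w = a k.
  move=> kK Xk; rewrite /A (bigD1 (Ordinal kK)) //= Xk mulr1 big1 ?addr0 ?subrK // => j jk.
  case Xj : (X j w); last by rewrite mulr0.
  by move: jk; rewrite -val_eqE /= (Xinj _ _ _ Xj Xk) eqxx.
have Ainf w : (forall k, (k < K)%N -> ~~ X k w) -> A w = ainf.
  move=> nX; rewrite /A big1 ?add0r // => j _.
  by rewrite (negPf (nX j (ltn_ord j))) mulr0.
have AC w : `|A w| <= C.
  have [/existsP[k Xk]|] := boolP [exists k : 'I_K, X k w]; first by rewrite (Ak w k).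
  by rewrite negb_exists => /forallP nX; rewrite Ainf // => k kK; exact: (nX (Ordinal kK)).
have hA w : `|h w - A w| <= ep + 2 * C * (bad w)%:R.
  case bw : (bad w).
    apply: le_trans (ler_normB _ _) _; rewrite mulr1; have := hC w; have := AC w; lra.
  rewrite mulr0 addr0.
  have [/existsP[k Xk]|] := boolP [exists k : 'I_K, X k w].
    by rewrite (Ak w k) //; apply: Hk => //; rewrite bw.
  rewrite negb_exists => /forallP nX.
  have nX' k : (k < K)%N -> ~~ X k w by move=> kK; exact: (nX (Ordinal kK)).
  by rewrite Ainf //; apply: Hinf => //; rewrite bw.
have bh : bounded_fct h by exists C.
have bA : bounded_fct A by exists C.
have bX k : bounded_fct (fun w => (X k w)%:R : R) by exact: bounded_indic.
have bbad : bounded_fct (fun w => (bad w)%:R : R) by exact: bounded_indic.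
have bZ (c : R) (g : W -> R) : bounded_fct g -> bounded_fct (fun w => c * g w).
  by apply: boundedM; exact: bounded_cst.
have -> : \sum_(k < K) (a k - ainf) * Prob p (X k) + ainf = Edisc p A.
  rewrite /A EdiscD //; last by [exact: bounded_cst].
    rewrite Edisc_cst // Edisc_sum //; last by move=> k; exact: bZ.
    by congr (_ + _); apply: eq_bigr => k _; rewrite EdiscZ.
  by apply: bounded_sum => k; exact: bZ.
have -> : ep + 2 * C * Prob p bad = Edisc p (fun w => ep + 2 * C * (bad w)%:R).
  by rewrite EdiscD //; [rewrite Edisc_cst // EdiscZ|exact: bounded_cst|exact: bZ].
have br : bounded_fct (fun w => ep + 2 * C * (bad w)%:R).
  by apply: boundedD; [exact: bounded_cst|exact: bZ].
have h1 : Edisc p h <= Edisc p A + Edisc p (fun w => ep + 2 * C * (bad w)%:R).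
  rewrite -EdiscD //; apply: Edisc_le => //; first exact: boundedD.
  by move=> w; have := hA w; rewrite ler_norml => /andP[_ ?]; lra.
have h2 : Edisc p A <= Edisc p h + Edisc p (fun w => ep + 2 * C * (bad w)%:R).
  rewrite -EdiscD //; apply: Edisc_le => //; first exact: boundedD.
  by move=> w; have := hA w; rewrite ler_norml => /andP[? _]; lra.
rewrite ler_norml; apply/andP; split; lra.
Qed.

Section LawMInf.
Local Open Scope classical_set_scope.
Variables (R : realType) (beta : nat -> R).
Hypotheses (b_ge0 : forall k, 0 <= beta k) (b1 : beta 1%N = 0).

Let S := fine (\esum_(n in setT) (PM beta n)%:E)%E.

Lemma sum_PM_fin : (\esum_(n in setT) (PM beta n)%:E)%E = S%:E /\ S <= 1 /\
  (\sum_(k < K) PM beta k.+1 : R) @[K --> \oo] --> (S : R).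
Proof.
have P0 k : 0 <= PM beta k by exact: PM_ge0.
have le1 : (\esum_(n in setT) (PM beta n)%:E <= 1)%E.
  rewrite (esum_shift (P0) (PM0 beta)) -nneseries_esumT => [|k]; last by rewrite lee_fin.
  apply: lime_le; first by apply: is_cvg_nneseries => k _ _; rewrite lee_fin.
  by apply: nearW => n; rewrite sumEFin lee_fin big_mkord; exact: sum_PM_le1.
have fin : (\esum_(n in setT) (PM beta n)%:E)%E \is a fin_num.
  by rewrite ge0_fin_numE; [exact: le_lt_trans le1 (ltry _)|apply: esum_ge0 => k _; rewrite lee_fin].
have E : (\esum_(n in setT) (PM beta n)%:E)%E = S%:E by rewrite fineK.
split=> //; split; first by rewrite -lee_fin -E.
have : (\sum_(0 <= k < K) (PM beta k.+1)%:E)%E @[K --> \oo] --> S%:E.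
  rewrite -E (esum_shift (P0) (PM0 beta)) -nneseries_esumT => [|k]; last by rewrite lee_fin.
  by apply: is_cvg_nneseries => k _ _; rewrite lee_fin.
under eq_cvg do rewrite sumEFin big_mkord.
by move/fine_cvgP => [_].
Qed.

Lemma M_law_ge0 m : 0 <= M_law beta m.
Proof.
case: m => [n|] /=; first exact: PM_ge0.
by rewrite /PMinf subr_ge0; case: sum_PM_fin => _ [].
Qed.

Lemma esum_M_law : (\esum_(m in setT) (M_law beta m)%:E = 1)%E.
Proof.
have P0 m : (0 <= (M_law beta m)%:E)%E by rewrite lee_fin M_law_ge0.
rewrite (esumID [set None]) //; rewrite setTI setTI esum_set1 //.
rewrite (_ : ~` [set None] = range Some); last first.
  apply/seteqP; split=> [[n|] //= _|_ [n _ <-]] //; by exists n.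
rewrite (@reindex_esum _ _ _ setT (range Some) Some (fun m => (M_law beta m)%:E)) /=; last first.
  split; [by move=> n _; exists n|by move=> i j _ _ []|by move=> _ [n _ <-]; exists n].
case: sum_PM_fin => E _; rewrite E -EFinD; congr _%:E.
by rewrite /= /PMinf -/S subrK.
Qed.

Lemma Prob_M_law k : Prob (M_law beta) (fun m => m == Some k) = PM beta k.
Proof.
rewrite /Prob Edisc_ge0E //.
rewrite (_ : (\esum_(t in _) _)%E = (PM beta k)%:E) // -(esum_set1 (t := Some k) (a := fun m => (M_law beta m)%:E)) /=.
  rewrite [RHS]esum_mkcond; apply: eq_esum => m _; case: eqP => [->|mk] /=.
    by rewrite mulr1 mem_set.
  by rewrite mulr0 memNset.
by rewrite lee_fin PM_ge0.
Qed.

Lemma Prob_M_law_None : Prob (M_law beta) (fun m => m == None) = PMinf beta.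
Proof.
rewrite /Prob Edisc_ge0E //.
rewrite (_ : (\esum_(t in _) _)%E = (PMinf beta)%:E) // -(esum_set1 (t := None) (a := fun m => (M_law beta m)%:E)) /=.
  rewrite [RHS]esum_mkcond; apply: eq_esum => m _; case: eqP => [->|mk] /=.
    by rewrite mulr1 mem_set.
  by rewrite mulr0 memNset.
by rewrite lee_fin (M_law_ge0 None).
Qed.

End LawMInf.

Section Limit.
Local Open Scope classical_set_scope.
Variables (R : realType) (beta : nat -> R) (v0 : forall n : nat, 'I_n.+1).
Hypotheses (b_ge0 : forall k, 0 <= beta k) (b1 : beta 1%N = 0).

Local Notation pN n := (@hyp_pmf R beta n.+1).
Local Notation T L := (TN L (v0 _)).

Variables (h : forall n, hypergraph n.+1 -> R) (a : nat -> R) (ainf C : R).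
Hypotheses (hC : forall n L, `|@h n L| <= C) (aC : forall k, `|a k| <= C) (aiC : `|ainf| <= C).
Hypothesis h_fin : forall k e, 0 < e -> \forall n \near \oo,
  Prob (pN n) (fun L => (T L == k) && ~~ (`|h L - a k| <= e)) <= e.
Hypothesis h_inf : forall e, 0 < e -> exists K0, forall K, (K0 <= K)%N -> \forall n \near \oo,
  Prob (pN n) (fun L => (K < T L)%N && ~~ (`|h L - ainf| <= e)) <= e.

Let pN_ge0 n L : 0 <= pN n L.
Proof. exact: hyp_pmf_ge0. Qed.
Let pN_sum n : (\esum_(L in setT) (pN n L)%:E = 1)%E.
Proof. exact: esum_hyp_pmf. Qed.

Let arith (x y l m r q e D : R) : 0 <= D -> 0 <= r -> `|x - l| <= 2 * D * r -> `|l - m| <= r ->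
  `|y - m| <= r + 2 * D * q -> 2 * D * q <= 2 * D * (2 * r) -> r * (10 * (D + 1)) = e ->
  `|x - y| <= e.
Proof.
move=> D0 r0; rewrite !ler_norml => /andP[? ?] /andP[? ?] /andP[? ?] ? ?.
by have := mulr_ge0 D0 r0 => ?; apply/andP; split; lra.
Qed.

(** Common core of both limits: only the values [a] and [ainf] differ. The comparison with a step
    function of the size is made both for the hypergraph and for the law of [M]. *)
Lemma Edisc_hyp_cvg : Edisc (pN n) (@h n) @[n --> \oo] -->
  Edisc (M_law beta) (fun m => if m is Some k then a k else ainf).
Proof.
have C0 : 0 <= C := le_trans (normr_ge0 _) aiC.
have M0 := M_law_ge0 b_ge0 b1; have M1 := esum_M_law b_ge0 b1.
apply/cvgrPdist_le => e e0.
(* The errors add up to at most [(6 * C + 2) * ep], see [arith]. *)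
pose ep := e / (10 * (C + 1)).
have ep0 : 0 < ep by rewrite divr_gt0 ?mulr_gt0 //; lra.
have epe : ep * (10 * (C + 1)) = e by rewrite divfK // gt_eqF // mulr_gt0 //; lra.
have [K0 HK0] := h_inf ep0.
have [_ [_ Scv]] := sum_PM_fin b_ge0 b1; set S := fine _ in Scv.
have [K1 _ HK1] : \forall K \near \oo, `|S - \sum_(k < K) PM beta k.+1| <= ep.
  by move/cvgrPdist_le: Scv; apply.
pose K := maxn K0 K1.
have SK : `|S - \sum_(k < K) PM beta k.+1| <= ep by apply: HK1; rewrite /= leq_maxr.
pose lim := \sum_(k < K) (a k.+1 - ainf) * PM beta k.+1 + ainf.
have RHS : `|Edisc (M_law beta) (fun m => if m is Some k then a k else ainf) - lim| <= 2 * C * ep.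
  (* The value 0 is matched by no event [m == Some k.+1]; it has mass 0 by [PM0]. *)
  pose bad (m : one_point_compactification nat) := if m is Some j then (j == 0)%N || (K < j)%N else false.
  have := @Edisc_approx R _ (M_law beta) M0 M1 K (fun k m => m == Some k.+1) bad
    (fun m => if m is Some k then a k else ainf) (fun k => a k.+1) ainf C 0.
  have -> : Prob (M_law beta) bad = S - \sum_(k < K) PM beta k.+1.
    have E : Prob (M_law beta) bad + (\sum_(k < K) Prob (M_law beta) (fun m => m == Some k.+1) +
        Prob (M_law beta) (fun m => m == None)) = 1.
      rewrite /Prob -Edisc_sum //; last by move=> k; exact: bounded_indic.
      rewrite -EdiscD //; last by [exact: bounded_indic].
        rewrite -EdiscD //; last 2 first.
        - exact: bounded_indic.
        - by apply: boundedD; [apply: bounded_sum => k; exact: bounded_indic|exact: bounded_indic].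
        rewrite -[RHS](Edisc_cst M0 M1); congr (Edisc _); apply/funext => -[[|j]|] /=.
        - by rewrite big1 ?addr0 // => k _.
        - have [jK|Kj] := ltnP j K; last first.
            rewrite ltnS Kj /= big1 ?addr0 // => k _.
            by case: eqP => // -[e1]; move: (ltn_ord k); rewrite -e1 ltnNge Kj.
          rewrite ltnS leqNgt jK /= (bigD1 (Ordinal jK)) //= eqxx big1 ?addr0 ?add0r // => k.
          by rewrite -val_eqE /= => kj; case: eqP => // -[e1]; rewrite e1 eqxx in kj.
        - by rewrite big1 ?add0r // => k _.
      by apply: bounded_sum => k; exact: bounded_indic.
    move: E; rewrite Prob_M_law_None // /PMinf -/S.
    under eq_bigr do rewrite Prob_M_law //.
    lra.
  under eq_bigr do rewrite Prob_M_law //.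
  rewrite -/lim add0r => H; apply: le_trans (H _ _ _ _ _ _ _) _ => //.
  - by case=> [k|].
  - by move=> m j k /eqP -> /eqP[].
  - by move=> m k _ /eqP -> _; rewrite subrr normr0.
  - move=> [[|j]|] nX //=; last by rewrite subrr normr0.
    rewrite -leqNgt => jK; have := nX j jK; by rewrite eqxx.
  - by apply: ler_wpM2l; [rewrite mulr_ge0|apply: le_trans (ler_norm _) SK].
(* Shares [ep] among the [K] bounded sizes. *)
pose ek := ep / (K%:R + 1).
have K10 : 0 < K%:R + 1 :> R by rewrite ltr_wpDl.
have ek0 : 0 < ek by rewrite divr_gt0.
have ekep : ek <= ep by rewrite ler_pdivrMr // ler_peMr ?lerDr // ltW.
have lim_cvg : (\sum_(k < K) (a k.+1 - ainf) * Prob (pN n) (fun L => T L == k.+1) + ainf : R) @[n --> \oo] --> (lim : R).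
  apply: cvgD; last exact: cvg_cst.
  apply: (@cvg_big R _ +%R 0 xpredT _ nat eventually (index_enum 'I_K)
    (fun k n => (a k.+1 - ainf) * Prob (pN n) (fun L => T L == k.+1)) (fun k => (a k.+1 - ainf) * PM beta k.+1)).
    exact: add_continuous.
  by move=> k _; apply: cvgMr; exact: Prob_TN_cvg.
have fin_near : \forall n \near \oo, forall k : 'I_K,
    Prob (pN n) (fun L => (T L == k.+1) && ~~ (`|h L - a k.+1| <= ek)) <= ek.
  by apply: filter_forall => k; exact: h_fin.
near=> n.
have finn : forall k : 'I_K, Prob (pN n) (fun L => (T L == k.+1) && ~~ (`|h L - a k.+1| <= ek)) <= ek.
  by near: n; exact: fin_near.
have infn : Prob (pN n) (fun L => (K < T L)%N && ~~ (`|h L - ainf| <= ep)) <= ep.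
  by near: n; apply: HK0; rewrite leq_maxl.
pose badk k L := (T L == k.+1) && ~~ (`|@h n L - a k.+1| <= ek).
pose badi L := (K < T L)%N && ~~ (`|@h n L - ainf| <= ep).
pose bad L := [exists k : 'I_K, badk k L] || badi L.
have Pbad : Prob (pN n) bad <= 2 * ep.
  apply: le_trans (Prob_orb (@pN_ge0 n) (@pN_sum n) _ _) _.
  have -> : 2 * ep = ep + ep by lra.
  apply: lerD; last exact: infn.
  apply: le_trans (Prob_bigor (@pN_ge0 n) (@pN_sum n) K badk) _.
  apply: (@le_trans _ _ (\sum_(k < K) ek)).
    by apply: ler_sum => k _; exact: finn.
  by rewrite sumr_const card_ord -mulr_natl mulrA ler_pdivrMr // mulrC ler_pM2l // lerDl.
have LHS := @Edisc_approx R _ (pN n) (@pN_ge0 n) (@pN_sum n) K (fun k L => T L == k.+1) bad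
  (@h n) (fun k => a k.+1) ainf C ep (@hC n) (fun k => aC k.+1) aiC (ltW ep0).
have {LHS} : `|Edisc (pN n) (@h n) - (\sum_(k < K) (a k.+1 - ainf) * Prob (pN n) (fun L => T L == k.+1) + ainf)|
    <= ep + 2 * C * Prob (pN n) bad.
  apply: LHS.
  - by move=> L j k /eqP -> /eqP[].
  - move=> L k kK Tk; rewrite negb_or negb_exists => /andP[/forallP /(_ (Ordinal kK))].
    by rewrite /badk /= Tk /= negbK => /le_trans le _; exact: le.
  - move=> L nT; rewrite negb_or => /andP[_]; rewrite /badi negb_and negbK => /orP[|//].
    rewrite -leqNgt => TK; have Tp := TN_gt0 v0 L.
    by have := nT (T L).-1; rewrite /= (prednK Tp) eqxx TK => /(_ isT).
have near_lim : `|lim - (\sum_(k < K) (a k.+1 - ainf) * Prob (pN n) (fun L => T L == k.+1) + ainf)| <= ep.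
  by near: n; move/cvgrPdist_le: lim_cvg; apply.
have Cbad : 2 * C * Prob (pN n) bad <= 2 * C * (2 * ep) by apply: ler_wpM2l => //; rewrite mulr_ge0.
move=> near_LHS; exact: arith C0 (ltW ep0) RHS near_lim near_LHS Cbad epe.
Unshelve. all: by end_near. Qed.

End Limit.

Local Open Scope classical_set_scope.
Local Open Scope ring_scope.

Theorem theorem6p2 (R : realType) (beta : nat -> R) (v0 : forall n : nat, 'I_n.+1) :
  (forall k, 0 <= beta k) -> beta 0%N = 0 -> beta 1%N = 0 -> 0 < beta 2%N ->
  (\esum_(k in [set: nat]) (k%:R * beta k)%:E < +oo)%E ->
  (forall x : R, 0 < x < gcrit beta -> betaD beta x + ln (1 - x) > 0) ->
  conv_in_dist (S := (one_point_compactification nat * one_point_compactification nat)%type)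
    (fun n => hyp_pmf beta (N := n.+1))
    (fun n (L : hypergraph n.+1) => (Some (TN L (v0 n)), Some (ZN L (v0 n))))
    (M_law beta) (fun m => (m, m))
  /\
  conv_in_dist (S := (R * R)%type)
    (fun n => hyp_pmf beta (N := n.+1))
    (fun n (L : hypergraph n.+1) =>
       ((TN L (v0 n))%:R / n.+1%:R, (ZN L (v0 n))%:R / n.+1%:R))
    (M_law beta)
    (fun m => if m is None then
                (gcrit beta,
                 betaF beta (gcrit beta) - (1 - gcrit beta) * ln (1 - gcrit beta))
              else (0, 0)).
Proof.
move=> b_ge0 b0 b1 _ b_sum b_pos.
have pN_ge0 n L : 0 <= @hyp_pmf R beta n.+1 L by exact: hyp_pmf_ge0.
have pN_sum n : (\esum_(L in setT) (@hyp_pmf R beta n.+1 L)%:E = 1)%E by exact: esum_hyp_pmf.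
split=> f cf [C hC].
  have -> : f \o (fun m => (m, m)) =
      (fun m => if m is Some k then f (Some k, Some k) else f (None, None)).
    by apply/funext => -[].
  apply: (@Edisc_hyp_cvg R beta v0 b_ge0 b1 _ _ _ C) => //.
  - by move=> n L; exact: hC.
  - move=> k e e0; have := @Prob_TN_neq_ZN R beta v0 b_ge0 b0 b1 k e e0.
    apply: filterS => n; apply: le_trans.
    apply: (Prob_sub (@pN_ge0 n) (@pN_sum n)) => L /andP[/eqP Tk ne].
    rewrite Tk eqxx /=; apply: contra ne => /eqP Zk.
    by rewrite /= Tk Zk subrr normr0 ltW.
  - move=> e e0; have [K0 HK0] := continuous_at_infinity cf e0.
  exists K0 => K KK0; near=> n; rewrite (_ : Prob _ _ = 0) ?ltW //.
  rewrite -[RHS](Edisc_cst (@pN_ge0 n) (@pN_sum n) 0); congr (Edisc _); apply/funext => L.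
  case KT: (K < TN L (v0 n))%N => //=.
  have KT' : (K0 <= TN L (v0 n))%N by apply: leq_trans KK0 (ltnW KT).
  by rewrite HK0 // (leq_trans KT') // leq_TN_ZN.
set g := gcrit beta; set z := betaF beta g - _.
have -> : f \o (fun m => if m is None then (g, z) else (0, 0)) =
    (fun m : one_point_compactification nat => if m is Some k then f (0, 0) else f (g, z)).
  by apply/funext => -[].
have ball_at x y e : 0 < e -> exists2 d, 0 < d &
    forall u v, `|u - x| <= d -> `|v - y| <= d -> `|f (u, v) - f (x, y)| <= e.
  move=> e0; have /cvgrPdist_le /(_ e e0) := cf (x, y).
  case=> -[A B] /= [/nbhs_ballP[d1 /= d10 H1] /nbhs_ballP[d2 /= d20 H2]] AB.
  exists (Num.min d1 d2 / 2); first by rewrite divr_gt0 // lt_min d10.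
  have d0 : 0 < Num.min d1 d2 by rewrite lt_min d10.
  have dd : Num.min d1 d2 / 2 < Num.min d1 d2 by rewrite ltr_pdivrMr // ltr_pMr // ltr1n.
  move=> u v ux vy; rewrite distrC; apply: (AB (u, v)); split => /=.
    by apply: H1; rewrite /ball /= distrC; apply: le_lt_trans ux _; apply: lt_le_trans dd _; rewrite ge_min lexx.
  by apply: H2; rewrite /ball /= distrC; apply: le_lt_trans vy _; apply: lt_le_trans dd _; rewrite ge_min lexx orbT.
apply: (@Edisc_hyp_cvg R beta v0 b_ge0 b1 _ _ _ C) => //.
- by move=> n L; exact: hC.
- move=> k e e0; have [d d0 Hd] := ball_at 0 0 e e0.
  near=> n; apply: le_trans (_ : _ <= Prob (@hyp_pmf R beta n.+1)
      (fun L => (TN L (v0 n) == k) && (ZN L (v0 n) != k))) _; last first.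
    by near: n; exact: Prob_TN_neq_ZN.
  apply: (Prob_sub (@pN_ge0 n) (@pN_sum n)) => L /andP[/eqP Tk ne].
  rewrite Tk eqxx /=; apply: contra ne => /eqP Zk.
  (* A bounded size, with equally many hyperedges, is negligible after rescaling. *)
  have kd : `|k%:R / n.+1%:R - 0| <= d :> R.
    rewrite subr0 ger0_norm ?divr_ge0 // ler_pdivrMr ?ltr0n // mulrC -ler_pdivrMr //.
    by apply: (@le_trans _ _ n%:R); [near: n; exact: nbhs_infty_ger|rewrite ler_nat].
  by rewrite /= Tk Zk; exact: Hd.
- move=> e e0; have [d d0 Hd] := ball_at g z e e0.
have [K0 HK0] := @Prob_not_fluid R beta v0 b_ge0 b0 b1 b_sum b_pos d e d0 e0.
exists K0 => K KK0; apply: filterS (HK0 K KK0) => n; apply: le_trans.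
apply: (Prob_sub (@pN_ge0 n) (@pN_sum n)) => L /andP[-> /=].
by apply: contra => /andP[h1 h2]; exact: Hd.
Unshelve. all: by end_near. Qed.
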